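(* Let $n\ge1$, let $v=\mathrm{diag}(v_1,\dots,v_n,-v_n,\dots,-v_1)\in\operatorname{int}\mathfrak a^+$ and $m\in\{\pm1\}^n$. Fix small $0<\varepsilon<1$. (1) There are constants $c_1,c_2>0$, possibly depending on $\varepsilon$ but not on $T$, such that for all sufficiently large $T$, $$c_1e^{\rho_{\mathrm{Sp}_{2n}}(v)T}\le\#\{(\lambda(\gamma),m(\gamma)):\gamma\in\mathrm{Sp}_{2n}(\mathbb Z),\ \|\lambda(\gamma)-Tv\|\le\varepsilon,\ m(\gamma)=m\}\le c_2e^{\rho_{\mathrm{Sp}_{2n}}(v)T}.$$ (2) There exist $C_1,C_2>0$ such that for all sufficiently large $T>1$, $$C_1e^{\rho_{\mathrm{Sp}_{2n}}(v)T}\le\#\{[\gamma]\in[\mathrm{Sp}_{2n}(\mathbb Z)]:\ \|\lambda(\gamma)-Tv\|\le\varepsilon,\ m(\gamma)=m\}\le C_2e^{2\rho_{\mathrm{Sp}_{2n}}(v)T},$$ where $[\mathrm{Sp}_{2n}(\mathbb Z)]$ is the set of $\mathrm{Sp}_{2n}(\mathbb Z)$-conjugacy classes.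
   Context: $\mathrm{Sp}_{2n}(\mathbb R)=\{g\in\mathrm{SL}_{2n}(\mathbb R):g^tJ_ng=J_n\}$ with $J_n=\begin{pmatrix}0&\bar I_n\\-\bar I_n&0\end{pmatrix}$, $\bar I_n$ the $n\times n$ anti-diagonal identity matrix; $\mathrm{Sp}_{2n}(\mathbb Z)$ is the subgroup of integral matrices. $\mathfrak a^+=\{\mathrm{diag}(v_1,\dots,v_n,-v_n,\dots,-v_1):v_1\ge\dots\ge v_n\ge0\}$, with interior $\operatorname{int}\mathfrak a^+$ given by $v_1>\dots>v_n>0$; elements are identified with vectors in $\mathbb R^{2n}$, equipped with a fixed norm $\|\cdot\|$. Put $\rho_{\mathrm{Sp}_{2n}}(v)=\sum_{i=1}^n(n+1-i)v_i$. For $g\in\mathrm{Sp}_{2n}(\mathbb R)$ the Jordan projection $\lambda(g)=(\lambda_1(g),\dots,\lambda_n(g),-\lambda_n(g),\dots,-\lambda_1(g))\in\mathfrak a^+$ is the vector of logarithms of the moduli of the eigenvalues of $g$, with multiplicity, in non-increasing order. $g$ is loxodromic if $\lambda(g)\in\operatorname{int}\mathfrak a^+$; then all eigenvalues are real and are $m_i(g)e^{\pm\lambda_i(g)}$, $1\le i\le n$, with $m_i(g)\in\{\pm1\}$, and $m(g)=(m_1(g),\dots,m_n(g))$. For $T$ sufficiently large every $\gamma$ with $\|\lambda(\gamma)-Tv\|\le\varepsilon$ is loxodromic. *)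

(* Defs.v *)
From HB Require Import structures.
From mathcomp Require Import all_boot all_order all_algebra.
From mathcomp Require Import complex.
From mathcomp Require Import all_classical all_reals all_analysis.

Set Implicit Arguments.
Unset Strict Implicit.
Unset Printing Implicit Defensive.

Import Order.TTheory GRing.Theory Num.Theory.
Import numFieldNormedType.Exports.

Local Open Scope classical_set_scope.
Local Open Scope ring_scope.
Local Open Scope complex_scope.

Section Symplectic.
Context {R : realType} {n : nat}.

Definition antidiag_mx : 'M[R]_n := \matrix_(i, j) (j == rev_ord i)%:R.

Definition sympl_form : 'M[R]_(n + n) :=
  block_mx 0 antidiag_mx (- antidiag_mx) 0.

Definition Sp : set 'M[R]_(n + n) :=
  [set g | \det g = 1 /\ g^T *m sympl_form *m g = sympl_form].

Definition SpZ : set 'M[R]_(n + n) :=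
  Sp `&` [set g | forall i j, g i j \is a Num.int].

Definition SpZ_class (g : 'M[R]_(n + n)) : set 'M[R]_(n + n) :=
  [set p *m g *m invmx p | p in SpZ].

(* The diagonal matrix diag(w_1, .., w_n, - w_n, .., - w_1) is identified with
   the row vector of its diagonal entries. *)
Definition int_weyl_chamber : set 'rV[R]_(n + n) :=
  [set row_mx w (\row_i - w 0 (rev_ord i)) | w in
    [set w : 'rV[R]_n | (forall i j : 'I_n, (i < j)%N -> w 0 j < w 0 i) /\
                        (forall i : 'I_n, 0 < w 0 i)]].

(* Indices are 0-based: the coefficient n + 1 - i of the i-th coordinate
   becomes n - i. *)
Definition rho (v : 'rV[R]_(n + n)) : R :=
  \sum_(i < n) (n - i)%:R * v 0 (lshift n i).

(* The complex roots of the characteristic polynomial, with multiplicity, in an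
   unspecified order. *)
Definition eigenvalues (g : 'M[R]_(n + n)) : seq R[i] :=
  sval (closed_field_poly_normal
          (map_poly (real_complex R) (char_poly g))).

Definition jordan (g : 'M[R]_(n + n)) : 'rV[R]_(n + n) :=
  let s := sort (fun x y : R => y <= x)
             [seq ln (ComplexField.Normc.normc z) | z <- eigenvalues g] in
  \row_i s`_i.

Definition is_sign_vector (s : 'rV[R]_n) : Prop :=
  forall i, s 0 i = 1 \/ s 0 i = - 1.

Definition is_signature (g : 'M[R]_(n + n)) (s : 'rV[R]_n) : Prop :=
  is_sign_vector s /\
  let l i := jordan g 0 (lshift n i) in
  perm_eq (eigenvalues g)
    ([seq (s 0 i * expR (l i))%:C | i <- enum 'I_n] ++
     [seq (s 0 i * expR (- l i))%:C | i <- enum 'I_n]).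

(* A loxodromic element of Sp has exactly one signature; the default value is
   only a totalization. *)
Definition signature (g : 'M[R]_(n + n)) : 'rV[R]_n :=
  xget (const_mx 1) (is_signature g).

Definition is_norm (N : 'rV[R]_(n + n) -> R) : Prop :=
  [/\ forall x y, N (x + y) <= N x + N y,
      forall (a : R) x, N (a *: x) = `|a| * N x
    & forall x, N x = 0 -> x = 0].

Definition SpZ_near (N : 'rV[R]_(n + n) -> R) (v : 'rV[R]_(n + n))
    (m : 'rV[R]_n) (eps T : R) : set 'M[R]_(n + n) :=
  [set g | [/\ SpZ g, N (jordan g - T *: v) <= eps & signature g = m]].

End Symplectic.

(* Main.v *)
Require Import Defs.
From mathcomp Require Import all_boot all_order all_algebra.
From mathcomp Require Import all_classical all_reals all_analysis.
From mathcomp Require Import complex.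
From mathcomp Require Import ring lra zify.
Import Order.TTheory GRing.Theory Num.Theory.
Import numFieldNormedType.Exports.
Local Open Scope ring_scope.

Set Implicit Arguments.
Unset Strict Implicit.
Unset Printing Implicit Defensive.

(** Put X_k = exp (T (v_1 + ... + v_k)), so that X_1 ... X_n = exp (rho(v) T).

    The pairs are counted through characteristic polynomials. For a regular element the
    pair (lambda, m) and the characteristic polynomial determine each other
    ([pair_of_char_poly], [char_poly_of_pair]). The polynomial is monic, integral and
    palindromic, so [n] coefficients determine it, and the k-th of them, an elementary
    symmetric function of the eigenvalues, is O(X_k) ([char_poly_coef_le]). This leaves
    O(X_1 ... X_n) possibilities ([pair_count_le]).

    Conversely, take integers c_k between X_k and (1 + delta) X_k, give them the signs that
    the signs m prescribe, and make them the coefficients of a palindromic polynomial. Near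
    +-exp (T v_i) two consecutive terms of it dominate all the others by a power of exp T
    ([psum_gap]), and they change sign there ([root_near]). So all roots are real, with the
    prescribed signs and with logarithms as close to T v as wanted. Every monic palindromic
    integral polynomial of degree 2n with distinct real roots is the characteristic
    polynomial of an integral symplectic matrix, an explicit companion matrix
    ([companion_sympl], [companion_char_poly]). This produces a constant times X_1 ... X_n
    elements of the set ([companion_family]). Their characteristic polynomials are
    distinct, so their conjugacy classes are distinct too, and both lower bounds follow.

    The upper bound for classes comes from reduction theory and an elementary covering
    argument, instead of volumes. A regular [g] has real eigenvectors that form a symplectic
    frame [Q]. Reduction theory for the integral symplectic group ([reduction]) says that
    after conjugating [g] and rescaling the eigenvectors [Q] is bounded independently of [g]
    ([bounded_eigen_rep]). If [g] and [g'] have such frames with rows q_k and q'_l, and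
    eigenvalues x_k and x'_l, then the integral matrix [g^T *m J *m g'] is
    Q^-1 (x_k x'_l om(q_k, q'_l)) Q'^-T. It is therefore bounded as soon as all
    exp (T v_k) exp (T v_l) om(q_k, q'_l) are bounded, and then it takes finitely many
    values, that is, [g] and the value determine [g']. Hence the number of classes is at most
    a constant times the number of parts in a partition of the bounded frames such that
    these products are bounded within each part. [covering] constructs a partition with
    O(exp (2 rho(v) T)) parts by recursion on the rank, removing the pair of coordinates with
    the largest weight and recording rounded coordinates of the top row of the frame. *)

(** * Symplectic frames on sets of coordinates *)

Section Frames.
Variables (R : realType) (n : nat).
Implicit Types (i j k l : 'I_(n + n)) (D E : {set 'I_(n + n)}).
Implicit Types (g h : 'M[R]_(n + n)) (x y u v : 'rV[R]_(n + n)).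

Definition sg k : R := if (k < n)%N then 1 else -1.

Lemma sg_rev k : sg (rev_ord k) = - sg k.
Proof.
rewrite /sg /=; case: k => k /= hk.
case: ltnP => h1; case: ltnP => h2; rewrite ?opprK //; lia.
Qed.

Lemma sgM k : sg k * sg k = 1.
Proof. by rewrite /sg; case: ifP; rewrite ?mulrNN mulr1. Qed.

Lemma normr_sg k : `|sg k| = 1.
Proof. by rewrite /sg; case: ifP; rewrite ?normrN normr1. Qed.

Lemma sg_int k : sg k \is a Num.int.
Proof. by rewrite /sg; case: ifP; rewrite ?rpredN rpred1. Qed.

Lemma rev_neq k : rev_ord k != k.
Proof. by apply/eqP => /(congr1 val) /=; case: k => k /= hk; lia. Qed.

Lemma eq_rev k l : (rev_ord k == l) = (k == rev_ord l).
Proof. by apply/eqP/eqP => [<-|->]; rewrite rev_ordK. Qed.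

Lemma sympl_formE k l :
  @sympl_form R n k l = sg k * (l == rev_ord k)%:R.
Proof.
rewrite /sympl_form /block_mx !mxE /sg.
case: (splitP k) => k' hk; rewrite !mxE; case: (splitP l) => l' hl; rewrite !mxE.
- rewrite mul1r; case: eqP => // /(congr1 val) /= ; rewrite hl hk.
  case: k' l' {hk hl} => k' hk' [l' hl'] /=; lia.
- rewrite mul1r -!val_eqE /= hl hk; congr (nat_of_bool _)%:R.
  case: k' l' {hk hl} => k' hk' [l' hl'] /=; lia.
- rewrite mulN1r; congr (- _).
  rewrite -!val_eqE /= hl hk; congr (nat_of_bool _)%:R.
  case: k' l' {hk hl} => k' hk' [l' hl'] /=; lia.
- rewrite mulN1r; case: eqP => [|_]; last by rewrite oppr0.
  move=> /(congr1 val) /=; rewrite hl hk.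
  case: k' l' {hk hl} => k' hk' [l' hl'] /=; lia.
Qed.

(** The symplectic form restricted to the coordinates in [D]; the recursions below work
    with sets [D] from which pairs of opposite coordinates are removed. *)
Definition om D x y := \sum_(l in D) sg l * x 0 l * y 0 (rev_ord l).

Lemma om_set0 x y : om finset.set0 x y = 0.
Proof. by rewrite /om big_set0. Qed.

Definition rev_closed D := forall l, l \in D -> rev_ord l \in D.

Lemma rev_closedE D l : rev_closed D -> (rev_ord l \in D) = (l \in D).
Proof. by move=> hD; apply/idP/idP => /hD; rewrite ?rev_ordK. Qed.

Lemma omC D x y : rev_closed D -> om D x y = - om D y x.
Proof.
move=> hD; rewrite /om (reindex_inj rev_ord_inj) /= -sumrN.
apply: eq_big => [l|l _]; first by rewrite rev_closedE.
by rewrite rev_ordK sg_rev; ring.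
Qed.

Lemma omDl D x y u : om D (x + y) u = om D x u + om D y u.
Proof. by rewrite /om -big_split /=; apply: eq_bigr => l _; rewrite mxE /=; ring. Qed.

Lemma omDr D u x y : om D u (x + y) = om D u x + om D u y.
Proof. by rewrite /om -big_split /=; apply: eq_bigr => l _; rewrite mxE /=; ring. Qed.

Lemma omZl D c x u : om D (c *: x) u = c * om D x u.
Proof. by rewrite /om mulr_sumr; apply: eq_bigr => l _; rewrite mxE /=; ring. Qed.

Lemma omZr D c u x : om D u (c *: x) = c * om D u x.
Proof. by rewrite /om mulr_sumr; apply: eq_bigr => l _; rewrite mxE /=; ring. Qed.

Lemma omNl D x u : om D (- x) u = - om D x u.
Proof. by rewrite -scaleN1r omZl mulN1r. Qed.

Lemma omNr D x u : om D u (- x) = - om D u x.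
Proof. by rewrite -scaleN1r omZr mulN1r. Qed.

Lemma om0l D u : om D 0 u = 0.
Proof. by rewrite -(scale0r 0) omZl mul0r. Qed.

Lemma om0r D u : om D u 0 = 0.
Proof. by rewrite -(scale0r 0) omZr mul0r. Qed.

Lemma om_sumr D (I : Type) (r : seq I) (P : pred I) (F : I -> 'rV[R]_(n + n)) u :
  om D u (\sum_(a <- r | P a) F a) = \sum_(a <- r | P a) om D u (F a).
Proof. by elim/big_rec2: _ => [|a y1 y2 _ <-]; rewrite ?om0r ?omDr. Qed.

Lemma omxx D x : rev_closed D -> om D x x = 0.
Proof. by move=> hD; have := omC x x hD; lra. Qed.

Lemma eq_om D x y u v :
    rev_closed D -> {in D, forall l, x 0 l = u 0 l} -> {in D, forall l, y 0 l = v 0 l} ->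
  om D x y = om D u v.
Proof.
by move=> hD hx hy; apply: eq_bigr => l lD; rewrite hx// hy// hD.
Qed.

Definition drop_pair D j := D :\ j :\ rev_ord j.

Lemma in_drop_pair D j l :
  (l \in drop_pair D j) = [&& l != rev_ord j, l != j & l \in D].
Proof. by rewrite !inE. Qed.

Lemma drop_pair_rev_closed D j : rev_closed D -> rev_closed (drop_pair D j).
Proof.
move=> hD l; rewrite !in_drop_pair rev_closedE// => /and3P[h1 h2 ->].
by rewrite (inj_eq rev_ord_inj) h2 /= andbT eq_rev h1.
Qed.

Lemma drop_pair_sub D j : drop_pair D j \subset D.
Proof. by apply/fintype.subsetP => l; rewrite in_drop_pair => /and3P[]. Qed.

Lemma big_drop_pair (F : 'I_(n + n) -> R) D j : rev_closed D -> j \in D ->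
  \sum_(l in D) F l = F j + F (rev_ord j) + \sum_(l in drop_pair D j) F l.
Proof.
move=> hD jD; rewrite (big_setD1 j)//= (big_setD1 (rev_ord j)) /= ?addrA//.
by rewrite !inE rev_neq hD.
Qed.

Lemma card_drop_pair D j : rev_closed D -> j \in D -> #|D| = #|drop_pair D j|.+2.
Proof.
move=> hD jD; rewrite (cardsD1 j D) jD (cardsD1 (rev_ord j)) /=.
by rewrite !inE rev_neq hD.
Qed.

Lemma om_drop_pair D j x y : rev_closed D -> j \in D ->
  om D x y = sg j * (x 0 j * y 0 (rev_ord j) - x 0 (rev_ord j) * y 0 j)
             + om (drop_pair D j) x y.
Proof.
move=> hD jD; rewrite /om (big_drop_pair _ hD jD) rev_ordK sg_rev; congr (_ + _).
by ring.
Qed.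

(** A symplectic basis of the coordinate space on [D], indexed by [E]: the second
    clause is the expansion of a vector in this basis, which replaces the equality of
    the cardinals of [E] and [D]. *)
Definition frame E D g :=
  {in E &, forall k l, om D (row k g) (row l g) = sg k * (l == rev_ord k)%:R} /\
  forall v, {in D, forall l,
    v 0 l = \sum_(k in E) sg k * om D v (row (rev_ord k) g) * g k l}.

(** Right multiplication by this matrix subtracts from a row the multiple of [x] that
    kills its [j]-th coordinate. *)
Definition pivot_proj j x : 'M[R]_(n + n) := 1%:M - (x 0 j)^-1 *: (delta_mx j 0 *m x).

Lemma pivot_projE j x v : v *m pivot_proj j x = v - (v 0 j / x 0 j) *: x.
Proof.
rewrite /pivot_proj mulmxBr mulmx1 -scalemxAr mulmxA -colE.
by rewrite [col j v]mx11_scalar mul_scalar_mx mxE scalerA mulrC.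
Qed.

Lemma row_proj g j x k : row k (g *m pivot_proj j x) = row k g - (g k j / x 0 j) *: x.
Proof. by rewrite row_mul pivot_projE mxE. Qed.

Lemma om_zero D j x y : rev_closed D -> j \in D -> x 0 j = 0 -> y 0 j = 0 ->
  om D x y = om (drop_pair D j) x y.
Proof. by move=> hD jD hx hy; rewrite (om_drop_pair _ _ hD jD) hx hy; ring. Qed.

Lemma om_row g D k l : om D (row k g) (row l g) =
  \sum_(b in D) sg b * g k b * g l (rev_ord b).
Proof. by apply: eq_bigr => b _; rewrite !mxE. Qed.

(** This is symplectic reduction. The rows orthogonal to [x], the [i]-th row, modulo
    [x] form a symplectic space, and eliminating the coordinate [j] with [x] identifies
    it with the coordinates other than [j] and its opposite. For the expansion of [v],
    extend [v] to [w] with [w j = 0] and orthogonal to [x]. *)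
Lemma frame_proj E D g i j :
  rev_closed E -> rev_closed D -> frame E D g -> i \in E -> j \in D -> g i j != 0 ->
  frame (drop_pair E i) (drop_pair D j) (g *m pivot_proj j (row i g)).
Proof.
move=> hE hD fg iE jD gij; have [h1 h2] := fg.
set g' := _ *m _.
have g'j k : row k g' 0 j = 0.
  by rewrite row_proj !mxE divfK ?subrr.
have om_x k : k \in drop_pair E i -> om D (row k g) (row i g) = 0.
  rewrite in_drop_pair => /and3P[ki' ki kE]; rewrite h1// eq_sym eq_rev eq_sym.
  by rewrite eq_sym (negPf ki') mulr0.
have om_x' k : k \in drop_pair E i -> om D (row i g) (row k g) = 0.
  by move=> /om_x h; rewrite omC// h oppr0.
split.
  move=> k l kE lE; rewrite -om_zero//.
  have [kE' lE'] : k \in E /\ l \in E.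
    by split; [move: kE | move: lE]; apply/fintype.subsetP/drop_pair_sub.
  rewrite /g' !row_proj -!scaleNr omDl !omDr !omZl !omZr om_x// om_x'// omxx//.
  by rewrite h1//; ring.
move=> v l lD.
pose c := sg j * om (drop_pair D j) v (row i g) / g i j.
pose w : 'rV[R]_(n + n) :=
  \row_a if a == j then 0 else if a == rev_ord j then c else v 0 a.
have wv : {in drop_pair D j, forall a, w 0 a = v 0 a}.
  by move=> a; rewrite in_drop_pair mxE => /and3P[/negPf-> /negPf-> _].
have wj : w 0 j = 0 by rewrite mxE eqxx.
have wj' : w 0 (rev_ord j) = c by rewrite mxE (negPf (rev_neq j)) eqxx.
have wx : om D w (row i g) = 0.
  rewrite (om_drop_pair _ _ hD jD) wj wj'.
  rewrite [X in _ + X](@eq_om _ _ _ _ (row i g) (drop_pair_rev_closed hD) wv)//.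
  by rewrite !mxE /c mul0r sub0r divfK// mulrN mulrA sgM mul1r addNr.
have hk k : k \in drop_pair E i ->
    om D w (row (rev_ord k) g) = om (drop_pair D j) v (row (rev_ord k) g').
  move=> kE; rewrite -(@eq_om _ w (row (rev_ord k) g') _ _ (drop_pair_rev_closed hD) wv)//.
  by rewrite -om_zero// row_proj -scaleNr omDr omZr wx mulr0 addr0.
pose a0 := sg i * om D w (row (rev_ord i) g).
have key b : b \in D ->
   w 0 b = a0 * g i b + \sum_(k in drop_pair E i)
              sg k * om (drop_pair D j) v (row (rev_ord k) g') * g k b.
  move=> bD; rewrite (h2 w b bD) (big_drop_pair _ hE iE) rev_ordK wx mulr0 mul0r addr0.
  by congr (_ + _); apply: eq_bigr => k kE; rewrite hk.
have keyj := key j jD; rewrite wj in keyj.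
have lD' : l \in D by move: lD; apply/fintype.subsetP/drop_pair_sub.
rewrite -wv// key//.
under [RHS]eq_bigr => k _.
  rewrite (_ : g' k l = g k l - g k j / g i j * g i l); last first.
    have := congr1 (fun m : 'rV_(n + n) => m 0 l) (row_proj g j (row i g) k).
    by rewrite !mxE.
  rewrite mulrBr (_ : _ * (g k j / _ * _) =
    sg k * om (drop_pair D j) v (row (rev_ord k) g') * g k j * (g i l / g i j)); last first.
    by ring.
  over.
rewrite sumrB -mulr_suml addrC; congr (_ + _).
have -> : \sum_(k in drop_pair E i)
    sg k * om (drop_pair D j) v (row (rev_ord k) g') * g k j = - (a0 * g i j).
  by apply/eqP; rewrite -addr_eq0 addrC; apply/eqP.
by field.
Qed.

Local Notation fullI := ([set: 'I_(n + n)]%SET).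

Lemma om_full x y : om fullI x y = \sum_l sg l * x 0 l * y 0 (rev_ord l).
Proof. by apply: eq_bigl => l; rewrite inE. Qed.

(** * Integral transvections *)

(** The symplectic transvection in the direction [xi], acting on rows from the right. *)
Definition tv (xi : 'rV[R]_(n + n)) (c : R) : 'M[R]_(n + n) :=
  1%:M + c *: (\col_k (sg k * xi 0 (rev_ord k)) *m xi).

Lemma tvE v xi c : v *m tv xi c = v + (c * om fullI v xi) *: xi.
Proof.
rewrite mulmxDr mulmx1 -scalemxAr mulmxA [v *m _]mx11_scalar mul_scalar_mx scalerA.
congr (_ + (_ * _) *: _); rewrite mxE om_full.
by apply: eq_bigr => l _; rewrite mxE; ring.
Qed.

Lemma row_tv g xi c k :
  row k (tv xi c *m g) = row k g + (c * (sg k * xi 0 (rev_ord k))) *: (xi *m g).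
Proof.
rewrite mulmxDl mul1mx !linearD /= -scalemxAl linearZ /= -mulmxA row_mul.
congr (_ + _); rewrite -scalerA; congr (_ *: _).
by rewrite [row k _]mx11_scalar mul_scalar_mx !mxE.
Qed.

Definition supp E (xi : 'rV[R]_(n + n)) := forall k, k \notin E -> xi 0 k = 0.

Definition mxint p q (A : 'M[R]_(p, q)) := forall a b, A a b \is a Num.int.

Lemma mxint_mul p q r (A : 'M[R]_(p, q)) (B : 'M[R]_(q, r)) :
  mxint A -> mxint B -> mxint (A *m B).
Proof. by move=> hA hB a b; rewrite mxE rpred_sum// => c _; rewrite rpredM. Qed.

(** The group generated by the integral transvections whose direction is supported in
    [E]. It lies in the integral symplectic group and, when [E] is closed under opposition, fixes
    the basis vectors off [E], so one can recurse on [E] without embedding smaller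
    symplectic groups. *)
Inductive tvg E : 'M[R]_(n + n) -> Prop :=
| tvg1 : tvg E 1%:M
| tvgS xi c g : mxint xi -> supp E xi -> c \is a Num.int -> tvg E g ->
    tvg E (tv xi c *m g).

Lemma tvgM E g h : tvg E g -> tvg E h -> tvg E (g *m h).
Proof.
elim=> [|xi c g' ixi sxi ic _ IH] hh; first by rewrite mul1mx.
by rewrite -mulmxA; apply: tvgS => //; exact: IH.
Qed.

Lemma tvg_tv E xi c : mxint xi -> supp E xi -> c \is a Num.int -> tvg E (tv xi c).
Proof. by move=> ? ? ?; rewrite -[tv _ _]mulmx1; apply: tvgS => //; exact: tvg1. Qed.

Lemma tvg_sub E E' g : E' \subset E -> tvg E' g -> tvg E g.
Proof.
move=> /fintype.subsetP sE; elim=> [|xi c g' ixi sxi ic _ IH]; first exact: tvg1.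
by apply: tvgS => // k kE; apply: sxi; apply: contra kE; exact: sE.
Qed.

Lemma tvg_row E g h k : rev_closed E -> k \notin E -> tvg E g -> row k (g *m h) = row k h.
Proof.
move=> hE kE; elim=> [|xi c g' ixi sxi ic _ IH]; first by rewrite mul1mx.
by rewrite -mulmxA row_tv sxi ?rev_closedE// !mulr0 scale0r addr0.
Qed.

Lemma tv_int xi c : mxint xi -> c \is a Num.int -> mxint (tv xi c).
Proof.
move=> ixi ic a b; rewrite !mxE rpredD ?rpred_nat// rpredM//.
by rewrite rpred_sum// => k _; rewrite !mxE !rpredM ?sg_int.
Qed.

Lemma tvg_int E g : tvg E g -> mxint g.
Proof.
elim=> [a b|xi c g' ixi sxi ic _ IH]; first by rewrite mxE rpred_nat.
by apply: mxint_mul => //; exact: tv_int.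
Qed.

Lemma tv_om x y xi c : om fullI (x *m tv xi c) (y *m tv xi c) = om fullI x y.
Proof.
have hT : rev_closed fullI by move=> ? _; rewrite inE.
rewrite !tvE omDl !omDr !omZl !omZr omxx// (@omC _ xi y)//; ring.
Qed.

Lemma om_symplE x y : om fullI x y = (x *m sympl_form *m y^T) 0 0.
Proof.
rewrite -mulmxA mxE om_full; apply: eq_bigr => k _.
rewrite mxE (bigD1 (rev_ord k))//= big1 ?addr0 => [|l /negPf lk].
  by rewrite sympl_formE eqxx mulr1 mxE; ring.
by rewrite sympl_formE lk mulr0 mul0r.
Qed.

Lemma sympl_formK : @sympl_form R n *m sympl_form = - 1%:M.
Proof.
apply/matrixP => k l; rewrite !mxE (bigD1 (rev_ord k))//= big1 ?addr0 => [|a /negPf ak].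
  by rewrite !sympl_formE eqxx rev_ordK sg_rev eq_sym mulr1 mulNr mulrN mulrA sgM mul1r.
by rewrite sympl_formE ak mulr0 mul0r.
Qed.

Lemma tv_sympl xi c : tv xi c *m sympl_form *m (tv xi c)^T = sympl_form.
Proof.
apply/matrixP => k l.
have h (A : 'M[R]_(n + n)) : A k l = ((delta_mx 0 k : 'rV[R]_(n + n)) *m A *m (delta_mx 0 l : 'rV_(n + n))^T) 0 0.
  by rewrite trmx_delta -rowE -colE !mxE.
rewrite h [RHS]h -[RHS]om_symplE -(tv_om _ _ xi c) om_symplE trmx_mul.
by rewrite !mulmxA.
Qed.

Lemma tvD xi c c' : tv xi c *m tv xi c' = tv xi (c + c').
Proof.
have hT : rev_closed fullI by move=> ? _; rewrite inE.
apply/row_matrixP => k; rewrite !rowE mulmxA !tvE omDl omZl omxx// mulr0 addr0.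
by rewrite -addrA -scalerDl mulrDl.
Qed.

Lemma det_tv xi c : \det (tv xi c) = 1.
Proof.
have J0 : \det (@sympl_form R n) != 0.
  have := congr1 determinant sympl_formK; rewrite det_mulmx.
  apply: contra_eqN => /eqP ->; rewrite mul0r eq_sym -scaleN1r detZ det1 mulr1.
  by rewrite expf_eq0 oppr_eq0 oner_eq0 andbF.
have := congr1 determinant (tv_sympl xi (c / 2)).
rewrite !det_mulmx det_tr mulrAC => /eqP; rewrite -subr_eq0 -{2}[\det sympl_form]mul1r -mulrBl.
rewrite mulf_eq0 (negPf J0) orbF subr_eq0 => /eqP.
by rewrite -det_mulmx tvD -splitr.
Qed.

Lemma sympl_tr (g : 'M[R]_(n + n)) : g *m sympl_form *m g^T = sympl_form ->
  g^T *m sympl_form *m g = sympl_form.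
Proof.
move=> h; have h1 : (g *m sympl_form) *m (- (g^T *m sympl_form)) = 1%:M.
  by rewrite mulmxN mulmxA h sympl_formK opprK.
have /(congr1 (mulmx^~ sympl_form)) := mulmx1C h1.
rewrite !mulNmx -!mulmxA sympl_formK mul1mx !mulmxN mulmx1 opprK.
by [].
Qed.

Lemma tvg_sympl E g : tvg E g -> g *m sympl_form *m g^T = sympl_form.
Proof.
elim=> [|xi c g' ixi sxi ic _ IH]; first by rewrite mul1mx trmx1 mulmx1.
rewrite trmx_mul !mulmxA -[tv _ _ *m g' *m _]mulmxA.
by rewrite -[_ *m _ *m g'^T]mulmxA IH tv_sympl.
Qed.

Lemma tvg_SpZ E g : tvg E g -> SpZ g.
Proof.
move=> hg; split; last exact: tvg_int hg.
split; last exact/sympl_tr/tvg_sympl/hg.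
elim: hg => [|xi c g' _ _ _ _ IH]; first by rewrite det1.
by rewrite det_mulmx det_tv IH mulr1.
Qed.

Lemma om_lin_comb E D g xi k : rev_closed E -> frame E D g -> supp E xi -> k \in E ->
  om D (row k g) (xi *m g) = sg k * xi 0 (rev_ord k).
Proof.
move=> hE [h1 _] sxi kE; rewrite mulmx_sum_row om_sumr (bigD1 (rev_ord k))//= big1.
  by rewrite addr0 omZr h1 ?rev_closedE// eqxx mulr1 mulrC.
move=> l lk; rewrite omZr; have [lE|lE] := boolP (l \in E); last by rewrite sxi// mul0r.
by rewrite h1// (negPf lk) !mulr0.
Qed.

Lemma frame_om E D g x y : frame E D g -> om D x y =
  \sum_(k in E) sg k * om D x (row (rev_ord k) g) * om D (row k g) y.
Proof.
move=> [_ h2]; rewrite {1}/om.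
under eq_bigr => b bD do rewrite (h2 x b bD) mulr_sumr mulr_suml.
rewrite exchange_big /=; apply: eq_bigr => k kE.
by rewrite [om D (row k g) y]/om mulr_sumr; apply: eq_bigr => b bD; rewrite mxE; ring.
Qed.

(** Multiplying by a transvection on the left applies to the rows of [g] the
    transvection in the direction [xi *m g], and this preserves the form. *)
Lemma frame_tv E D g xi c : rev_closed E -> rev_closed D -> frame E D g -> supp E xi ->
  frame E D (tv xi c *m g).
Proof.
move=> hE hD fg sxi; have [h1 h2] := fg.
have rowtv k : k \in E -> row k (tv xi c *m g) =
    row k g + (c * om D (row k g) (xi *m g)) *: (xi *m g).
  by move=> kE; rewrite row_tv (om_lin_comb hE fg sxi kE).
set u := xi *m g in rowtv *.
split.
  move=> k l kE lE; rewrite !rowtv// omDl !omDr !omZl !omZr omxx// h1//.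
  by rewrite (@omC _ u)//; ring.
move=> v l lD; set s := \sum_(k in E) _.
have exp (w : 'rV[R]_(n + n)) :
    w 0 l = \sum_(k in E) sg k * om D w (row (rev_ord k) g) * g k l by exact: h2.
have expu (w : 'rV[R]_(n + n)) := frame_om w u fg.
have e1 : s = \sum_(k in E) (sg k * om D v (row (rev_ord k) g) * g k l
   + c * u 0 l * (sg k * om D v (row (rev_ord k) g) * om D (row k g) u)
   - c * om D v u * (sg k * om D u (row (rev_ord k) g) * g k l)
   - c ^+ 2 * om D v u * u 0 l * (sg k * om D u (row (rev_ord k) g) * om D (row k g) u)).
  apply: eq_bigr => k kE; rewrite rowtv ?hE// omDr omZr (@omC _ (row _ g) u)//.
  have -> : (tv xi c *m g) k l = g k l + c * om D (row k g) u * u 0 l.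
    have := congr1 (fun m : 'rV_(n + n) => m 0 l) (rowtv k kE).
    by rewrite !mxE.
  by ring.
rewrite e1 !sumrB big_split /= -!mulr_sumr -!exp -!expu omxx//; ring.
Qed.

Lemma tvg_frame E D g h : rev_closed E -> rev_closed D -> tvg E h -> frame E D g ->
  frame E D (h *m g).
Proof.
move=> hE hD; elim=> [|xi c h' ixi sxi ic _ IH] fg; first by rewrite mul1mx.
by rewrite -mulmxA; apply: frame_tv => //; exact: IH.
Qed.

(** * Reduction theory *)

Lemma round_ex (t : R) : exists2 z, z \is a Num.int & `|t + z| <= 1 / 2.
Proof.
exists (- (Num.floor (t + 1 / 2))%:~R); first by rewrite rpredN intr_int.
have := floor_itv (t + 1 / 2); rewrite rmorphD /= => /andP[h1 h2].
by rewrite ler_norml; apply/andP; split; lra.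
Qed.

Lemma om_delta k x : om fullI (delta_mx 0 k) x = sg k * x 0 (rev_ord k).
Proof.
rewrite om_full (bigD1 k)//= big1 ?addr0 ?mxE ?eqxx ?mulr1//.
by move=> l /negPf lk; rewrite mxE lk andbF mulr0 mul0r.
Qed.

(** These are elements of the Heisenberg group that fixes [e_i]. The product of three
    transvections works since, for [mu] orthogonal to [e_i], the directions [mu + e_i],
    [mu] and [e_i] are mutually orthogonal and the quadratic terms cancel. *)
Lemma heisenberg_shear E i (z : 'I_(n + n) -> R) : rev_closed E -> i \in E ->
  (forall k, z k \is a Num.int) ->
  exists2 g, tvg E g & row i g = delta_mx 0 i /\
    {in drop_pair E i, forall k, row k g = delta_mx 0 k + z k *: delta_mx 0 i}.
Proof.
move=> hE iE iz.
have hT : rev_closed fullI by move=> ? _; rewrite inE.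
pose mu : 'rV[R]_(n + n) :=
  \row_k if k \in drop_pair E i then - sg k * z (rev_ord k) else 0.
pose ei : 'rV[R]_(n + n) := delta_mx 0 i.
have imu : mxint mu.
  by move=> a b; rewrite mxE; case: ifP => // _; rewrite rpredM ?rpredN ?sg_int.
have smu : supp E mu.
  move=> k kE; rewrite mxE; case: ifP => //; rewrite in_drop_pair (negPf kE).
  by rewrite !andbF.
have iei : mxint ei by move=> a b; rewrite mxE rpred_nat.
have sei : supp E ei.
  by move=> k kE; rewrite mxE eqxx; case: eqP => // ki; rewrite ki iE in kE.
exists (tv (mu + ei) 1 *m (tv mu (-1) *m tv ei (-1))).
  apply: tvgM; first apply: tvg_tv.
  - by move=> a b; rewrite mxE rpredD.
  - by move=> k kE; rewrite mxE smu// sei// addr0.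
  - by rewrite rpred1.
  by apply: tvgM; apply: tvg_tv => //; rewrite rpredN rpred1.
have mui' : mu 0 (rev_ord i) = 0 by rewrite mxE in_drop_pair eqxx.
have omeimu : om fullI ei mu = 0 by rewrite om_delta mui' mulr0.
have ommuei : om fullI mu ei = 0 by rewrite omC// omeimu oppr0.
split.
  rewrite rowE !mulmxA (tvE ei (mu + ei)) omDr omeimu omxx// addr0 mulr0 scale0r addr0.
  by rewrite (tvE ei mu) omeimu mulr0 scale0r addr0 tvE omxx// mulr0 scale0r addr0.
move=> k kE; have := kE; rewrite in_drop_pair => /and3P[ki' ki kE'].
have omk : om fullI (delta_mx 0 k) mu = z k.
  by rewrite om_delta mxE drop_pair_rev_closed// rev_ordK sg_rev opprK mulrA sgM mul1r.
have omki : om fullI (delta_mx 0 k) ei = 0.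
  by rewrite om_delta mxE eq_rev (negPf ki') andbF mulr0.
rewrite rowE !mulmxA (tvE _ (mu + ei)) omDr omk omki addr0 mul1r.
rewrite (tvE _ mu) omDl omk omZl omDl omxx// omeimu !addr0 mulr0 addr0.
rewrite (_ : _ + _ + _ = delta_mx 0 k + z k *: ei); last first.
  by rewrite mulN1r scaleNr [mu + _]addrC scalerDr -!addrA subrr addr0.
by rewrite tvE omDl omki omZl omxx// mulr0 addr0 mulr0 scale0r addr0.
Qed.

(** A shear adds integral multiples of row [i] to the other rows, so it can bring the
    entries of column [j] into the interval of length [`|g i j|] around 0. The row opposite
    to [i] is treated last, by a transvection in the direction [e_i] alone. *)
Lemma round_column E g i j : rev_closed E -> i \in E -> g i j != 0 ->
  exists h, [/\ tvg E h, row i (h *m g) = row i g,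
   {in drop_pair E i, forall k, exists z, row k (h *m g) = row k g + z *: row i g} &
   {in E, forall k, k != i -> `|(h *m g) k j| <= `|g i j| / 2}].
Proof.
move=> hE iE gij.
have ex_z (t : R) : exists2 z, z \is a Num.int & `|t + z * g i j| <= `|g i j| / 2.
  have [z iz hz] := round_ex (t / g i j); exists z => //.
  rewrite (_ : t + z * g i j = (t / g i j + z) * g i j); last by field.
  by rewrite normrM mulrC ler_wpM2l//; lra.
have [z hz] := choice (fun k => let: ex_intro2 z iz hz := ex_z (g k j) in
                         ex_intro _ z (conj iz hz)).
have [h1 th1 [h1i h1k]] := heisenberg_shear hE iE (fun k => proj1 (hz k)).
have [c ic hc] := ex_z ((h1 *m g) (rev_ord i) j).
pose ei : 'rV[R]_(n + n) := delta_mx 0 i.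
pose c' : R := - (sg i * c).
have rowh k : row k (tv ei c' *m (h1 *m g)) = row k (h1 *m g) +
    (c' * (sg k * (rev_ord k == i)%:R)) *: row i (h1 *m g).
  by rewrite row_tv mxE eqxx /= -rowE.
have rowi : row i (h1 *m g) = row i g by rewrite row_mul h1i -rowE.
have rowk k : k \in drop_pair E i -> row k (h1 *m g) = row k g + z k *: row i g.
  by move=> kE; rewrite row_mul h1k// mulmxDl -scalemxAl -!rowE.
exists (tv ei c' *m h1); split.
- apply: tvgM => //; apply: tvg_tv; last by rewrite rpredN rpredM ?sg_int.
    by move=> a b; rewrite mxE rpred_nat.
  by move=> k kE; rewrite mxE eqxx; case: eqP => // ki; rewrite ki iE in kE.
- by rewrite -mulmxA rowh (negPf (rev_neq _)) !mulr0 scale0r addr0.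
- move=> k kE; exists (z k).
  move: (kE); rewrite in_drop_pair => /and3P[ki' ki _].
  by rewrite -mulmxA rowh eq_rev (negPf ki') !mulr0 scale0r addr0 rowk.
- move=> k kE ki; have /(congr1 (fun m : 'rV_(n + n) => m 0 j)) := rowh k.
  rewrite mulmxA !mxE => ->.
  have [ki'|ki'] := eqVneq k (rev_ord i).
    rewrite ki' rev_ordK eqxx mulr1 sg_rev.
    have /(congr1 (fun m : 'rV_(n + n) => m 0 j)) := rowi; rewrite !mxE => ->.
    rewrite (_ : c' * - sg i = c); last by rewrite /c' mulrNN mulrAC sgM mul1r.
    by have := hc; rewrite mxE.
  rewrite eq_rev (negPf ki') mulr0 mulr0 mul0r addr0.
  have kE2 : k \in drop_pair E i by rewrite in_drop_pair ki' ki.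
  have /(congr1 (fun m : 'rV_(n + n) => m 0 j)) := rowk k kE2; rewrite !mxE => ->.
  by have [] := hz k.
Qed.

(** The sup norms of the rows of all [h *m g] are bounded below by [eta], so their
    infimum is positive and is nearly attained. *)
Lemma near_minimal_row E D g (eta : R) i0 : i0 \in E -> 0 < eta ->
  (forall h k, tvg E h -> k \in E -> exists2 l, l \in D & eta <= `|(h *m g) k l|) ->
  exists h i j, [/\ tvg E h, i \in E, j \in D,
    {in D, forall l, `|(h *m g) i l| <= `|(h *m g) i j|} &
    forall h' k, tvg E h' -> k \in E ->
      exists2 l, l \in D & 2 / 3 * `|(h *m g) i j| <= `|(h' *m g) k l|].
Proof.
move=> i0E eta0 low.
pose S : set R := fun e => exists h i j, [/\ tvg E h, i \in E, j \in D,
    {in D, forall l, `|(h *m g) i l| <= `|(h *m g) i j|} & e = `|(h *m g) i j|].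
have exmax h k : tvg E h -> k \in E -> exists2 j, j \in D &
    {in D, forall l, `|(h *m g) k l| <= `|(h *m g) k j|}.
  move=> th kE; have [l lD _] := low h k th kE.
  case: (@arg_maxP _ _ _ l (fun l => l \in D) (fun l => `|(h *m g) k l|) lD).
  by move=> j jD hj; exists j.
have Sge e : S e -> eta <= e.
  move=> [h [i [j [th iE jD hj ->]]]]; have [l lD hl] := low h i th iE.
  by apply: (le_trans hl); exact: hj.
have hS : has_inf S.
  split; last by exists eta => e /Sge.
  have [j jD hj] := exmax _ _ (tvg1 E) i0E.
  by exists `|(1%:M *m g) i0 j|; exists 1%:M, i0, j; split => //; exact: tvg1.
have infS : eta <= inf S by apply: lb_le_inf; [case: hS | move=> e /Sge].
have [e [h [i [j [th iE jD hj ->]]]] he] := @inf_adherent _ S (inf S / 2) (ltac:(lra)) hS.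
exists h, i, j; split => // h' k th' kE.
have [l lD hl] := exmax _ _ th' kE; exists l => //.
have : inf S <= `|(h' *m g) k l|.
  by apply: ge_inf; [case: hS | exists h', k, l].
lra.
Qed.

Lemma rowDZ g h k x (z : R) l : row k g = row k h + z *: x ->
  g k l = h k l + z * x 0 l.
Proof.
move=> /(congr1 (fun m : 'rV_(n + n) => m 0 l)).
by rewrite mxE [RHS]mxE [X in X + _]mxE [X in _ + X]mxE.
Qed.

Let d : R := (n + n)%:R.

Lemma sum_le D (F : 'I_(n + n) -> R) (M : R) : 0 <= M ->
  {in D, forall l, F l <= M} -> \sum_(l in D) F l <= d * M.
Proof.
move=> M0 hF; apply: (@le_trans _ _ (\sum_(l in D) M)); first exact: ler_sum.
rewrite sumr_const -mulr_natl ler_wpM2r// ler_nat.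
by apply: leq_trans (max_card _) _; rewrite card_ord.
Qed.

Lemma om_le D x y (M : R) : 0 <= M ->
  {in D, forall l, `|x 0 l * y 0 (rev_ord l)| <= M} -> `|om D x y| <= d * M.
Proof.
move=> M0 h; apply: (le_trans (ler_norm_sum _ _ _)).
apply: sum_le => // l lD; rewrite -mulrA normrM normr_sg mul1r; exact: h.
Qed.

Lemma frame_empty D g l : frame finset.set0 D g -> l \in D -> False.
Proof.
move=> [_ h2] lD; have := h2 (delta_mx 0 l) l lD.
by rewrite big1 ?mxE ?eqxx => [/eqP|k]; rewrite ?oner_eq0// inE.
Qed.

(** Reduction theory: every symplectic frame becomes, after multiplication by an element
    of the discrete group, a bounded matrix times a diagonal symplectic matrix [t], as in
    a Siegel set. Induct on [E]. Let [x] be a nearly shortest row, of sup norm [e] attained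
    at the coordinate [j], and project along [x]. A row of the projected frame that is much
    shorter than [e] would lift, with its [j]-th coordinate rounded to at most [e / 2], to a
    row shorter than [2 e / 3]; so the projected frame satisfies the hypothesis with [eta]
    replaced by [e / (12 d)], and the recursive call gives [e <= C t_l]. Lift the result by
    rounding again and put [t_j = e] and [t_j' = 1 / e] on the two removed coordinates. *)
Lemma reduction p : exists2 C : R, 1 <= C & forall E D g (eta : R),
  (#|E| <= p)%N -> rev_closed E -> rev_closed D -> frame E D g -> 0 < eta ->
  (forall h k, tvg E h -> k \in E -> exists2 l, l \in D & eta <= `|(h *m g) k l|) ->
  exists h (t : 'I_(n + n) -> R), [/\ tvg E h, forall l, 0 < t l,
    forall l, t l * t (rev_ord l) = 1,
    {in D, forall l, eta <= C * t l} &
    {in E & D, forall k l, `|(h *m g) k l| <= C * t l}].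
Proof.
elim: p => [|p [C' C'1 IH]].
  exists 1 => // E D g eta; rewrite leqn0 => /eqP/cards0_eq -> _ _ fg _ _.
  exists 1%:M, (fun=> 1); split => //; first exact: tvg1.
  - by move=> l; rewrite mulr1.
  - by move=> l /(frame_empty fg).
  - by move=> k l; rewrite inE.
have d0 : 0 <= d by exact: ler0n.
pose C1 := 12 * d * C'.
pose K := C1 ^+ 2 + 6.
pose C2 := (1 + d) * C' + C1.
have C10 : 0 <= C1 by rewrite /C1 !mulr_ge0//; lra.
have K0 : 6 <= K by rewrite /K lerDr sqr_ge0.
have C20 : 1 <= C2 by rewrite /C2; nra.
have dC0 : 0 <= d * C2 * C1 by rewrite !mulr_ge0//; lra.
exists (1 + K + d * C2 * C1 + C1 + C2); first by lra.
move=> E D g eta cE hE hD fg eta0 low.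
have [E0|[i0 i0E]] := set_0Vmem E.
  rewrite {}E0 in fg *.
  exists 1%:M, (fun=> 1); split => //; first exact: tvg1.
  - by move=> l; rewrite mulr1.
  - by move=> l /(frame_empty fg).
  - by move=> k l; rewrite inE.
have d1 : 1 <= d.
  by rewrite /d ler1n; case: (n + n)%N i0 {i0E} => // -[].
have [h1 [i [j [th1 iE jD hj low1]]]] := near_minimal_row i0E eta0 low.
have etaj : eta <= `|(h1 *m g) i j|.
  have [l lD hl] := low _ _ th1 iE; apply: (le_trans hl); exact: hj.
have fh := tvg_frame hE hD th1 fg.
have {}low1 h' k : tvg E h' -> k \in E ->
    exists2 l, l \in D & 2 / 3 * `|(h1 *m g) i j| <= `|(h' *m (h1 *m g)) k l|.
  by move=> th' kE; rewrite mulmxA; apply: low1 => //; exact: tvgM.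
set h := h1 *m g in hj etaj fh low1.
set e : R := `|h i j| in hj etaj low1.
have e0 : 0 < e by lra.
have hij : h i j != 0 by rewrite -normr_gt0.
set E' := drop_pair E i; set D' := drop_pair D j.
have hE' : rev_closed E' by exact: drop_pair_rev_closed.
have hD' : rev_closed D' by exact: drop_pair_rev_closed.
set x := row i h.
have xj : x 0 j = h i j by rewrite mxE.
pose h' := h *m pivot_proj j x.
have fh' : frame E' D' h' by exact: frame_proj.
have E'E : E' \subset E by exact: drop_pair_sub.
have iE' : i \notin E' by rewrite in_drop_pair eqxx andbF.
have inD' l : l \in D -> [\/ l = j, l = rev_ord j | l \in D'].
  move=> lD; rewrite in_drop_pair lD andbT.
  have [->|lj] := eqVneq l j; first by constructor 1.
  have [->|lj'] := eqVneq l (rev_ord j); first by constructor 2.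
  by constructor 3.
have xe l : l \in D -> `|x 0 l| <= e by move=> lD; rewrite mxE; exact: hj.
(* Lifting: the projected row is recovered up to a multiple of [x] of size at most
   1 / 2, since the [j]-th coordinate has been rounded. *)
have adj h2 : tvg E' h2 -> exists h3, [/\ tvg E (h3 *m h2),
    row i (h3 *m h2 *m h) = x,
    {in E', forall k, exists2 th, `|th| <= 1 / 2 &
       row k (h3 *m h2 *m h) = row k (h2 *m h') + th *: x} &
    {in E, forall k, k != i -> `|(h3 *m h2 *m h) k j| <= e / 2}].
  move=> th2; have rowi : row i (h2 *m h) = x by rewrite (tvg_row _ hE' iE' th2).
  have ij2 : (h2 *m h) i j = h i j.
    by have := congr1 (fun m : 'rV_(n + n) => m 0 j) rowi; rewrite xj mxE.
  have ij2n : (h2 *m h) i j != 0 by rewrite ij2.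
  have [h3 [th3 h3i h3k h3j]] := round_column hE iE ij2n.
  exists h3; rewrite -!mulmxA; split => //.
  - by apply: tvgM => //; exact: tvg_sub th2.
  - by rewrite h3i.
  - move=> k kE; have [z hz] := h3k k kE.
    have kE2 : k \in E by move: kE; rewrite in_drop_pair => /and3P[].
    have ki : k != i by move: kE; rewrite in_drop_pair => /and3P[].
    set r := (h3 *m (h2 *m h)) k j.
    exists (r / h i j).
      rewrite normrM normfV ler_pdivrMr//.
      by have := h3j k kE2 ki; rewrite ij2 -/e -/r; lra.
    rewrite hz rowi /h' mulmxA row_proj xj -addrA; congr (_ + _).
    rewrite -scaleNr -scalerDl; congr (_ *: _).
    rewrite rowi in hz; have : r = (h2 *m h) k j + z * h i j.
      by rewrite -xj; exact: rowDZ.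
    by move=> ->; field.
  - by move=> k kE ki; have := h3j k kE ki; rewrite ij2.
have rowh'j h2 k : (h2 *m h') k j = 0.
  have := row_proj (h2 *m h) j x k; rewrite -mulmxA -/h' -scaleNr => /(rowDZ j) ->.
  by rewrite mulNr divfK ?subrr// xj.
have omx H k : tvg E H -> row i (H *m h) = x -> k \in E ->
    om D x (row k (H *m h)) = sg i * (k == rev_ord i)%:R.
  move=> tH rH kE; have [fH _] := tvg_frame hE hD tH fh.
  by rewrite -{1}rH fH.
have normM j1 (a b c : R) : sg j1 * (a - b) + c = 0 -> `|a| <= `|b| + `|c|.
  move=> /eqP; rewrite addr_eq0 => /eqP abc.
  have -> : a = b - sg j1 * c.
    by rewrite -[c]opprK -abc mulrN mulrA sgM mul1r opprK addrC subrK.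
  by apply: (le_trans (ler_normB _ _)); rewrite normrM normr_sg mul1r.
(* A short projected row lifts to a row shorter than the near minimum: orthogonality
   to [x] also makes its coordinate opposite to [j] small. *)
have low' h2 k : tvg E' h2 -> k \in E' ->
    exists2 l, l \in D' & e / (12 * d) <= `|(h2 *m h') k l|.
  move=> th2 kE'; apply: contrapT => nl.
  have up l : l \in D' -> `|(h2 *m h') k l| < e / (12 * d).
    by move=> lD; rewrite ltNge; apply/negP => hl; apply: nl; exists l.
  have [h3 [th3 h3i h3k h3j]] := adj h2 th2.
  have [kE ki ki'] : [/\ k \in E, k != i & k != rev_ord i].
    by move: kE'; rewrite in_drop_pair => /and3P[].
  have [th hth hk] := h3k k kE'.
  have := omx _ k th3 h3i kE; rewrite (negPf ki') mulr0 hk omDr omZr omxx// mulr0 addr0.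
  rewrite (om_drop_pair _ _ hD jD).
  set r := row k _; have rj : r 0 j = 0 by rewrite mxE rowh'j.
  rewrite rj mulr0 => /normM; rewrite normr0 add0r => hr.
  have e12 : e / 12 = d * (e / (12 * d)).
    by clear -d1; field; rewrite lt0r_neq0//; lra.
  have {}hr : `|r 0 (rev_ord j)| <= e / 12.
    have : `|om D' x r| <= d * (e * (e / (12 * d))).
      apply: om_le => [|l lD].
        by clear -e0 d1; rewrite !mulr_ge0 ?invr_ge0 ?mulr_ge0//; lra.
      rewrite normrM ler_pM//; first by apply: xe; move: lD; apply/fintype.subsetP/drop_pair_sub.
      by rewrite mxE ltW// up// hD'.
    rewrite mulrCA -e12 => hom.
    have := le_trans hr hom; rewrite normrM xj -/e ler_pM2l//.
  have [l lD] := low1 _ k th3 kE.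
  have Hkl : (h3 *m h2 *m h) k l = r 0 l + th * x 0 l.
    by rewrite [r 0 l]mxE; exact: rowDZ.
  have hthx : `|th * x 0 l| <= e / 2.
    rewrite normrM; have := xe l lD; have := normr_ge0 th; clear -hth e0; nra.
  have := ler_normD (r 0 l) (th * x 0 l); rewrite -Hkl => h3l h23.
  have [lj|lj|lD'] := inD' l lD.
  - by have := h3j k kE ki; rewrite lj in h23 *; clear -h23 e0; lra.
  - by rewrite -lj in hr; clear -hr h23 h3l hthx e0; lra.
  - have := ltW (up l lD'); have : r 0 l = (h2 *m h') k l by rewrite mxE.
    move=> <-; have : e / (12 * d) <= e / 12.
      by rewrite e12 ler_peMl// divr_ge0//; clear -d1 e0; lra.
    by clear -h23 h3l hthx e0; lra.
have cE' : (#|E'| <= p)%N by move: cE; rewrite (card_drop_pair hE iE); exact: ltnW.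
have e12 : 0 < e / (12 * d) by rewrite divr_gt0//; clear -d1; lra.
have [h2 [t' [th2 t0 tt' ht' hb]]] := IH _ _ _ _ cE' hE' hD' fh' e12 low'.
have [h3 [th3 h3i h3k h3j]] := adj h2 th2.
set H := h3 *m h2 in th3 h3i h3k h3j.
have et l : l \in D' -> e <= C1 * t' l.
  move=> lD; have := ht' l lD; rewrite ler_pdivrMr; last by clear -d1; lra.
  by rewrite /C1; clear; lra.
have et' l : l \in D' -> e * t' (rev_ord l) <= C1.
  move=> lD; have := et l lD; have := tt' l; have := t0 (rev_ord l) => h0 h4 h5.
  have : e * t' (rev_ord l) <= C1 * t' l * t' (rev_ord l) by rewrite ler_wpM2r// ltW.
  by rewrite -mulrA h4 mulr1.
have [fH fHc] := tvg_frame hE hD th3 fh.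
have rowi' : row i (H *m h) = x by [].
pose y k := row k (H *m h).
have ykj k : k \in E -> k != i -> `|y k 0 j| <= e / 2.
  by move=> kE ki; rewrite mxE; exact: h3j.
have xykj k : k \in E -> k != i -> `|x 0 (rev_ord j) * y k 0 j| <= e ^+ 2 / 2.
  move=> kE ki; rewrite normrM.
  have := ykj k kE ki; have := xe _ (hD _ jD).
  have := normr_ge0 (x 0 (rev_ord j)); have := normr_ge0 (y k 0 j); clear; nra.
have xyk k : k \in E -> k != i ->
    `|x 0 j * y k 0 (rev_ord j)| <= 1 + e ^+ 2 / 2 + `|om D' x (y k)|.
  move=> kE ki; have := omx _ k th3 h3i kE.
  rewrite (om_drop_pair _ _ hD jD) -/(y k) => /eqP; rewrite -subr_eq0 -addrA => /eqP/normM hM.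
  apply: (le_trans hM).
  have : `|om D' x (y k) - sg i * (k == rev_ord i)%:R| <= `|om D' x (y k)| + 1.
    apply: (le_trans (ler_normB _ _)); rewrite lerD2l normrM normr_sg mul1r.
    by case: (_ == _); rewrite ?normr1 ?normr0.
  by have := xykj k kE ki; clear; lra.
(* [e] is bounded: compare it with [t' l] and [t' (rev_ord l)], of product 1; if no
   coordinate is left, the pairing of the two remaining rows bounds it. *)
have eK : e ^+ 2 <= K.
  have [D0|[l lD]] := set_0Vmem D'; last first.
    have h1' := et _ lD; have h2' := et _ (hD' _ lD).
    have := tt' l; have := t0 l; have := t0 (rev_ord l) => a0 b0 ab.
    have : e * e <= C1 * t' l * (C1 * t' (rev_ord l)) by rewrite ler_pM// ltW.
    by rewrite mulrACA ab mulr1 -!expr2 /K; clear; lra.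
  have iE2 := hE _ iE; have hy := xyk _ iE2 (rev_neq i).
  have [l lD hl] := low1 _ _ th3 iE2.
  have [lj|lj|] := inD' l lD; last by rewrite D0 inE.
    by have := h3j _ iE2 (rev_neq i); rewrite lj in hl; clear -hl e0; lra.
  rewrite D0 om_set0 normr0 addr0 normrM xj -/e mxE -lj in hy.
  by have := sqr_ge0 C1; rewrite /K; clear -hl hy e0; nra.
have hkl k l : k \in E' -> l \in D' -> `|y k 0 l| <= C2 * t' l.
  move=> kE lD; have [th hth /(rowDZ l) hk] := h3k k kE; rewrite /y mxE hk.
  have := hb k l kE lD; have := et l lD; have lD2 : l \in D.
    by move: lD; apply/fintype.subsetP/drop_pair_sub.
  have := hj l lD2 => a1 a2 a3; apply: (le_trans (ler_normD _ _)); rewrite normrM.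
  have := normr_ge0 (h i l); have := t0 l; rewrite /C2 => a4 a5.
  have : 0 <= d * C' * t' l.
    by rewrite !mulr_ge0//; [clear -C'1; lra | exact: ltW].
  by have := normr_ge0 th; rewrite [x 0 l]mxE; clear -a1 a2 a3 a4 a5 hth e0; nra.
(* The row opposite to [i] is not a lift; its projection is expanded in the
   projected frame. *)
have hi'l l : l \in D' -> `|y (rev_ord i) 0 l| <= C2 * t' l.
  move=> lD; have lD2 : l \in D by move: lD; apply/fintype.subsetP/drop_pair_sub.
  have iE2 := hE _ iE; set yi := y _.
  have fh2 := tvg_frame hE' hD' th2 fh'.
  pose c := yi 0 j / x 0 j; pose yt := yi - c *: x.
  have ytE b : yt 0 b = yi 0 b - c * x 0 b.
    by rewrite /yt mxE [X in _ + X]mxE [X in _ - X]mxE.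
  have ytj : yt 0 j = 0 by rewrite ytE divfK ?subrr// xj.
  have cle : `|c| <= 1 / 2.
    rewrite normrM normfV xj ler_pdivrMr// -/e.
    by have := ykj _ iE2 (rev_neq i); clear; lra.
  have omk k : k \in E' -> `|om D' yt (row (rev_ord k) (h2 *m h'))| <= 1 / 2.
    move=> kE; have kE2 := hE' _ kE.
    have [th hth hk] := h3k _ kE2.
    have [k'E k'i k'i'] : [/\ rev_ord k \in E, rev_ord k != i & rev_ord k != rev_ord i].
      by move: kE2; rewrite in_drop_pair => /and3P[].
    rewrite -om_zero// /yt; last by rewrite mxE rowh'j.
    have -> : row (rev_ord k) (h2 *m h') = y (rev_ord k) - th *: x.
      by rewrite /y hk addrK.
    have o1 : om D yi (y (rev_ord k)) = 0.
      by rewrite /yi /y fH// rev_ordK (negPf k'i) mulr0.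
    have o2 : om D yi x = sg (rev_ord i).
      by rewrite /yi /y -h3i fH// rev_ordK eqxx mulr1.
    have o3 : om D x (y (rev_ord k)) = 0.
      by rewrite /y -h3i fH// (negPf k'i') mulr0.
    rewrite omDl omNl omZl !omDr !omNr !omZr o1 o2 o3 omxx//.
    rewrite !(mulr0, subr0, sub0r, oppr0, addr0).
    by rewrite normrN normrM normr_sg mulr1.
  have ytl : `|yt 0 l| <= d * C' * t' l.
    have [_ /(_ yt l lD) ->] := fh2; apply: (le_trans (ler_norm_sum _ _ _)).
    have t'l := t0 l.
    rewrite -mulrA; apply: sum_le => [|k kE].
      by rewrite mulr_ge0 ?(ltW t'l)//; clear -C'1; lra.
    rewrite !normrM normr_sg mul1r -[leRHS]mul1r.
    by rewrite ler_pM ?hb//; apply: le_trans (omk k kE) _; clear -d; lra.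
  have yil : yi 0 l = yt 0 l + c * x 0 l.
    by rewrite ytE subrK.
  have := et l lD; have := xe l lD2; have := normr_ge0 (x 0 l).
  rewrite yil /C2; have := ler_normD (yt 0 l) (c * x 0 l); rewrite normrM.
  have := normr_ge0 c; have := mulr_gt0 (lt_le_trans ltr01 C'1) (t0 l).
  move: ytl cle e0; clear; nra.
have hkl' k l : k \in E -> k != i -> l \in D' -> `|y k 0 l| <= C2 * t' l.
  move=> kE ki lD; have [->|ki'] := eqVneq k (rev_ord i); first exact: hi'l.
  by apply: hkl => //; rewrite in_drop_pair ki' ki.
(* The last coordinate is solved from the pairing with [x], whose [j]-th entry is [e]. *)
have hkj' k : k \in E -> k != i ->
    `|y k 0 (rev_ord j)| <= (1 + K + d * C2 * C1) / e.
  move=> kE ki; rewrite ler_pdivlMr// mulrC -[e]/(`|h i j|) -xj -normrM.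
  apply: (le_trans (xyk k kE ki)).
  have : `|om D' x (y k)| <= d * (C2 * C1).
    apply: om_le => [|l lD]; first by rewrite mulr_ge0//; clear -C20; lra.
    have lD2 : l \in D by move: lD; apply/fintype.subsetP/drop_pair_sub.
    rewrite normrM; apply: (@le_trans _ _ (e * (C2 * t' (rev_ord l)))).
      by apply: ler_pM => //; [exact: xe | exact: hkl' (hD' _ lD)].
    by rewrite mulrCA ler_wpM2l ?et'//; apply: le_trans C20.
  by move: eK (sqr_ge0 e); clear -d; lra.
exists (H *m h1), (fun l => if l == j then e else if l == rev_ord j then e^-1 else t' l).
rewrite -mulmxA -/h; split.
- exact: tvgM.
- by move=> l; case: ifP => // _; case: ifP => // _; rewrite invr_gt0.
- move=> l; rewrite (inj_eq rev_ord_inj) eq_rev.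
  have [->|lj] := eqVneq l j; first by rewrite eq_sym (negPf (rev_neq _)) divff// lt0r_neq0.
  by have [_|lj'] := eqVneq l (rev_ord j); rewrite ?mulVf// lt0r_neq0.
- move=> l /inD'[->|->|lD].
  + by rewrite eqxx; move: etaj e0 K0 dC0 C10 C20; clear -d; nra.
  + rewrite (negPf (rev_neq _)) eqxx ler_pdivlMr//.
    have : eta * e <= e ^+ 2 by rewrite expr2 ler_wpM2r// ltW.
    by move: eK dC0 C10 C20; clear -d; lra.
  + have := lD; rewrite in_drop_pair => /and3P[/negPf-> /negPf-> _].
    have := et l lD; have := t0 l; move: etaj K0 dC0 C20; clear.
    set X := d * C2 * C1; nra.
- move=> k l kE lD; have [->|ki] := eqVneq k i.
    rewrite (_ : (H *m h) i l = h i l); last first.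
      by have := congr1 (fun m : 'rV_(n + n) => m 0 l) h3i; rewrite !mxE.
    have hl := hj l lD; have [lj|lj|lD'] := inD' l lD.
    + rewrite lj eqxx; rewrite -lj; move: hl e0 K0 dC0 C10 C20; clear -d; nra.
    + rewrite lj (negPf (rev_neq _)) eqxx -lj ler_pdivlMr//.
      have : `|h i l| * e <= e ^+ 2 by rewrite expr2 ler_wpM2r// ltW.
      by move: eK dC0 C10 C20; clear -d; lra.
    + have := lD'; rewrite in_drop_pair => /and3P[/negPf-> /negPf-> _].
      have := et l lD'; have := t0 l; move: hl K0 dC0 C20; clear.
      set X := d * C2 * C1; nra.
  have ykl : (H *m h) k l = y k 0 l by rewrite /y [RHS]mxE.
  have [lj|lj|lD'] := inD' l lD.
  + rewrite lj eqxx; have := h3j k kE ki; move: e0 K0 dC0 C10 C20; clear -d; nra.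
  + rewrite ykl lj (negPf (rev_neq _)) eqxx; apply: le_trans (hkj' k kE ki) _.
    by rewrite ler_wpM2r ?invr_ge0 ?(ltW e0)//; move: C10 C20; clear -d; lra.
  + have := lD'; rewrite in_drop_pair => /and3P[/negPf-> /negPf-> _].
    rewrite ykl; apply: le_trans (hkl' k l kE ki lD') _.
    by rewrite ler_wpM2r ?(ltW (t0 l))//; move: C10 C20 K0 dC0; clear -d; lra.
Qed.

Lemma row_col p q (A : 'M[R]_(p, n + n)) (B : 'M[R]_(n + n, q)) (k : 'I_p)
    (l : 'I_q) :
  (row k A *m col l B) 0 0 = (A *m B) k l.
Proof. by rewrite !mxE; apply: eq_bigr => b _; rewrite !mxE. Qed.

Lemma frame_full g : g *m sympl_form *m g^T = sympl_form -> frame fullI fullI g.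
Proof.
move=> hg; have hT : rev_closed fullI by move=> ? _; rewrite inE.
split=> [k l _ _|v l _].
  by rewrite om_symplE tr_row -row_mul row_col hg sympl_formE.
have h1 : v = - (v *m sympl_form *m g^T *m sympl_form *m g).
  by rewrite -!mulmxA [g^T *m _]mulmxA (sympl_tr hg) sympl_formK mulmxN opprK mulmx1.
rewrite {1}h1 mxE [X in - X]mxE -sumrN.
under [RHS]eq_bigl do rewrite inE.
apply: eq_bigr => k _; rewrite om_symplE tr_row.
set w := v *m sympl_form *m g^T.
have -> : (v *m sympl_form *m col (rev_ord k) g^T) 0 0 = w 0 (rev_ord k).
  rewrite -[RHS]row_col (_ : row 0 _ = v *m sympl_form)//.
  by apply/rowP => b; rewrite [LHS]mxE.
rewrite -mulNr; congr (_ * _).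
rewrite mxE (bigD1 (rev_ord k))//= big1 ?addr0 => [|b /negPf bk].
  by rewrite sympl_formE rev_ordK eqxx mulr1 sg_rev; ring.
by rewrite sympl_formE -eq_rev eq_sym bk mulr0 mulr0.
Qed.

Lemma int_ge1 (z : R) : z \is a Num.int -> z != 0 -> 1 <= `|z|.
Proof. by move=> /intrP[m ->]; rewrite -intr_norm intr_eq0 ler1z -absz_gt0; lia. Qed.

(** The lower bound [eta] that the reduction asks for exists: if all entries of row [k] of
    [h *m g] were tiny, the integral row [k] of [h], which is recovered from them by the
    symplectic form, would have entries smaller than 1 and vanish. *)
Lemma reduce_sympl : exists2 C : R, 1 <= C & forall g,
  g *m sympl_form *m g^T = sympl_form ->
  exists h (t : 'I_(n + n) -> R), [/\ tvg fullI h, forall l, 0 < t l,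
    forall l, t l * t (rev_ord l) = 1 & forall k l, `|(h *m g) k l| <= C * t l].
Proof.
have hT : rev_closed fullI by move=> ? _; rewrite inE.
have [C C1 hC] := reduction #|[set: 'I_(n + n)]%SET|; exists C => // g hg.
have fg := frame_full hg.
pose M : R := \sum_k \sum_l `|g k l|.
have gM k l : `|g k l| <= M.
  rewrite /M (bigD1 k)//= (bigD1 l)//= -addrA lerDl addr_ge0// sumr_ge0// => *.
  by rewrite sumr_ge0.
have [n0|n0] := eqVneq (n + n)%N 0%N.
  exists 1%:M, (fun=> 1); split => //; [exact: tvg1|by move=> l; rewrite mulr1|].
  by move=> k; have := ltn_ord k; rewrite {2}n0.
have d1 : 1 <= d by rewrite /d ler1n lt0n.
have M0 : 0 <= M by rewrite /M sumr_ge0// => *; rewrite sumr_ge0.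
have [||h [t [th t0 tt _ hb]]] := hC fullI fullI g (d * (M + 1))^-1 (leqnn _) hT hT fg.
- by rewrite invr_gt0 mulr_gt0//; clear -d1 M0; lra.
- move=> h k th kE; apply: contrapT => nl.
  have up l : `|(h *m g) k l| <= (d * (M + 1))^-1.
    by rewrite leNgt; apply/negP => hl; apply: nl; exists l; rewrite ?inE// ltW.
  have hk0 : row k h = 0.
    apply/rowP => b; rewrite [RHS]mxE; apply/eqP; apply: contraT => nz.
    have ib : row k h 0 b \is a Num.int by rewrite mxE; exact: (tvg_int th).
    have := int_ge1 ib nz; rewrite leNgt => /negP[].
    have sk : supp fullI (row k h) by move=> ?; rewrite inE.
    have bT : rev_ord b \in fullI by rewrite inE.
    have := om_lin_comb hT fg sk bT; rewrite rev_ordK.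
    move=> /(congr1 Num.norm); rewrite normrM normr_sg mul1r => <-.
    apply: (@le_lt_trans _ _ (d * (M * (d * (M + 1))^-1))).
      apply: om_le => [|l _].
        by rewrite mulr_ge0// invr_ge0 mulr_ge0//; clear -d1 M0; lra.
      by rewrite normrM ler_pM// -?row_mul mxE.
    have d0 : d != 0 by rewrite lt0r_neq0//; clear -d1; lra.
    have M1 : M + 1 != 0 by rewrite lt0r_neq0//; clear -M0; lra.
    have frac (a c : R) : a != 0 -> c + 1 != 0 -> a * (c * (a * (c + 1))^-1) = c / (c + 1).
      by move=> a0 c0; field; rewrite a0 c0.
    rewrite frac//.
    by rewrite ltr_pdivrMr ?mul1r; clear -M0; lra.
  have := tvg_SpZ th => -[[dh _] _].
  have hu : h \in unitmx by rewrite unitmxE dh unitr1.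
  have := congr1 (mulmx^~ (invmx h)) hk0; rewrite -row_mul mulmxV// mul0mx.
  move=> /rowP/(_ k); rewrite !mxE eqxx => /eqP; apply/negP; exact: oner_neq0.
by exists h, t; split => // k l; apply: hb; rewrite inE.
Qed.

(** * Covering bounded frames *)

(** Expanding in the frame [g], whose rows come in opposite pairs with [a k * a k' = 1],
    the weights cancel. *)
Lemma om_close E D g (a : 'I_(n + n) -> R) x y (al be : R) :
  frame E D g -> rev_closed E -> (forall k, 0 < a k) -> (forall k, a k * a (rev_ord k) = 1) ->
  0 <= al -> 0 <= be ->
  {in E, forall k, a k * `|om D x (row k g)| <= al} ->
  {in E, forall k, a k * `|om D (row k g) y| <= be} ->
  `|om D x y| <= d * (al * be).
Proof.
move=> fg hE a0 aa al0 be0 hx hy; rewrite (frame_om x y fg).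
apply: (le_trans (ler_norm_sum _ _ _)); apply: sum_le => [|k kE].
  exact: mulr_ge0.
rewrite !normrM normr_sg mul1r; set A : R := `|_|; set B : R := `|_|.
have -> : A * B = (a (rev_ord k) * A) * (a k * B).
  by rewrite mulrACA [a _ * a k]mulrC aa mul1r.
have A0 : 0 <= A by exact: normr_ge0.
have B0 : 0 <= B by exact: normr_ge0.
apply: ler_pM; rewrite ?mulr_ge0 ?(ltW (a0 _))//; first exact: hx (hE _ kE).
exact: hy.
Qed.

Definition bounded_frame E D (M : R) g :=
  frame E D g /\ {in E & D, forall k l, `|g k l| <= M}.

Definition pivot D i g j := j \in D /\ {in D, forall l, `|g i l| <= `|g i j|}.

(** A row of a frame is not zero on [D], since it pairs to a sign with the opposite row. *)
Lemma pivot_ex D E (M : R) g i : rev_closed E -> rev_closed D -> bounded_frame E D M g -> i \in E ->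
  exists j, pivot D i g j /\ g i j != 0.
Proof.
move=> hE hD [[h1 _] _] iE.
have [l [lD hl]] : exists l, l \in D /\ g i l != 0.
  apply: contrapT => nl; have := h1 i _ iE (hE _ iE).
  rewrite eqxx mulr1 om_row big1 => [|b bD].
    by move=> /esym/(congr1 Num.norm)/eqP; rewrite normr_sg normr0 oner_eq0.
  have [->|nz] := eqVneq (g i b) 0; first by rewrite mulr0 mul0r.
  by exfalso; apply: nl; exists b.
case: (@arg_maxP _ _ _ l (fun l => l \in D) (fun l => `|g i l|) lD) => j jD hj.
exists j; split; first by split.
by rewrite -normr_gt0; apply: lt_le_trans (hj _ lD); rewrite normr_gt0.
Qed.

(** The projection subtracts [g k j], at most [M], times the pivot row scaled to have entry
    1 at the pivot, whose entries are then at most 1. *)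
Lemma proj_bounded_frame E D (M : R) g i j :
  rev_closed E -> rev_closed D -> bounded_frame E D M g -> i \in E ->
  pivot D i g j -> g i j != 0 ->
  bounded_frame (drop_pair E i) (drop_pair D j) (2 * M) (g *m pivot_proj j (row i g)).
Proof.
move=> hE hD [fg hg] iE [jD hj] gij; split; first exact: frame_proj.
move=> k l kE lD; have := row_proj g j (row i g) k; rewrite -scaleNr => /(rowDZ l) ->.
have kE' : k \in E by move: kE; apply/fintype.subsetP/drop_pair_sub.
have lD' : l \in D by move: lD; apply/fintype.subsetP/drop_pair_sub.
rewrite !mxE mulNr; apply: (le_trans (ler_normB _ _)).
have -> : 2 * M = M + M by ring.
rewrite lerD ?hg// !normrM normfV mulrAC -mulrA.
apply: (@le_trans _ _ (`|g k j| * 1)); last by rewrite mulr1 hg.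
by rewrite ler_wpM2l// ler_pdivrMr ?normr_gt0// mul1r hj.
Qed.

Definition pivot_row i j g : 'rV[R]_(n + n) := (g i j)^-1 *: row i g.

Lemma pivot_row_pivot i j g : g i j != 0 -> pivot_row i j g 0 j = 1.
Proof. by move=> gij; rewrite !mxE mulVf. Qed.

Lemma pivot_row_le D i j g l : pivot D i g j -> g i j != 0 -> l \in D -> `|pivot_row i j g 0 l| <= 1.
Proof.
move=> [jD hj] gij lD; rewrite !mxE normrM normfV mulrC ler_pdivrMr ?normr_gt0//.
by rewrite mul1r hj.
Qed.

Lemma row_proj_u i j g k : g i j != 0 ->
  row k g = row k (g *m pivot_proj j (row i g)) + g k j *: pivot_row i j g.
Proof. by move=> gij; rewrite row_proj /pivot_row mxE scalerA subrK. Qed.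

Lemma om_proj0 E D g i j k : rev_closed E -> rev_closed D -> frame E D g -> i \in E ->
  k \in drop_pair E i -> om D (pivot_row i j g) (row k (g *m pivot_proj j (row i g))) = 0.
Proof.
move=> hE hD [h1 _] iE; rewrite in_drop_pair => /and3P[ki' ki kE].
rewrite row_proj -scaleNr /pivot_row omZl omDr omZr omxx// h1// (negPf ki').
by rewrite !mulr0 addr0 mulr0.
Qed.

Lemma om_bilinear D x y u v (b c : R) : om D (x + b *: u) (y + c *: v) =
  om D x y + c * om D x v + (b * om D u y + b * (c * om D u v)).
Proof. by rewrite omDl !omDr !omZl !omZr. Qed.

Lemma mul_close (q m p p' y b : R) : 0 <= q -> q <= m -> 0 < p -> p <= p' ->
  0 <= y -> p' * y <= b -> q * (p * y) <= m * b.
Proof.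
move=> q0 qm p0 pp y0 h; apply: ler_pM => //; first by rewrite mulr_ge0// ltW.
by apply: le_trans h; rewrite ler_wpM2r.
Qed.

Section CloseStep.
Variables (E D : {set 'I_(n + n)}) (M C : R) (a : 'I_(n + n) -> R) (i j : 'I_(n + n)).
Hypotheses (hE : rev_closed E) (hD : rev_closed D) (a0 : forall k, 0 < a k).
Hypotheses (aa : forall k, a k * a (rev_ord k) = 1) (iE : i \in E) (jD : j \in D).
Hypotheses (C0 : 0 <= C) (M0 : 0 <= M).
Variable G : 'M[R]_(n + n).
Hypothesis fG : frame (drop_pair E i) (drop_pair D j) G.
Let E' := drop_pair E i.
Let D' := drop_pair D j.

(** Up to a multiple of row [i], to which the rows [r] are orthogonal, only the
    difference of the two pivot rows matters, and it is expanded in the frame [G]. *)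
Lemma close_u (Q Q' : 'M[R]_(n + n)) : frame E D Q' -> Q i j != 0 -> Q' i j != 0 ->
  {in E' &, forall k l,
     a k * (a l * `|om D' (row k G) (row l (Q' *m pivot_proj j (row i Q')))|) <= C} ->
  {in E', forall k, a i * (a k * `|om D' (pivot_row i j Q - pivot_row i j Q') (row k G)|) <= 1} ->
  {in E', forall l,
     a i * (a l * `|om D (pivot_row i j Q) (row l (Q' *m pivot_proj j (row i Q')))|) <= d * C}.
Proof.
move=> fQ' nz nz' cG cu l lE; set r := row l _.
have rj : r 0 j = 0.
  by rewrite /r row_proj !mxE divfK ?subrr.
have -> : om D (pivot_row i j Q) r = om D' (pivot_row i j Q - pivot_row i j Q') r.
  rewrite -om_zero//; last by rewrite mxE [X in _ + X]mxE !pivot_row_pivot// subrr.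
  by rewrite omDl omNl (om_proj0 j hE hD fQ' iE lE) subr0.
have H : `|om D' (pivot_row i j Q - pivot_row i j Q') r| <= d * ((a i)^-1 * (C / a l)).
  apply: (@om_close E' D' G a) => //; first exact: drop_pair_rev_closed.
  - by rewrite invr_ge0 ltW.
  - by rewrite divr_ge0// ltW.
  - by move=> k kE; rewrite -[leRHS]mul1r ler_pdivlMr// mulrC; exact: cu.
  - by move=> k kE; rewrite ler_pdivlMr// mulrC mulrCA; exact: cG.
rewrite mulrCA mulrA -ler_pdivlMl ?mulr_gt0//; apply: le_trans H _.
by rewrite invfM le_eqVlt; apply/orP; left; apply/eqP; ring.
Qed.

(** The pairing of [u] and [u'] is the pairing of [u - u0] and [u' - u0], which the frame
    [G] controls, plus the difference of the pairings of [u0] with [u] and [u']. *)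
Lemma close_uu (Q Q' : 'M[R]_(n + n)) (u0 : 'rV[R]_(n + n)) :
  frame E D Q' -> Q i j != 0 -> Q' i j != 0 -> u0 0 j = 1 ->
  {in E', forall k, a i * (a k * `|om D' (pivot_row i j Q - u0) (row k G)|) <= 1} ->
  {in E', forall k, a i * (a k * `|om D' (pivot_row i j Q' - u0) (row k G)|) <= 1} ->
  a i * (a i * `|om D u0 (pivot_row i j Q) - om D u0 (pivot_row i j Q')|) <= 1 ->
  a i * (a i * `|om D (pivot_row i j Q) (pivot_row i j Q')|) <= d + 1.
Proof.
move=> fQ' nz nz' u0j cu cu' c3; set u := pivot_row i j Q in cu c3 *; set u' := pivot_row i j Q' in cu' c3 *.
have uj : u 0 j = 1 by exact: pivot_row_pivot.
have uj' : u' 0 j = 1 by exact: pivot_row_pivot.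
have key : `|om D' (u - u0) (u' - u0)| <= d / (a i * a i).
  have -> : d / (a i * a i) = d * ((a i)^-1 * (a i)^-1) by rewrite invfM.
  apply: (@om_close E' D' G a) => //; first exact: drop_pair_rev_closed.
  - by rewrite invr_ge0 ltW.
  - by rewrite invr_ge0 ltW.
  - by move=> k kE; rewrite -[leRHS]mul1r ler_pdivlMr// mulrC; exact: cu.
  - move=> k kE; rewrite -[leRHS]mul1r ler_pdivlMr// mulrC omC; last exact: drop_pair_rev_closed.
    by rewrite normrN; exact: cu'.
rewrite -om_zero// in key; try by rewrite mxE [X in _ + X]mxE ?uj ?uj' u0j subrr.
rewrite omDl !omDr !omNl !omNr omxx// (@omC _ u u0)// in key.
set A := om D u u' in key *; set B := om D u0 u in c3 key; set B' := om D u0 u' in c3 key.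
have -> : A = (A - - B + (- B' - - 0)) - (B - B') by ring.
have ai0 := a0 i.
rewrite mulrA; apply: (@le_trans _ _ (a i * a i * (d / (a i * a i) + `|B - B'|))).
  apply: ler_wpM2l; first by rewrite mulr_ge0 ?ltW.
  by apply: le_trans (ler_normB _ _) _; rewrite lerD2r.
rewrite mulrDr lerD// -?mulrA//.
by rewrite mulrA mulrCA divff ?mulr1// mulf_neq0// lt0r_neq0.
Qed.

(** Each row of [Q] is a row of the projected frame plus a bounded multiple of the pivot
    row, so the pairing splits into four terms: the projected frames pair by the recursive
    hypothesis, and the mixed terms by the closeness of the pivot rows. When one of the rows
    is opposite to [i], the product of the two weights is at most 1 and the trivial bound
    suffices. *)
Lemma close_step (Q Q' : 'M[R]_(n + n)) (u0 : 'rV[R]_(n + n)) :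
  bounded_frame E D M Q -> bounded_frame E D M Q' ->
  {in E, forall k, a k <= a i} ->
  pivot D i Q j -> pivot D i Q' j -> Q i j != 0 -> Q' i j != 0 -> u0 0 j = 1 ->
  (forall q, q = Q \/ q = Q' -> {in E' &, forall k l,
     a k * (a l * `|om D' (row k G) (row l (q *m pivot_proj j (row i q)))|) <= C}) ->
  {in E' &, forall k l, a k * (a l *
     `|om D' (row k (Q *m pivot_proj j (row i Q))) (row l (Q' *m pivot_proj j (row i Q')))|) <= C} ->
  (forall q, q = Q \/ q = Q' -> {in E', forall k,
      a i * (a k * `|om D' (pivot_row i j q - u0) (row k G)|) <= 1}) ->
  {in E', forall k, a i * (a k * `|om D' (pivot_row i j Q - pivot_row i j Q') (row k G)|) <= 1} ->
  a i * (a i * `|om D u0 (pivot_row i j Q) - om D u0 (pivot_row i j Q')|) <= 1 ->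
  {in E &, forall k l, a k * (a l * `|om D (row k Q) (row l Q')|) <=
     C + 2 * M * (d * C) + M ^+ 2 * (d + 1) + d * M ^+ 2}.
Proof.
move=> [fQ bQ] [fQ' bQ'] amax pQ pQ' nz nz' u0j cG c0 cu0 cuu c3.
have hD' : rev_closed D' by exact: drop_pair_rev_closed.
have cuu' : {in E', forall k, a i * (a k * `|om D' (pivot_row i j Q' - pivot_row i j Q) (row k G)|) <= 1}.
  by move=> k kE; have := cuu k kE; rewrite -opprB omNl normrN.
have B1 := close_u fQ' nz nz' (cG _ (or_intror erefl)) cuu.
have B2 := close_u fQ nz' nz (cG _ (or_introl erefl)) cuu'.
have C3 := close_uu fQ' nz nz' u0j (cu0 _ (or_introl erefl)) (cu0 _ (or_intror erefl)) c3.
set u := pivot_row i j Q in cuu cuu' B1 B2 C3 *; set u' := pivot_row i j Q' in cuu cuu' B1 B2 C3 *.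
set P := Q *m _ in c0 B2 *; set P' := Q' *m _ in c0 B1 *.
have d0 : 0 <= d by exact: ler0n.
have M2 : 0 <= M ^+ 2 by exact: sqr_ge0.
have Pi : row i P = 0 by rewrite /P row_proj mxE divff// scale1r subrr.
have Pi' : row i P' = 0 by rewrite /P' row_proj mxE divff// scale1r subrr.
have inE' k : k \in E -> k != rev_ord i -> k = i \/ k \in E'.
  move=> kE ki'; have [->|ki] := eqVneq k i; [by left|right].
  by rewrite in_drop_pair ki' ki.
have bd k l : k \in E -> l \in E -> (k == rev_ord i) || (l == rev_ord i) ->
   a k * (a l * `|om D (row k Q) (row l Q')|) <= d * M ^+ 2.
  move=> kE lE kl; rewrite mulrA -[leRHS]mul1r ler_pM ?mulr_ge0 ?(ltW (a0 _))//.
    case/orP: kl => /eqP ->; first by rewrite -(aa i) mulrC ler_wpM2r ?amax// ltW.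
    by rewrite -(aa i) ler_wpM2r ?amax// ltW.
  apply: om_le => // b bD; rewrite normrM expr2 ler_pM// mxE ?bQ ?bQ' ?hD//.
have P0 k l : k \in E -> k != rev_ord i -> l \in E -> l != rev_ord i ->
   a k * (a l * `|om D (row k P) (row l P')|) <= C.
  move=> kE ki lE li; have [->|kE'] := inE' k kE ki.
    by rewrite Pi om0l normr0 !mulr0.
  have [->|lE'] := inE' l lE li; first by rewrite Pi' om0r normr0 !mulr0.
  have Pj g k' : g i j != 0 -> row k' (g *m pivot_proj j (row i g)) 0 j = 0.
    by move=> gij; rewrite row_proj !mxE divfK ?subrr.
  by rewrite (om_zero hD jD) ?Pj//; exact: c0.
have P1 l : l \in E -> l != rev_ord i -> a i * (a l * `|om D u (row l P')|) <= d * C.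
  move=> lE li; have [->|lE'] := inE' l lE li; last exact: B1.
  by rewrite Pi' om0r normr0 !mulr0 mulr_ge0.
have P2 k : k \in E -> k != rev_ord i -> a i * (a k * `|om D (row k P) u'|) <= d * C.
  move=> kE ki; rewrite omC// normrN; have [->|kE'] := inE' k kE ki; last exact: B2.
  by rewrite Pi om0r normr0 !mulr0 mulr_ge0.
move=> k l kE lE.
have [/bd-/(_ kE lE)|] := boolP ((k == rev_ord i) || (l == rev_ord i)).
  move=> /le_trans; apply; rewrite lerDr.
  by rewrite !(addr_ge0, mulr_ge0).
rewrite negb_or => /andP[ki li].
rewrite (row_proj_u k nz) (row_proj_u l nz') -/P -/P' -/u -/u'.
rewrite om_bilinear.
have ak0 := a0 k; have al0 := a0 l; have ai0 := a0 i.
have aki := amax k kE; have ali := amax l lE.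
have t1 := P0 k l kE ki lE li; have t2 := P1 l lE li; have t3 := P2 k kE ki.
have bk : `|Q k j| <= M by apply: bQ => //; case: pQ.
have bl : `|Q' l j| <= M by apply: bQ' => //; case: pQ'.
have le4 (p q r s : R) : `|p + q + (r + s)| <= `|p| + `|q| + (`|r| + `|s|).
  by apply: le_trans (ler_normD _ _) _; rewrite lerD// ler_normD.
apply: le_trans (ler_wpM2l (ltW ak0) (ler_wpM2l (ltW al0) (le4 _ _ _ _))) _.
rewrite !normrM; move: t1 t2 t3 C3 bk bl.
set X1 : R := `|om _ _ (row l P')|; set X2 : R := `|om _ u _|; set X3 : R := `|om _ _ u'|.
set X4 : R := `|om _ u u'|; set q : R := `|Q k j|; set q' : R := `|Q' l j| => t1 t2 t3 t4 bk bl.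
have q0 : 0 <= q by exact: normr_ge0.
have q0' : 0 <= q' by exact: normr_ge0.
have X20 : 0 <= X2 by exact: normr_ge0.
have X30 : 0 <= X3 by exact: normr_ge0.
have X40 : 0 <= X4 by exact: normr_ge0.
have e2 : a k * (a l * (q * X2)) <= M * (d * C).
  rewrite (_ : _ * _ = q * (a k * (a l * X2))); last by ring.
  by apply: mul_close aki _ t2 => //; rewrite mulr_ge0// ltW.
have e3 : a k * (a l * (q' * X3)) <= M * (d * C).
  rewrite (_ : _ * _ = q' * (a l * (a k * X3))); last by ring.
  by apply: mul_close ali _ t3 => //; rewrite mulr_ge0// ltW.
have e4 : a k * (a l * (q * (q' * X4))) <= M ^+ 2 * (d + 1).
  rewrite (_ : _ * _ = (q * q') * (a k * (a l * X4))); last by ring.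
  rewrite expr2; apply: (mul_close _ _ _ aki); rewrite ?mulr_ge0 ?(ltW al0)//.
    by rewrite ler_pM.
  by apply: le_trans t4; rewrite ler_pM2l// ler_wpM2r.
have dM : 0 <= d * M ^+ 2 by rewrite mulr_ge0.
rewrite !mulrDr; apply: le_trans (lerD (lerD t1 e3) (lerD e2 e4)) _.
by rewrite -subr_ge0 (_ : _ - _ = d * M ^+ 2)//; ring.
Qed.

End CloseStep.

(** Values with the same integer part differ by less than 1; the shift by [K] makes them
    nonnegative, and the bound [K] makes the number of labels finite. *)
Lemma label_close (K x y : R) : `|x| <= K -> `|y| <= K ->
  inord (Num.truncn (x + K)) = inord (Num.truncn (y + K)) :> 'I_(Num.truncn (2 * K)).+1 ->
  `|x - y| < 1.
Proof.
have bnd z : `|z| <= K -> 0 <= z + K /\ z + K <= 2 * K.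
  by rewrite ler_norml => /andP[h1 h2]; split; lra.
move=> /bnd[x0 xK] /bnd[y0 yK] /(congr1 val) /=; rewrite !inordK ?ltnS ?le_truncn//.
move=> e; have := truncn_itv x0; have := truncn_itv y0; rewrite e.
rewrite -!natr1 => /andP[h1 h2] /andP[h3 h4].
by rewrite ltr_norml; apply/andP; split; lra.
Qed.

(** The frames bounded by [M] are partitioned into [N] classes, the fibres of a label, in
    each of which the rows of two frames pair to at most [C / (a k * a l)]. *)
Definition covered E D (M : R) (a : 'I_(n + n) -> R) (C : R) (N : nat) :=
  exists f : 'M[R]_(n + n) -> nat, (forall Q, bounded_frame E D M Q -> (f Q < N)%N) /\
    forall Q Q', bounded_frame E D M Q -> bounded_frame E D M Q' -> f Q = f Q' ->
      {in E &, forall k l, a k * (a l * `|om D (row k Q) (row l Q')|) <= C}.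

(** Refining a partition by the value of [h], measured from a representative of each class.
    The representative is what makes it possible to compare an element of a class with a
    reference that depends on the class alone. *)
Lemma refine_label (X : Type) (p1 : X) (S : X -> Prop) (f : X -> nat) N (T : finType)
    (h : X -> X -> T) : (forall p, S p -> (f p < N)%N) ->
  exists rep f', [/\ forall p, S p -> S (rep (f p)) /\ f (rep (f p)) = f p,
    forall p, S p -> (f' p < N * #|T|)%N &
    forall p q, S p -> S q -> f' p = f' q ->
      f p = f q /\ h (rep (f p)) p = h (rep (f p)) q].
Proof.
move=> hf.
have ex_rep (t : nat) : exists p0, (exists p, S p /\ f p = t) -> S p0 /\ f p0 = t.
  have [[p hp]|] := pselect (exists p, S p /\ f p = t); last by exists p1.
  by exists p.
have [rep hrep] := choice ex_rep.
have T0 : (0 < #|T|)%N by apply/card_gt0P; exists (h p1 p1).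
exists rep, (fun p => (f p * #|T| + enum_rank (h (rep (f p)) p))%N); split.
- by move=> p Sp; apply: hrep; exists p.
- move=> p Sp; apply: (@leq_trans ((f p).+1 * #|T|)).
    by rewrite mulSnr ltn_add2l ltn_ord.
  by rewrite leq_mul2r hf ?orbT.
- move=> p q Sp Sq e.
  have ef : f p = f q.
    by have := congr1 (divn^~ #|T|) e; rewrite !divnMDl// !divn_small ?addn0.
  split=> //; apply: enum_rank_inj; apply: val_inj => /=.
  by move: e; rewrite -ef => /eqP; rewrite eqn_add2l => /eqP.
Qed.

(** Opposite weights cancel. *)
Lemma prod_weights E (a : 'I_(n + n) -> R) : rev_closed E -> (forall k, 0 < a k) ->
  (forall k, a k * a (rev_ord k) = 1) -> \prod_(l in E) a l = 1.
Proof.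
move=> hE a0 aa; apply/eqP; rewrite -(@eqrXn2 _ 2)//; last first.
  by rewrite prodr_ge0// => k _; rewrite ltW.
rewrite expr1n expr2 {2}(reindex_inj rev_ord_inj) /=.
rewrite [X in _ * X](eq_bigl (fun l => l \in E)); last by move=> l; rewrite rev_closedE.
by rewrite -big_split /= big1// => l _; exact: aa.
Qed.

Lemma card_dffun_ord (b : 'I_(n + n) -> nat) :
  #|{dffun forall l, 'I_(b l).+1}| = (\prod_l (b l).+1)%N.
Proof.
rewrite card_dep_ffun foldrE big_map big_enum /=.
by apply: eq_bigr => l _; rewrite card_ord.
Qed.

(** Besides the pivot and the recursive label there are [O(a i * a l)] values for each
    coordinate of the reduced frame and [O(a i ^+ 2)] values of a last label: since the
    [a l] on the reduced frame multiply to 1, this contributes [O(a i ^+ #|E|)]. *)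
Lemma cover_count E (M : R) (a : 'I_(n + n) -> R) N i (K : 'I_(n + n) -> R) (K3 : R) :
  rev_closed E -> (forall k, 0 < a k) -> (forall k, a k * a (rev_ord k) = 1) ->
  i \in E -> {in E, forall k, a k <= a i} -> 0 <= M ->
  K = (fun l => if l \in drop_pair E i then 2 * d * M * (a i * a l) else 0) ->
  K3 = d * (a i * a i) ->
  ((n + n) * #|'I_N.+1| * #|{dffun forall l, 'I_(Num.truncn (2 * K l)).+1}| *
        #|'I_(Num.truncn (2 * K3)).+1|)%N%:R <=
    d * (2 * d + 1) * (4 * d * M + 1) ^+ #|drop_pair E i| * N.+1%:R * a i ^+ #|E|.
Proof.
move=> hE a0 aa iE amax M0 -> ->.
set E' := drop_pair E i; have hE' : rev_closed E' by exact: drop_pair_rev_closed.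
have d0 : 0 <= d by exact: ler0n.
have ai0 := a0 i.
have ail k : k \in E -> 1 <= a i * a k.
  move=> kE; rewrite -(aa k) mulrC ler_wpM2r ?(ltW (a0 k))//.
  by rewrite amax// hE.
have trn (y : R) : 0 <= y -> (Num.truncn y).+1%:R <= y + 1.
  by move=> y0; rewrite -natr1 lerD2r truncn_le.
rewrite card_dffun_ord !natrM !card_ord natr_prod -/d.
have h3 : (Num.truncn (2 * (d * (a i * a i)))).+1%:R <= (2 * d + 1) * (a i * a i).
  apply: le_trans (trn _ _) _; first by rewrite !mulr_ge0// ltW.
  by rewrite [leRHS]mulrDl -[2 * d * _]mulrA mul1r lerD2l ail.
have h2 : \prod_l (Num.truncn (2 * (if l \in E' then 2 * d * M * (a i * a l) else 0))).+1%:R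
    <= (4 * d * M + 1) ^+ #|E'| * a i ^+ #|E'| :> R.
  have -> : (4 * d * M + 1) ^+ #|E'| * a i ^+ #|E'| =
      \prod_(l in E') ((4 * d * M + 1) * a i * a l).
    by rewrite big_split /= (prod_weights hE' a0 aa) mulr1 prodr_const exprMn.
  rewrite [leRHS]big_mkcond /=; apply: ler_prod => l _; rewrite ler0n /=.
  case: ifP => [lE'|_]; last by rewrite mulr0 truncn0.
  have lE : l \in E by move: lE'; apply/fintype.subsetP/drop_pair_sub.
  apply: le_trans (trn _ _) _; first by rewrite !mulr_ge0// ltW.
  have -> : (4 * d * M + 1) * a i * a l = 2 * (2 * d * M * (a i * a l)) + a i * a l.
    by ring.
  by rewrite lerD2l ail.
rewrite (card_drop_pair hE iE) -/E' !exprS.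
set X : R := \prod_l _ in h2 *; set Y : R := (Num.truncn _).+1%:R in h3 *.
have X0 : 0 <= X by rewrite /X prodr_ge0.
have Y0 : 0 <= Y by [].
have -> : d * (2 * d + 1) * (4 * d * M + 1) ^+ #|E'| * N.+1%:R * (a i * (a i * a i ^+ #|E'|)) =
  d * N.+1%:R * ((4 * d * M + 1) ^+ #|E'| * a i ^+ #|E'|) * ((2 * d + 1) * (a i * a i)).
  by ring.
by rewrite ler_pM ?mulr_ge0// ler_wpM2l ?mulr_ge0.
Qed.

(** Label a frame [Q] by the position of its pivot and the label of its projection, then
    by the rounded coordinates of its pivot row in the frame of a representative [Q0], and
    at last by the rounded pairing of its pivot row with that of a representative [Q1].
    Two frames with the same label satisfy the hypotheses of the previous estimate, with
    [G] the projection of [Q0] and [u0] the pivot row of [Q1]. *)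
Lemma cover_step E D (M : R) (a : 'I_(n + n) -> R) i (C : R) N :
  rev_closed E -> rev_closed D -> (forall k, 0 < a k) -> (forall k, a k * a (rev_ord k) = 1) ->
  i \in E -> {in E, forall k, a k <= a i} -> 1 <= M -> 0 <= C ->
  {in D, forall j, covered (drop_pair E i) (drop_pair D j) (2 * M) a C N} ->
  exists2 N', covered E D M a
     (C + 2 * M * (d * C) + M ^+ 2 * (d + 1) + d * M ^+ 2) N' &
     N'%:R <= d * (2 * d + 1) * (4 * d * M + 1) ^+ #|drop_pair E i| * N.+1%:R * a i ^+ #|E|.
Proof.
move=> hE hD a0 aa iE amax M1 C0 IH.
set E' := drop_pair E i in IH *.
have d0 : 0 <= d by exact: ler0n.
have ex_jj (Q : 'M[R]_(n + n)) : exists j, bounded_frame E D M Q -> pivot D i Q j /\ Q i j != 0.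
  have [bQ|] := pselect (bounded_frame E D M Q); last by exists i.
  by have [j hj] := pivot_ex hE hD bQ iE; exists j.
have [jj hjj] := choice ex_jj.
have ex_F j : exists f : 'M[R]_(n + n) -> nat, j \in D ->
   (forall Q, bounded_frame E' (drop_pair D j) (2 * M) Q -> (f Q < N)%N) /\
    forall Q Q', bounded_frame E' (drop_pair D j) (2 * M) Q -> bounded_frame E' (drop_pair D j) (2 * M) Q' ->
      f Q = f Q' ->
      {in E' &, forall k l, a k * (a l * `|om (drop_pair D j) (row k Q) (row l Q')|) <= C}.
  have [jD|jD] := boolP (j \in D); last by exists (fun=> 0%N).
  by have [f hf] := IH j jD; exists f.
have [F hF] := choice ex_F.
pose pr (Q : 'M[R]_(n + n)) := Q *m pivot_proj (jj Q) (row i Q).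
have pr_b Q : bounded_frame E D M Q -> bounded_frame E' (drop_pair D (jj Q)) (2 * M) (pr Q).
  by move=> bQ; have [pQ nz] := hjj Q bQ; exact: proj_bounded_frame.
pose U Q := pivot_row i (jj Q) Q.
pose S Q := bounded_frame E D M Q.
have jj_lt Q : S Q -> (val (jj Q) < n + n)%N by move=> _; exact: ltn_ord.
have [_ [f1 [_ f1N hf1]]] := @refine_label _ 0 S (fun Q => val (jj Q)) _
  'I_N.+1 (fun _ Q => inord (F (jj Q) (pr Q))) jj_lt.
pose K l : R := if l \in E' then 2 * d * M * (a i * a l) else 0.
pose h2 Q0 Q : {dffun forall l, 'I_(Num.truncn (2 * K l)).+1} :=
  [ffun l : 'I_(n + n) => inord (Num.truncn
       (a i * (a l * om (drop_pair D (jj Q0)) (U Q) (row l (pr Q0))) + K l))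
     : 'I_(Num.truncn (2 * K l)).+1].
have [rep1 [f2 [hrep1 f2N hf2]]] := @refine_label _ 0 S f1 _ _ h2 f1N.
pose K3 : R := d * (a i * a i).
pose h3 Q1 Q : 'I_(Num.truncn (2 * K3)).+1 :=
  inord (Num.truncn (a i * (a i * om D (U Q1) (U Q)) + K3)).
have [rep2 [f3 [hrep2 f3N hf3]]] := @refine_label _ 0 S f2 _ _ h3 f2N.
have M0 : 0 <= M by apply: le_trans M1.
have U_le q l : S q -> l \in D -> `|U q 0 l| <= 1.
  by move=> bq lD; have [pq nq] := hjj q bq; exact: pivot_row_le pq nq lD.
have same1 q q' : S q -> S q' -> f1 q = f1 q' -> jj q = jj q' /\
    {in E' &, forall k l,
       a k * (a l * `|om (drop_pair D (jj q)) (row k (pr q)) (row l (pr q'))|) <= C}.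
  move=> bq bq' e; have [/val_inj ej eF] := hf1 q q' bq bq' e; split=> //.
  have [[jD _] _] := hjj q bq; have [hF1 hF2] := hF _ jD.
  have b1 := pr_b q bq; have b2 := pr_b q' bq'; rewrite -ej in b2 eF.
  have l1 : (F (jj q) (pr q) < N.+1)%N by exact: leqW (hF1 _ b1).
  have l2 : (F (jj q) (pr q') < N.+1)%N by exact: leqW (hF1 _ b2).
  apply: (hF2 _ _ b1 b2).
  by move: (congr1 (@nat_of_ord _) eF); rewrite (inordK l1) (inordK l2).
have lab2 q q' Q0 : S q -> S q' -> S Q0 -> jj q = jj Q0 -> jj q' = jj Q0 ->
    h2 Q0 q = h2 Q0 q' ->
    {in E', forall k, a i * (a k * `|om (drop_pair D (jj Q0)) (U q - U q') (row k (pr Q0))|) <= 1}.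
  move=> bq bq' bQ0 jq jq' e k kE.
  have [fG bG] := pr_b _ bQ0.
  have lab_le p : S p -> `|a i * (a k * om (drop_pair D (jj Q0)) (U p) (row k (pr Q0)))| <= K k.
    move=> bp; rewrite /K kE !normrM (gtr0_norm (a0 i)) (gtr0_norm (a0 k)).
    rewrite mulrA [leRHS]mulrC; apply: ler_wpM2l; first by rewrite mulr_ge0 ?ltW.
    rewrite (_ : 2 * d * M = d * (1 * (2 * M))); last by ring.
    apply: om_le => [|l lD]; first by rewrite mul1r mulr_ge0.
    have lD2 : l \in D by move: lD; apply/fintype.subsetP/drop_pair_sub.
    rewrite normrM ler_pM// ?U_le// mxE bG//.
    exact: (drop_pair_rev_closed hD).
  have ek : h2 Q0 q k = h2 Q0 q' k by rewrite e.
  rewrite !ffunE in ek; have := ltW (label_close (lab_le q bq) (lab_le q' bq') ek).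
  by rewrite -!mulrBr !normrM (gtr0_norm (a0 i)) (gtr0_norm (a0 k)) omDl omNl.
have lab3 q q' Q1 : S q -> S q' -> S Q1 -> h3 Q1 q = h3 Q1 q' ->
    a i * (a i * `|om D (U Q1) (U q) - om D (U Q1) (U q')|) <= 1.
  move=> bq bq' bQ1 e.
  have lab_le p : S p -> `|a i * (a i * om D (U Q1) (U p))| <= K3.
    move=> bp; rewrite !normrM (gtr0_norm (a0 i)) mulrA mulrC /K3.
    apply: ler_wpM2r; first by rewrite mulr_ge0 ?ltW.
    rewrite -[leRHS]mulr1; apply: om_le => // l lD.
    by rewrite normrM -[leRHS]mulr1 ler_pM ?U_le ?hD.
  by have := ltW (label_close (lab_le q bq) (lab_le q' bq') e); rewrite -!mulrBr !normrM (gtr0_norm (a0 i)).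
exists ((n + n) * #|'I_N.+1| * #|{dffun forall l, 'I_(Num.truncn (2 * K l)).+1}| *
        #|'I_(Num.truncn (2 * K3)).+1|)%N.
  exists f3; split=> // Q Q' bQ bQ' e3.
  have [e2 eh3] := hf3 Q Q' bQ bQ' e3.
  have [bQ1 e2'] := hrep2 Q bQ.
  set Q1 := rep2 (f2 Q) in bQ1 e2' eh3.
  have [e1 eh2] := hf2 Q Q' bQ bQ' e2.
  have [e1' eh2'] := hf2 Q Q1 bQ bQ1 (esym e2').
  have [bQ0 e1''] := hrep1 Q bQ.
  set Q0 := rep1 (f1 Q) in bQ0 e1'' eh2 eh2'.
  have [jQ cQ] := same1 Q0 Q bQ0 bQ e1''.
  have [jQ' cQ'] := same1 Q0 Q' bQ0 bQ' (etrans e1'' e1).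
  have [jQ1 _] := same1 Q0 Q1 bQ0 bQ1 (etrans e1'' e1').
  have [_ cQQ'] := same1 Q Q' bQ bQ' e1.
  rewrite -jQ in cQQ'.
  have [fG _] := pr_b _ bQ0.
  have [pQ nz] := hjj Q bQ; rewrite -jQ in pQ nz; have [jD _] := pQ.
  have [pQ' nz'] := hjj Q' bQ'; rewrite -jQ' in pQ' nz'.
  have [pQ1 nz1] := hjj Q1 bQ1; rewrite -jQ1 in pQ1 nz1.
  have prE q : jj Q0 = jj q -> q *m pivot_proj (jj Q0) (row i q) = pr q by rewrite /pr => ->.
  have UE q : jj Q0 = jj q -> pivot_row i (jj Q0) q = U q by rewrite /U => ->.
  have u1 : U Q1 0 (jj Q0) = 1 by rewrite -UE// pivot_row_pivot.
  have H2 := lab2 Q Q1 Q0 bQ bQ1 bQ0 (esym jQ) (esym jQ1) eh2'.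
  have H3 := lab2 Q' Q1 Q0 bQ' bQ1 bQ0 (esym jQ') (esym jQ1) (etrans (esym eh2) eh2').
  have H4 := lab2 Q Q' Q0 bQ bQ' bQ0 (esym jQ) (esym jQ') eh2.
  have H5 := lab3 Q Q' Q1 bQ bQ' bQ1 eh3.
  apply: (close_step hE hD a0 aa iE jD C0 M0 fG bQ bQ' amax pQ pQ' nz nz' u1).
  - by move=> q [->|->]; [rewrite (prE _ jQ); exact: cQ|rewrite (prE _ jQ'); exact: cQ'].
  - by rewrite (prE _ jQ) (prE _ jQ'); exact: cQQ'.
  - by move=> q [->|->]; [rewrite (UE _ jQ); exact: H2|rewrite (UE _ jQ'); exact: H3].
  - by rewrite (UE _ jQ) (UE _ jQ'); exact: H4.
  - by rewrite (UE _ jQ) (UE _ jQ'); exact: H5.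
exact: (@cover_count E M a N i K K3).
Qed.

(** The symmetric intervals of indices around the middle; the recursion removes the
    outermost pair, which has the largest weight. *)
Definition layer (m : nat) : {set 'I_(n + n)} :=
  finset (fun k : 'I_(n + n) => (n - m <= k)%N && (k < n + m)%N).

Lemma layer_rev_closed m : (m <= n)%N -> rev_closed (layer m).
Proof. by move=> mn [k hk]; rewrite !inE /= => /andP[h1 h2]; apply/andP; split; lia. Qed.

Lemma drop_pair_layer m (hm : (n - m.+1 < n + n)%N) : (m < n)%N ->
  drop_pair (layer m.+1) (Ordinal hm) = layer m.
Proof.
move=> mn; apply/setP => -[k hk]; rewrite in_drop_pair !inE -!val_eqE /=.
by apply/idP/idP => [/and4P[h1 h2 h3 h4]|/andP[h1 h2]]; [apply/andP|apply/and4P]; split; lia.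
Qed.

Lemma card_layer m : (m <= n)%N -> #|layer m| = m.*2.
Proof.
elim: m => [_|m IH mn].
  by apply/eqP; rewrite cards_eq0; apply/eqP/setP => k; rewrite !inE; apply/negP; lia.
have hm : (n - m.+1 < n + n)%N by lia.
have iL : Ordinal hm \in layer m.+1 by rewrite inE /=; lia.
by rewrite (card_drop_pair (layer_rev_closed mn) iL) drop_pair_layer// IH// ltnW.
Qed.

Lemma layer_full : layer n = fullI.
Proof. by apply/setP => k; rewrite !inE subnn /= ltn_ord. Qed.

Lemma covered_le E D (M : R) a (C C' : R) N N' : C <= C' -> (N <= N')%N ->
  covered E D M a C N -> covered E D M a C' N'.
Proof.
move=> CC NN [f [f1 f2]]; exists f; split=> [Q bQ|Q Q' bQ bQ' e k l kE lE].
  exact: leq_trans (f1 Q bQ) NN.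
exact: le_trans (f2 Q Q' bQ bQ' e k l kE lE) CC.
Qed.

(** For the full range of indices this is the value at the diagonal matrix [a] of the sum of
    the positive roots of the symplectic group, as a multiplicative character. *)
Definition weight m (a : 'I_(n + n) -> R) : R :=
  \prod_(k < n + n | (n - m <= k)%N && (k < n)%N) a k ^+ (2 * (n - k)).

Lemma weightS m (hm : (n - m.+1 < n + n)%N) a : (m < n)%N ->
  weight m.+1 a = a (Ordinal hm) ^+ m.+1.*2 * weight m a.
Proof.
move=> mn; rewrite /weight (bigD1 (Ordinal hm))/=; last by apply/andP; split; lia.
congr (_ ^+ _ * _); first by lia.
apply: eq_bigl => -[k hk]; rewrite -val_eqE /=.
by apply/idP/idP => [/andP[/andP[h1 h2] h3]|/andP[h1 h2]]; rewrite ?h2; lia.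
Qed.

Lemma weight_ge1 m (a : 'I_(n + n) -> R) : (forall k, 0 < a k) ->
    (forall k, a k * a (rev_ord k) = 1) -> (forall k l, (k <= l)%N -> a l <= a k) ->
  1 <= weight m a.
Proof.
move=> a0 aa amon; apply: (big_ind (fun z : R => 1 <= z)) => //.
  by move=> p q p1 q1; rewrite -[1]mulr1 ler_pM.
move=> k /andP[_ kn]; rewrite exprn_ege1// -(@ler_pXn2r _ 2) ?nnegrE ?(ltW (a0 _))//.
by rewrite expr1n expr2 -{1}(aa k) ler_wpM2l ?(ltW (a0 _))// amon//=; lia.
Qed.

(** The sets where all [a k * a l * om q_k q'_l] are bounded are, up to constants, cosets of
    [U cap a^-1 U a] for a compact neighbourhood [U] of the identity, and its volume is the
    inverse of the weight. *)
Lemma covering m : (m <= n)%N -> forall M : R, 1 <= M -> exists2 C : R, 1 <= C &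
  forall D (a : 'I_(n + n) -> R), rev_closed D -> (forall k, 0 < a k) ->
    (forall k, a k * a (rev_ord k) = 1) ->
    (forall k l, (k <= l)%N -> a l <= a k) ->
    exists2 N, covered (layer m) D M a C N & N%:R <= C * weight m a.
Proof.
elim: m => [_ M _|m IH mn M M1].
  exists 1 => // D a hD a0 aa amon; exists 1%N; last first.
    by rewrite /weight big_pred0 ?mulr1// => k; apply/negP; lia.
  by exists (fun=> 0%N); split=> // Q Q' _ _ _ k l; rewrite !inE => kE; exfalso; lia.
have M2 : 1 <= 2 * M by move: M1; clear -d; lra.
have [C' C1 hC] := IH (ltnW mn) (2 * M) M2.
have d0 : 0 <= d by exact: ler0n.
have M0 : 0 <= M by apply: le_trans M1.
have C0 : 0 <= C' by apply: le_trans C1.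
have hm : (n - m.+1 < n + n)%N by lia.
pose i := Ordinal hm.
pose A : R := d * (2 * d + 1) * (4 * d * M + 1) ^+ m.*2.
pose B : R := C' + 2 * M * (d * C') + M ^+ 2 * (d + 1) + d * M ^+ 2.
have A0 : 0 <= A by rewrite /A !(mulr_ge0, addr_ge0, exprn_ge0).
have BC : C' <= B by rewrite /B -!addrA lerDl !(mulr_ge0, addr_ge0, sqr_ge0).
have AC : 0 <= A * (2 * C') by rewrite mulr_ge0// mulr_ge0.
have iE : i \in layer m.+1 by rewrite inE /=; lia.
exists (B + A * (2 * C')).
  by apply: le_trans C1 (le_trans BC _); rewrite lerDl.
clear IH M2 => D a hD a0 aa amon.
have P1 := weight_ge1 m a0 aa amon; have P0 := le_trans ler01 P1.
have hE : rev_closed (layer m.+1) by exact: layer_rev_closed.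
have amax : {in layer m.+1, forall k, a k <= a i}.
  by move=> k; rewrite inE => /andP[h _]; exact: amon.
have IHm : {in D, forall j, covered (drop_pair (layer m.+1) i) (drop_pair D j) (2 * M) a C'
    (Num.truncn (C' * weight m a))}.
  move=> j jD; rewrite drop_pair_layer//.
  have [N cN hN] := hC (drop_pair D j) a (drop_pair_rev_closed hD) a0 aa amon.
  by apply: covered_le cN => //; rewrite truncn_ge_nat// mulr_ge0.
have [N' cN' hN'] := cover_step hE hD a0 aa iE amax M1 C0 IHm.
exists N'; first by apply: covered_le cN' => //; rewrite -/B lerDl.
rewrite drop_pair_layer// (card_layer mn) (card_layer (ltnW mn)) in hN'.
apply: le_trans hN' _; rewrite (weightS hm a mn) -/i -/A.
have CP : (Num.truncn (C' * weight m a)).+1%:R <= 2 * C' * weight m a.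
  have CP0 : 0 <= C' * weight m a by rewrite mulr_ge0.
  have CP1 : 1 <= C' * weight m a by rewrite -[1]mulr1 ler_pM.
  have tr : (Num.truncn (C' * weight m a))%:R <= C' * weight m a by rewrite truncn_le.
  by rewrite -natr1 -mulrA; move: tr CP1; set z := C' * weight m a; clear -d; lra.
have ai0 : 0 <= a i ^+ m.+1.*2 by rewrite exprn_ge0// ltW.
rewrite [leRHS]mulrCA [leLHS]mulrC ler_wpM2l//.
apply: (@le_trans _ _ (A * (2 * C' * weight m a))); first by rewrite ler_wpM2l.
rewrite mulrA ler_wpM2r// lerDr; exact: le_trans C0 BC.
Qed.

End Frames.

(** * Counting with injections *)

Section Counting.
Local Open Scope classical_set_scope.

Lemma counting_le (R : realType) (X : choiceType) (A : set X) (N : nat) (f : X -> nat) :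
  (forall x, A x -> (f x < N)%N) ->
  (forall x y, A x -> A y -> f x = f y -> x = y) ->
  (counting A <= (N%:R : R)%:E)%E.
Proof.
move=> fN finj.
have fA : (f @` A #= A)%card.
  by apply: inj_card_eq => x y; rewrite !inE => Ax Ay; exact: finj.
have sA : f @` A `<=` `I_N by move=> _ [x Ax <-]; exact: fN.
have AN : (A #<= `I_N)%card by rewrite -(card_le_eql fA); exact: subset_card_le.
have fin : finite_set A := card_le_finite AN (finite_II N).
have [m Am] := (finite_setP A).1 fin.
rewrite /counting asboolT// lee_fin ler_nat (card_fset_set Am).
by rewrite -card_le_II -(card_le_eql Am).
Qed.

Lemma counting_ge (R : realType) (X : choiceType) (A : set X) (T : finType) (h : T -> X) :
  (forall t, A (h t)) -> injective h -> ((#|T|%:R : R)%:E <= counting A)%E.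
Proof.
move=> hA hinj; rewrite /counting; case: asboolP => [fin|_]; last by rewrite leey.
rewrite lee_fin ler_nat cardE -(size_map h); apply: uniq_leq_size.
  by rewrite map_inj_uniq ?enum_uniq.
move=> x /mapP[t _ ->]; apply: (etrans (in_fset_set fin (h t))).
exact: (mem_set (hA t)).
Qed.

End Counting.

(** * Coefficients of products of linear factors *)

Section Polynomials.
Variable R : realFieldType.
Implicit Types (p q : {poly R}) (x y c : R).

Lemma coefMXsubC p c j :
  (p * ('X - c%:P))`_j = (if j is j'.+1 then p`_j' else 0) - c * p`_j.
Proof. by rewrite mulrBr coefB coefMX coefMC [p`_j * c]mulrC; case: j. Qed.

(** Elementary symmetric functions are dominated by the product of the largest terms. *)
Lemma coef_prod_bound (x b : nat -> R) (m : nat) :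
  (forall i, `|x i| <= b i) -> (forall i j, (i <= j)%N -> b j <= b i) ->
  forall j, (j <= m)%N ->
    `|(\prod_(i < m) ('X - (x i)%:P))`_(m - j)| <= 2 ^+ m * \prod_(i < j) b i.
Proof.
move=> hx hb; have b0 i : 0 <= b i by apply: le_trans (hx i).
have P0 j : 0 <= \prod_(i < j) b i by rewrite prodr_ge0.
elim: m => [|m IH] j jm.
  by move: jm; rewrite leqn0 => /eqP ->; rewrite !big_ord0 coefC normr1 mulr1.
rewrite big_ord_recr /= coefMXsubC exprS.
set f := \prod_(i < m) _ in IH *.
have sf : size f = m.+1.
  have -> : f = \prod_(i <- enum 'I_m) ('X - (x i)%:P) by rewrite big_enum.
  by rewrite size_prod_XsubC size_enum_ord.
have h1 : `|if (m.+1 - j)%N is j'.+1 then f`_j' else 0| <= 2 ^+ m * \prod_(i < j) b i.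
  have [jm'|jm'] := leqP j m; first by rewrite subSn//; exact: IH.
  by rewrite (eqP (_ : m.+1 - j == 0)%N) ?subn_eq0// normr0 mulr_ge0// exprn_ge0.
have h2 : `|x m * f`_(m.+1 - j)| <= 2 ^+ m * \prod_(i < j) b i.
  case: j jm {h1} => [_|j jm].
    by rewrite subn0 nth_default ?sf// mulr0 normr0 mulr_ge0// exprn_ge0.
  rewrite subSS normrM big_ord_recr /= mulrA mulrC.
  apply: ler_pM => //; first exact: IH.
  by apply: le_trans (hx m) (hb _ _ _).
by apply: le_trans (ler_normB _ _) _; move: h1 h2; rewrite -mulrA; lra.
Qed.

Lemma horner_rev (a : nat -> R) m y : y != 0 ->
  y ^+ m * (\poly_(j < m.+1) a j).[y^-1] = (\poly_(j < m.+1) a (m - j)%N).[y].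
Proof.
move=> y0; rewrite !horner_poly mulr_sumr (reindex_inj rev_ord_inj) /=.
apply: eq_bigr => -[j hj] _ /=; rewrite subSS mulrCA; congr (_ * _).
by rewrite exprVn -{1}(subnK (leq_subr j m)) subKn// exprD mulfK// expf_neq0.
Qed.

Lemma poly_eq_nonzero p q m : (size p <= m)%N -> (size q <= m)%N ->
  (forall y, y != 0 -> p.[y] = q.[y]) -> p = q.
Proof.
move=> sp sq h; apply/eqP; rewrite -subr_eq0; apply/eqP.
apply: (@roots_geq_poly_eq0 _ _ [seq i.+1%:R : R | i <- iota 0 m]).
- by apply/allP => _ /mapP[i _ ->]; rewrite rootE hornerD hornerN h ?subrr.
- by rewrite map_inj_uniq ?iota_uniq// => i j /eqP; rewrite eqr_nat => /eqP[].
- rewrite size_map size_iota; apply: leq_trans (size_polyD _ _) _.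
  by rewrite size_polyN geq_max sp sq.
Qed.

(** The hypothesis says that [p] and its reversal have the same values off 0. *)
Lemma palindrome_coef p m : (size p <= m.+1)%N ->
  (forall y, y != 0 -> y ^+ m * p.[y^-1] = p.[y]) ->
  forall j, (j <= m)%N -> p`_j = p`_(m - j).
Proof.
move=> sp h j jm.
have pE : p = \poly_(j < m.+1) p`_j.
  apply/polyP => i; rewrite coef_poly; case: ltnP => // mi.
  by rewrite nth_default// (leq_trans sp).
have {1}-> : p = \poly_(j < m.+1) p`_(m - j).
  apply: (poly_eq_nonzero sp (size_poly _ _)) => y y0.
  by rewrite -(horner_rev (fun j => p`_j) _ y0) -pE h.
by rewrite coef_poly ltnS jm.
Qed.

End Polynomials.

(** * Eigenvalues of loxodromic elements *)

Section Loxodromic.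
Variables (R : realType) (n : nat).
Implicit Types (g : 'M[R]_(n + n)) (k l : 'I_(n + n)).
Local Open Scope complex_scope.

Lemma eigenvaluesE g : map_poly (real_complex R) (char_poly g) =
  \prod_(z <- eigenvalues g) ('X - z%:P).
Proof.
have := svalP (closed_field_poly_normal (map_poly (real_complex R) (char_poly g))).
rewrite -/(eigenvalues g) => {1}->.
by rewrite (monicP _) ?scale1r// monic_map// char_poly_monic.
Qed.

Lemma size_eigenvalues g : size (eigenvalues g) = (n + n)%N.
Proof.
have := congr1 (fun p : {poly R[i]} => size p) (eigenvaluesE g).
by rewrite size_map_poly size_char_poly size_prod_XsubC => -[].
Qed.

Lemma mem_eigenvalues g z :
  (z \in eigenvalues g) = root (map_poly (real_complex R) (char_poly g)) z.
Proof. by rewrite eigenvaluesE root_prod_XsubC. Qed.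

Lemma mem_eigenvalues_real g (x : R) : (x%:C \in eigenvalues g) = root (char_poly g) x.
Proof. by rewrite mem_eigenvalues (fmorph_root (real_complex R)). Qed.

Lemma mem_eigenvalues_conj g z : z \in eigenvalues g -> z^* \in eigenvalues g.
Proof.
rewrite !mem_eigenvalues -complex_root_conj -map_poly_comp.
move=> h; rewrite (@eq_map_poly _ _ _ (real_complex R))// => x; exact: conjc_real.
Qed.

Lemma char_poly_tr g : char_poly g^T = char_poly g.
Proof.
rewrite /char_poly -[RHS]det_tr; congr (\det _).
by rewrite /char_poly_mx linearB /= tr_scalar_mx map_trmx.
Qed.

Definition lmod (z : R[i]) : R := ln (ComplexField.Normc.normc z).

Lemma jordan_sorted g k l : (k <= l)%N -> jordan g 0 l <= jordan g 0 k.
Proof.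
move=> kl; rewrite !mxE.
have tot : total (fun x y : R => y <= x) by move=> x y; exact: le_total.
have tr : transitive (fun x y : R => y <= x) by move=> x y z /[swap]; exact: le_trans.
have := sort_sorted tot [seq lmod z | z <- eigenvalues g].
move=> /(sorted_leq_nth tr (fun x => lexx x) 0)/(_ k l); apply => //.
- by rewrite inE size_sort size_map size_eigenvalues.
- by rewrite inE size_sort size_map size_eigenvalues.
Qed.

Lemma jordan_perm g :
  perm_eq [seq jordan g 0 k | k <- enum 'I_(n + n)] [seq lmod z | z <- eigenvalues g].
Proof.
have := perm_sort (fun x y : R => y <= x) [seq lmod z | z <- eigenvalues g].
set L := sort _ _ => hL.
have -> : [seq jordan g 0 k | k <- enum 'I_(n + n)] = L; last by rewrite hL.
have sL : size L = (n + n)%N by rewrite /L size_sort size_map size_eigenvalues.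
apply: (@eq_from_nth _ 0); first by rewrite size_map size_enum_ord sL.
move=> i; rewrite size_map size_enum_ord => hi.
rewrite (nth_map (Ordinal hi)) ?size_enum_ord// mxE -/L.
by rewrite (nth_ord_enum (Ordinal hi) (Ordinal hi)).
Qed.

Lemma lmod_real (x : R) : lmod x%:C = ln `|x|.
Proof. by rewrite /lmod /= expr0n addr0 sqrtr_sqr. Qed.

Lemma lmod_conj z : lmod z^* = lmod z.
Proof. by case: z => a b; rewrite /lmod /= sqrrN. Qed.

Lemma Sp_sympl g : Sp g -> g *m sympl_form *m g^T = sympl_form.
Proof. by move=> [_ h]; have := @sympl_tr R n g^T; rewrite trmxK; apply. Qed.

Lemma Sp_unit g : Sp g -> g \in unitmx.
Proof. by move=> [h _]; rewrite unitmxE h unitr1. Qed.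

Lemma root_char_neq0 g (x : R) : Sp g -> root (char_poly g) x -> x != 0.
Proof.
move=> hg; rewrite -eigenvalue_root_char; apply: contraTneq => ->; apply/negP.
move=> /eigenvalueP[v hv /negP[]]; apply/eqP; rewrite scale0r in hv.
by have := congr1 (mulmx^~ (invmx g)) hv; rewrite mulmxK ?Sp_unit// mul0mx.
Qed.

Lemma eigen_tr g (x : R) (v : 'rV[R]_(n + n)) : Sp g -> x != 0 ->
  v *m g = x *: v -> (v *m sympl_form) *m g^T = x^-1 *: (v *m sympl_form).
Proof.
move=> /Sp_sympl hg x0 hv.
have : v *m sympl_form = x *: (v *m sympl_form *m g^T).
  by rewrite -{1}hg !mulmxA hv -!scalemxAl.
by move=> {2}->; rewrite scalerA mulVf// scale1r.
Qed.

Lemma sympl_form_inj (v : 'rV[R]_(n + n)) : v *m sympl_form = 0 -> v = 0.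
Proof.
move=> h; have := congr1 (mulmx^~ sympl_form) h.
by rewrite -mulmxA sympl_formK mulmxN mulmx1 mul0mx => /eqP; rewrite oppr_eq0 => /eqP.
Qed.

Lemma root_char_inv g (x : R) : Sp g -> root (char_poly g) x -> root (char_poly g) x^-1.
Proof.
move=> hg hx; have x0 := root_char_neq0 hg hx; move: hx.
rewrite -[in X in _ -> X]char_poly_tr -!eigenvalue_root_char => /eigenvalueP[v hv v0].
apply/eigenvalueP; exists (v *m sympl_form); first exact: eigen_tr.
by apply: contra v0 => /eqP/sympl_form_inj ->.
Qed.

(** The gaps of [w] exceed [2 * c], so the coordinates of the Jordan projection are distinct:
    this is how loxodromic elements enter. *)
Definition near_regular g (w : 'I_(n + n) -> R) (c : R) :=
  [/\ forall k, `|jordan g 0 k - w k| <= c,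
      forall k l, (k < l)%N -> w l + 2 * c < w k &
      forall k, w (rev_ord k) = - w k].

(** Distinct moduli force each eigenvalue to be its own complex conjugate, hence real;
    as the spectrum is stable under inversion, the order of the moduli forces opposite
    indices to carry inverse eigenvalues. *)
Lemma loxodromic_roots g w c : Sp g -> near_regular g w c ->
  exists x : 'I_(n + n) -> R, [/\
    perm_eq (eigenvalues g) [seq (x k)%:C | k <- enum 'I_(n + n)],
    forall k, `|x k| = expR (jordan g 0 k), injective x &
    forall k, x k * x (rev_ord k) = 1].
Proof.
move=> hg [hw gap wrev].
have jinj : injective (fun k => jordan g 0 k).
  have jlt k l : (k < l)%N -> jordan g 0 l < jordan g 0 k.
    move=> kl; have := gap k l kl; have := hw k; have := hw l.
    by rewrite !ler_norml => /andP[h1 h2] /andP[h3 h4]; lra.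
  move=> k l /= e; have [/jlt|/jlt|/val_inj//] := ltngtP (val k) (val l).
    by rewrite e ltxx.
  by rewrite e ltxx.
have ex_z k : exists z, z \in eigenvalues g /\ lmod z = jordan g 0 k.
  have : jordan g 0 k \in [seq lmod z | z <- eigenvalues g].
    by rewrite -(perm_mem (jordan_perm g)) map_f// mem_enum.
  by move=> /mapP[z hz ->]; exists z.
have [z hz] := choice ex_z.
have zinj : injective z.
  by move=> k l e; apply: jinj => /=; rewrite -(hz k).2 -(hz l).2 e.
have pz : perm_eq (eigenvalues g) [seq z k | k <- enum 'I_(n + n)].
  rewrite perm_sym.
  have uz : uniq [seq z k | k <- enum 'I_(n + n)] by rewrite map_inj_uniq ?enum_uniq.
  have sz : {subset [seq z k | k <- enum 'I_(n + n)] <= eigenvalues g}.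
    by move=> _ /mapP[k _ ->]; exact: (hz k).1.
  have le : (size (eigenvalues g) <= size [seq z k | k <- enum 'I_(n + n)])%N.
    by rewrite size_eigenvalues size_map size_enum_ord.
  have [_ ez] := uniq_min_size uz sz le.
  by apply: uniq_perm => //; exact: leq_size_uniq uz sz le.
have ez u : u \in eigenvalues g -> exists k, u = z k.
  by rewrite (perm_mem pz) => /mapP[k _ ->]; exists k.
(* The conjugate of [z k] is an eigenvalue of the same modulus. *)
have zreal k : z k = (complex.Re (z k))%:C.
  have [l hl] := ez _ (mem_eigenvalues_conj (hz k).1).
  have lk : l = k by apply: jinj => /=; rewrite -(hz k).2 -(hz l).2 -hl lmod_conj.
  move: hl; rewrite lk; case: (z k) => a b /= [] /eqP.
  by rewrite eq_sym -addr_eq0 -mulr2n mulrn_eq0 /= => /eqP ->.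
pose x k := complex.Re (z k).
have zx k : z k = (x k)%:C by exact: zreal.
have xroot k : root (char_poly g) (x k) by rewrite -mem_eigenvalues_real -zx (hz k).1.
have x0 k : x k != 0 by exact: root_char_neq0 hg (xroot k).
have xinj : injective x by move=> k l e; apply: zinj; rewrite !zx e.
have xnorm k : `|x k| = expR (jordan g 0 k).
  by rewrite -(hz k).2 zx lmod_real lnK// posrE normr_gt0.
exists x; split=> //.
  by rewrite (eq_map (fun k => esym (zx k))).
move=> k; have := root_char_inv hg (xroot k).
rewrite -mem_eigenvalues_real => /ez[l]; rewrite zx => -[xl].
have jl : jordan g 0 l = - jordan g 0 k.
  by apply: expR_inj; rewrite expRN -!xnorm -xl normfV.
suff -> : rev_ord k = l by rewrite -xl mulfV.
have := hw l; have := hw k; have := wrev k; rewrite jl => wk.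
rewrite !ler_norml => /andP[h1 h2] /andP[h3 h4].
by have [/gap p0|/gap p0|/val_inj//] := ltngtP (val (rev_ord k)) (val l); exfalso; move: p0; rewrite wk;
  move: h1 h2 h3 h4; move: (w l) (w k) (jordan g 0 k) => p q r; lra.
Qed.

(** The classical induction: apply [A - x k0] to a relation. *)
Lemma eigen_indep (A : 'M[R]_(n + n)) (x : 'I_(n + n) -> R)
    (v : 'I_(n + n) -> 'rV[R]_(n + n)) : injective x ->
  (forall k, v k *m A = x k *: v k) -> (forall k, v k != 0) ->
  forall (s : seq 'I_(n + n)), uniq s -> forall c : 'I_(n + n) -> R,
    \sum_(k <- s) c k *: v k = 0 -> forall k, k \in s -> c k = 0.
Proof.
move=> xinj hv v0; elim=> [|k0 s IH] //= /andP[k0s us] c hc.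
have cs k : k \in s -> c k = 0.
  move=> ks; have := IH us (fun k => c k * (x k - x k0)) _ k ks.
  have -> : \sum_(j <- s) (c j * (x j - x k0)) *: v j = 0.
    have := congr1 (fun u => u *m A - x k0 *: u) hc.
    rewrite mul0mx scaler0 subr0 big_cons mulmxDl scalerDr -scalemxAl hv !scalerA mulrC.
    rewrite opprD addrACA subrr add0r mulmx_suml scaler_sumr -sumrB => h; rewrite -[RHS]h.
    by apply: eq_bigr => j _; rewrite -scalemxAl hv !scalerA -scalerBl; congr (_ *: _); ring.
  move=> /(_ erefl)/eqP; rewrite mulf_eq0 subr_eq0 => /orP[/eqP//|/eqP/xinj kk].
  by rewrite -kk ks in k0s.
move=> k; rewrite inE => /orP[/eqP->|]; last exact: cs.
move: hc; rewrite big_cons big1_seq ?addr0 => [/eqP|j /= /cs->]; last by rewrite scale0r.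
by rewrite scaler_eq0 (negPf (v0 _)) orbF => /eqP.
Qed.

(** Eigenvectors of eigenvalues [x] and [y] are orthogonal unless [x * y = 1], so they
    pair off, and the form being nondegenerate they can be scaled to a symplectic basis. *)
Lemma eigen_frame g (x : 'I_(n + n) -> R) : Sp g -> injective x ->
  (forall k, root (char_poly g) (x k)) -> (forall k, x k * x (rev_ord k) = 1) ->
  exists Q : 'M[R]_(n + n), Q *m sympl_form *m Q^T = sympl_form /\
    forall k, row k Q *m g^T = x k *: row k Q.
Proof.
move=> hg xinj xroot xx.
have hT : rev_closed [set: 'I_(n + n)]%SET by move=> ? _; rewrite inE.
have ex_v k : exists v : 'rV[R]_(n + n), v *m g^T = x k *: v /\ v != 0.
  have := xroot k; rewrite -char_poly_tr -eigenvalue_root_char.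
  by move=> /eigenvalueP[v hv v0]; exists v.
have [v hv] := choice ex_v.
have om0 k l : l != rev_ord k -> om [set: 'I_(n + n)]%SET (v k) (v l) = 0.
  move=> lk; have : om [set: 'I_(n + n)]%SET (v k) (v l) =
     x k * (x l * om [set: 'I_(n + n)]%SET (v k) (v l)).
    rewrite -omZr -omZl -!(hv _).1 !om_symplE -{1}(hg.2) trmx_mul trmxK.
    by rewrite !mulmxA.
  rewrite mulrA => /eqP; rewrite -subr_eq0 -{1}[om _ _ _]mul1r -mulrBl mulf_eq0.
  move=> /orP[|/eqP//]; rewrite subr_eq0 -(xx k) => /eqP e; exfalso.
  have xk0 : x k != 0 by apply: contraTneq (oner_neq0 R) => z; rewrite -(xx k) z mul0r eqxx.
  by move: lk; rewrite -(xinj _ _ (mulfI xk0 e)) eqxx.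
pose V : 'M[R]_(n + n) := \matrix_k v k.
have Vu : V \in unitmx.
  rewrite -row_free_unit; apply: inj_row_free => u hu; apply/rowP => k; rewrite mxE.
  apply: (eigen_indep xinj (fun k => (hv k).1) (fun k => (hv k).2) (enum_uniq 'I_(n + n))).
    by move: hu; rewrite mulmx_sum_row big_enum /=; under eq_bigr do rewrite rowK.
  by rewrite mem_enum.
have omn0 k : om [set: 'I_(n + n)]%SET (v k) (v (rev_ord k)) != 0.
  apply/eqP => h0; have : v k *m sympl_form *m V^T = 0.
    apply/rowP => l; rewrite [RHS]mxE.
    have -> : (v k *m sympl_form *m V^T) 0 l = om [set: 'I_(n + n)]%SET (v k) (v l).
      rewrite om_symplE -[LHS]row_col -tr_row rowK; congr ((_ *m _) 0 0).
      by apply/rowP => b; rewrite [LHS]mxE.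
    by have [->|/om0] := eqVneq l (rev_ord k).
  move=> /(congr1 (mulmx^~ (invmx V^T))); rewrite mulmxK ?unitmx_tr// mul0mx.
  by move=> /sympl_form_inj/eqP; rewrite (negPf (hv k).2).
(* Only the second vector of each pair is rescaled, to make the pairing equal to 1. *)
pose c k : R := if (k < n)%N then 1 else (om [set: 'I_(n + n)]%SET (v (rev_ord k)) (v k))^-1.
exists (\matrix_k (c k *: v k)); split; last first.
  by move=> k; rewrite rowK -scalemxAl (hv k).1 !scalerA mulrC.
apply/matrixP => k l; rewrite -row_col -tr_row row_mul -om_symplE !rowK sympl_formE.
rewrite omZl omZr; have [->|lk] := eqVneq l (rev_ord k); last by rewrite om0// !mulr0.
rewrite mulr1 /c rev_ordK /sg /=.
have -> : (n + n - k.+1 < n)%N = ~~ (k < n)%N by case: k => k hk /=; lia.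
have on := omn0 k; case: ifP => kn; rewrite /= !mul1r; first by rewrite mulVf.
rewrite (omC _ _ hT) in on *; rewrite mulrN mulVf//.
by rewrite oppr_eq0 in on.
Qed.

(** * Upper bound for conjugacy classes *)

Lemma sympl_form_int : mxint (@sympl_form R n).
Proof. by move=> k l; rewrite sympl_formE rpredM ?sg_int// rpred_nat. Qed.

Lemma sympl_inv (Q : 'M[R]_(n + n)) : Q *m sympl_form *m Q^T = sympl_form ->
  Q *m (- (sympl_form *m Q^T *m sympl_form)) = 1%:M.
Proof. by move=> h; rewrite mulmxN !mulmxA h sympl_formK opprK. Qed.

Lemma Sp_invE g : Sp g -> invmx g = - (sympl_form *m g^T *m sympl_form).
Proof.
move=> hg; have := sympl_inv (Sp_sympl hg) => h.
by rewrite -[LHS]mulmx1 -h mulmxA mulVmx ?mul1mx// Sp_unit.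
Qed.

Lemma SpZ_mul g h : SpZ g -> SpZ h -> SpZ (g *m h).
Proof.
move=> [[dg Jg] ig] [[dh Jh] ih]; split; last exact: mxint_mul.
split; first by rewrite det_mulmx dg dh mulr1.
by rewrite trmx_mul -!mulmxA [sympl_form *m _]mulmxA [g^T *m _]mulmxA mulmxA Jg mulmxA.
Qed.

Lemma SpZ_inv g : SpZ g -> SpZ (invmx g).
Proof.
move=> [hg ig]; have gu := Sp_unit hg; split.
  split; first by rewrite det_inv hg.1 invr1.
  by rewrite -{1}hg.2 !mulmxA -trmx_mul mulmxV// trmx1 mul1mx -mulmxA mulmxV ?mulmx1.
rewrite Sp_invE// => k l; rewrite mxE rpredN.
have igT : mxint g^T by move=> a b; rewrite mxE; exact: ig.
exact: (mxint_mul (mxint_mul sympl_form_int igT) sympl_form_int).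
Qed.

Lemma invmx_mulmx (A B : 'M[R]_(n + n)) : A \in unitmx -> B \in unitmx ->
  invmx (A *m B) = invmx B *m invmx A.
Proof.
move=> uA uB; have uAB : A *m B \in unitmx by rewrite unitmx_mul uA.
have e : (A *m B) *m (invmx B *m invmx A) = 1%:M.
  by rewrite mulmxA -[A *m B *m _]mulmxA mulmxV// mulmx1 mulmxV.
by rewrite -[LHS]mulmx1 -e mulmxA mulVmx// mul1mx.
Qed.

Lemma SpZ_class_conj g h : SpZ h -> SpZ_class (h *m g *m invmx h) = SpZ_class g.
Proof.
move=> hh; have uh := Sp_unit hh.1; apply/seteqP; split=> [_ [p hp <-]|_ [p hp <-]].
  exists (p *m h); first exact: SpZ_mul.
  by rewrite invmx_mulmx ?(Sp_unit hp.1)// !mulmxA.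
exists (p *m invmx h); first by apply: SpZ_mul => //; exact: SpZ_inv.
rewrite invmx_mulmx ?(Sp_unit hp.1) ?unitmx_inv// invmxK !mulmxA.
rewrite -[p *m invmx h *m h]mulmxA mulVmx// mulmx1.
by rewrite -[_ *m invmx h *m h]mulmxA mulVmx// mulmx1.
Qed.

(** Conjugating by the matrix [h] of reduction theory makes the eigenframe a bounded
    matrix times a diagonal one, and rescaling eigenvectors absorbs the diagonal. *)
Lemma bounded_eigen_rep : exists2 C : R, 1 <= C & forall g w c, SpZ g -> near_regular g w c ->
  exists g1 (Q : 'M[R]_(n + n)) (x : 'I_(n + n) -> R),
    [/\ SpZ g1, SpZ_class g1 = SpZ_class g, Q *m sympl_form *m Q^T = sympl_form,
      forall k l, `|Q k l| <= C &
      forall k, row k Q *m g1^T = x k *: row k Q /\ `|x k| = expR (jordan g 0 k)].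
Proof.
have [C C1 hC] := reduce_sympl R n; exists C => // g w c hg hw.
have [x [px xnorm xinj xx]] := loxodromic_roots hg.1 hw.
have xroot k : root (char_poly g) (x k).
  by rewrite -mem_eigenvalues_real (perm_mem px); apply/mapP; exists k; rewrite ?mem_enum.
have [Q [hQ Qg]] := eigen_frame hg.1 xinj xroot xx.
have [|h [t [th t0 tt hb]]] := hC Q^T; first by rewrite trmxK; exact: sympl_tr.
have hh := tvg_SpZ th; have uh := Sp_unit hh.1.
exists (h *m g *m invmx h), (\matrix_k ((t k)^-1 *: row k (Q *m h^T))), x; split.
- exact: (SpZ_mul (SpZ_mul hh hg) (SpZ_inv hh)).
- exact: SpZ_class_conj.
- apply/matrixP => k l; rewrite -row_col -tr_row row_mul -om_symplE !rowK sympl_formE.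
  rewrite omZl omZr om_symplE tr_row -row_mul row_col trmx_mul trmxK.
  rewrite !mulmxA -[_ *m h^T *m sympl_form]mulmxA -[_ *m (_ *m _) *m h]mulmxA hh.1.2 hQ.
  rewrite sympl_formE; have [->|_] := eqVneq l (rev_ord k); last by rewrite !mulr0.
  by rewrite mulrA -invfM tt invr1 mul1r.
- move=> k l; rewrite !mxE -/((Q *m h^T) k l) normrM gtr0_norm ?invr_gt0//.
  rewrite mulrC ler_pdivrMr//; have := hb l k.
  by rewrite -[h *m Q^T]trmxK trmx_mul trmxK [_^T _ _]mxE mxE.
- move=> k; split=> //; rewrite rowK -scalemxAl !scalerA mulrC -scalerA; congr (_ *: _).
  rewrite !trmx_mul row_mul !mulmxA -[_ *m h^T *m _]mulmxA -trmx_mul mulVmx// trmx1 mulmx1.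
  by rewrite Qg -scalemxAl.
Qed.

Lemma norm_mx3 (A B C : 'M[R]_(n + n)) (al be ga : R) :
  (forall k l, `|A k l| <= al) -> (forall k l, `|B k l| <= be) ->
  (forall k l, `|C k l| <= ga) ->
  forall k l, `|(A *m B *m C) k l| <= (n + n)%:R * ((n + n)%:R * (al * be) * ga).
Proof.
have norm_mx2 (A' B' : 'M[R]_(n + n)) (al' be' : R) :
    (forall k l, `|A' k l| <= al') -> (forall k l, `|B' k l| <= be') ->
    forall k l, `|(A' *m B') k l| <= (n + n)%:R * (al' * be').
  move=> hA hB k l; rewrite mxE; apply: le_trans (ler_norm_sum _ _ _) _.
  apply: (@le_trans _ _ (\sum_(j < n + n) al' * be')).
    by apply: ler_sum => j _; rewrite normrM ler_pM.
  by rewrite sumr_const card_ord [leRHS]mulr_natl.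
by move=> hA hB hC; apply: (norm_mx2) => //; exact: norm_mx2.
Qed.

Lemma sympl_form_mul (A : 'M[R]_(n + n)) k l :
  (sympl_form *m A) k l = sg R k * A (rev_ord k) l.
Proof.
rewrite mxE (bigD1 (rev_ord k))//= big1 ?addr0 => [|b /negPf bk].
  by rewrite sympl_formE eqxx mulr1.
by rewrite sympl_formE bk mulr0 mul0r.
Qed.

Lemma mul_sympl_form (A : 'M[R]_(n + n)) k l :
  (A *m sympl_form) k l = A k (rev_ord l) * sg R (rev_ord l).
Proof.
rewrite mxE (bigD1 (rev_ord l))//= big1 ?addr0 => [|b /negPf bl].
  by rewrite sympl_formE rev_ordK eqxx mulr1.
by rewrite sympl_formE eq_sym eq_rev bl !mulr0.
Qed.

(** In the eigenframes the matrix of [g^T *m J *m g'] has entries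
    [x k * x' l * om q_k q'_l]; the frames and their inverses are bounded. *)
Lemma form_product_le g g' (Q Q' : 'M[R]_(n + n)) (x x' : 'I_(n + n) -> R) (C B : R) :
  Q *m sympl_form *m Q^T = sympl_form -> Q' *m sympl_form *m Q'^T = sympl_form ->
  (forall k l, `|Q k l| <= C) -> (forall k l, `|Q' k l| <= C) ->
  (forall k, row k Q *m g^T = x k *: row k Q) ->
  (forall k, row k Q' *m g'^T = x' k *: row k Q') ->
  (forall k l, `|x k * x' l * om [set: 'I_(n + n)]%SET (row k Q) (row l Q')| <= B) ->
  forall k l, `|(g^T *m sympl_form *m g') k l| <=
     (n + n)%:R * ((n + n)%:R * (C * B) * C).
Proof.
move=> hQ hQ' bQ bQ' eQ eQ' hB.
pose P (q : 'M[R]_(n + n)) := - (sympl_form *m q^T *m sympl_form).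
have PC (q : 'M[R]_(n + n)) :
    (forall k l, `|q k l| <= C) -> forall k l, `|P q k l| <= C.
  move=> bq k l; rewrite mxE normrN mul_sympl_form sympl_form_mul !normrM.
  by rewrite !normr_sg mul1r mulr1 mxE.
pose Y : 'M[R]_(n + n) := \matrix_(k, l)
  (x k * x' l * om [set: 'I_(n + n)]%SET (row k Q) (row l Q')).
have QY : Q *m (g^T *m sympl_form *m g') *m Q'^T = Y.
  have -> : Q *m (g^T *m sympl_form *m g') *m Q'^T =
      (Q *m g^T) *m sympl_form *m (Q' *m g'^T)^T by rewrite trmx_mul trmxK !mulmxA.
  apply/matrixP => k l; rewrite -row_col -tr_row row_mul -om_symplE.
  by rewrite [in LHS]row_mul eQ [row l _]row_mul eQ' omZl omZr mxE mulrA.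
have P1 := sympl_inv hQ; have P1' := sympl_inv hQ'.
have -> : g^T *m sympl_form *m g' = P Q *m Y *m (P Q')^T.
  rewrite -QY !mulmxA (mulmx1C P1) mul1mx -!mulmxA -trmx_mul (mulmx1C P1') trmx1 mulmx1.
  by rewrite !mulmxA.
apply: norm_mx3; [exact: PC|by move=> k l; rewrite mxE|].
by move=> k l; rewrite mxE; exact: PC.
Qed.

Lemma int_lt1_eq (p q : R) : p \is a Num.int -> q \is a Num.int -> `|p - q| < 1 -> p = q.
Proof.
move=> ip iq pq; apply/eqP; rewrite -subr_eq0; apply: contraTT pq => nz.
by rewrite -leNgt; apply: int_ge1 => //; rewrite rpredB.
Qed.

(** Choose in each class a representative with bounded eigenframe and cover these frames.
    For representatives [g] and [g'] with frames in the same part of the covering,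
    the integral matrix [g^T *m J *m g'] is bounded, so it takes boundedly many values, and it
    determines [g'] when [g] is fixed. Recording it for [g] a representative of the part thus
    separates the classes. *)
Lemma class_count_le (c : R) : exists2 C : R, 0 < C & forall w : 'I_(n + n) -> R,
  (forall k, w (rev_ord k) = - w k) -> (forall k l, (k <= l)%N -> w l <= w k) ->
  forall A : set (set 'M[R]_(n + n)),
    (forall K, A K -> exists g, [/\ SpZ g, near_regular g w c & SpZ_class g = K]) ->
  (counting A <= (C * weight n (fun k => expR (w k)))%:E)%E.
Proof.
have [C1 C11 hrep] := bounded_eigen_rep.
have [C2 C21 hcov] := @covering R n n (leqnn n) C1 C11.
have C10 : 0 <= C1 by apply: le_trans C11.
pose d : R := (n + n)%:R.
have d0 : 0 <= d by exact: ler0n.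
pose B : R := expR (c + c) * C2.
have B0 : 0 <= B by rewrite mulr_ge0// ?expR_ge0//; apply: le_trans C21.
pose K : R := d * (d * (C1 * B) * C1).
pose T : finType := {ffun 'I_(n + n) * 'I_(n + n) -> 'I_(Num.truncn (2 * K)).+1}.
have T0 : 0 < #|{: T}|%:R :> R.
  by rewrite ltr0n; apply/card_gt0P; exists [ffun=> ord0].
exists (C2 * #|{: T}|%:R); first by rewrite mulr_gt0//; apply: lt_le_trans C21.
move=> w wrev wmon A hA.
pose a k := expR (w k).
have a0 k : 0 < a k by exact: expR_gt0.
have aa k : a k * a (rev_ord k) = 1 by rewrite /a -expRD wrev subrr expR0.
have amon k l : (k <= l)%N -> a l <= a k by move=> kl; rewrite ler_expR wmon.
have hT : rev_closed [set: 'I_(n + n)]%SET by move=> ? _; rewrite inE.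
have [N [f [fN fclose]] hN] := hcov _ a hT a0 aa amon.
rewrite layer_full in fN fclose.
(* Pairs of an integral matrix and a bounded frame of its eigenvectors. *)
pose S (p : 'M[R]_(n + n) * 'M[R]_(n + n)) := [/\ SpZ p.1,
   p.2 *m sympl_form *m p.2^T = sympl_form, forall k l, `|p.2 k l| <= C1 &
   exists x : 'I_(n + n) -> R, forall k,
     row k p.2 *m p.1^T = x k *: row k p.2 /\ `|x k| <= expR c * a k].
have Sb p : S p -> bounded_frame [set: 'I_(n + n)]%SET [set: 'I_(n + n)]%SET C1 p.2.
  by move=> [_ hQ bQ _]; split=> [|k l _ _]; [exact: frame_full|exact: bQ].
pose del (p q : 'M[R]_(n + n) * 'M[R]_(n + n)) := p.1^T *m sympl_form *m q.1.
have del_le p q : S p -> S q -> f p.2 = f q.2 -> forall k l, `|del p q k l| <= K.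
  move=> Sp Sq e; have [hp hQ bQ [x hx]] := Sp; have [hq hQ' bQ' [x' hx']] := Sq.
  apply: (form_product_le hQ hQ' bQ bQ' (fun k => (hx k).1) (fun k => (hx' k).1)) => k l.
  have := fclose _ _ (Sb p Sp) (Sb q Sq) e k l; rewrite !inE => /(_ isT isT) h.
  rewrite !normrM /B expRD; set o : R := `|om _ _ _| in h *.
  apply: (@le_trans _ _ ((expR c * a k) * (expR c * a l) * o)).
    apply: ler_wpM2r; first exact: normr_ge0.
    by apply: ler_pM => //; [exact: (hx k).2|exact: (hx' l).2].
  rewrite (_ : _ * o = expR c * expR c * (a k * (a l * o))); last by ring.
  by rewrite ler_wpM2l// mulr_ge0 ?expR_ge0.
have fS p : S p -> (f p.2 < N)%N by move=> /Sb; exact: fN.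
have [rep [f' [hrep' f'N hf']]] := @refine_label _ (0, 0) S (fun p => f p.2) N T
  (fun p q => [ffun kl => inord (Num.truncn (del p q kl.1 kl.2 + K))]) fS.
have f'inj p q : S p -> S q -> f' p = f' q -> p.1 = q.1.
  move=> Sp Sq e; have [ef eh] := hf' p q Sp Sq e.
  have [Sr er] := hrep' p Sp; set r := rep _ in Sr er eh.
  have dE : del r p = del r q.
    apply/matrixP => k l.
    have idel z : S z -> del r z k l \is a Num.int.
      move=> [[_ iz] _ _ _]; have [[_ ir] _ _ _] := Sr.
      apply: mxint_mul => //; apply: mxint_mul; last exact: sympl_form_int.
      by move=> b b'; rewrite mxE; exact: ir.
    apply: (int_lt1_eq (idel p Sp) (idel q Sq)).
    apply: (@label_close R K); [exact: del_le|by apply: del_le => //; rewrite er|].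
    by have := congr1 (fun F : T => F (k, l)) eh; rewrite !ffunE.
  have [[hr _] _ _ _] := Sr.
  have u1 : r.1^T *m sympl_form \in unitmx.
    rewrite unitmx_mul unitmx_tr (Sp_unit hr) /=.
    have sJ : sympl_form *m - sympl_form = 1%:M :> 'M[R]_(n + n).
      by rewrite mulmxN sympl_formK opprK.
    by have [] := mulmx1_unit sJ.
  by have := congr1 (mulmx (invmx (r.1^T *m sympl_form))) dE; rewrite /del !mulKmx.
have ex_p K' : exists p, A K' -> S p /\ SpZ_class p.1 = K'.
  have [AK|nAK] := pselect (A K'); last by exists (0, 0).
  have [g [hg hw gK]] := hA K' AK.
  have [g1 [Q [x [hg1 cg1 hQ bQ hx]]]] := hrep g w c hg hw.
  exists (g1, Q) => _; split; last by rewrite cg1 gK.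
  split=> //=; exists x => k; split; first exact: (hx k).1.
  rewrite (hx k).2 /a -expRD ler_expR addrC -lerBlDl.
  by have [h _ _] := hw; apply: le_trans (h k); exact: ler_norm.
have [p hp] := choice ex_p.
apply: le_trans (@counting_le R _ A (N * #|{: T}|) (fun K' => f' (p K')) _ _) _.
- by move=> K' AK; apply: f'N; exact: (hp K' AK).1.
- move=> K1 K2 A1 A2 /(f'inj _ _ (hp K1 A1).1 (hp K2 A2).1) e.
  by rewrite -(hp K1 A1).2 e (hp K2 A2).2.
- by rewrite lee_fin natrM mulrAC ler_wpM2r.
Qed.

(** * Upper bound for pairs *)

Lemma char_poly_int g : mxint g -> forall j, (char_poly g)`_j \is a Num.int.
Proof.
move=> ig; apply/polyOverP; rewrite /char_poly /determinant rpred_sum// => s _.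
rewrite rpredMsign rpred_prod// => i _; rewrite !mxE rpredB//.
  by rewrite rpredMn// polyOverX.
by rewrite polyOverC; exact: ig.
Qed.

Lemma char_poly_prod g (x : 'I_(n + n) -> R) :
  perm_eq (eigenvalues g) [seq (x k)%:C | k <- enum 'I_(n + n)] ->
  char_poly g = \prod_k ('X - (x k)%:P).
Proof.
move=> px; apply: (@map_poly_inj _ _ (real_complex R)).
rewrite eigenvaluesE (perm_big _ px) /= big_map big_enum /= rmorph_prod.
by apply: eq_bigr => k _; rewrite /= map_polyXsubC.
Qed.

(** The roots come in pairs of inverses and their product is 1. *)
Lemma char_poly_palindrome g (x : 'I_(n + n) -> R) : Sp g ->
  char_poly g = \prod_k ('X - (x k)%:P) -> (forall k, x k * x (rev_ord k) = 1) ->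
  forall j, (j <= n + n)%N -> (char_poly g)`_j = (char_poly g)`_(n + n - j).
Proof.
move=> hg px xx; apply: palindrome_coef; first by rewrite size_char_poly.
have p1 : \prod_k (- x k) = 1.
  have := char_poly_det g; rewrite hg.1 mulr1 -horner_coef0 px horner_prod.
  have -> : (-1) ^+ (n + n) = 1 :> R by rewrite -signr_odd addnn odd_double.
  move=> {2}<-.
  by apply: eq_bigr => k _; rewrite hornerXsubC sub0r.
move=> y y0; rewrite px !horner_prod.
have -> : y ^+ (n + n) = \prod_(k < n + n) y by rewrite prodr_const card_ord.
transitivity (\prod_k (- x k) * \prod_k (y - x (rev_ord k))).
  rewrite -!big_split /=; apply: eq_bigr => k _.
  by rewrite hornerXsubC mulrBr mulfV// -(xx k); ring.
rewrite p1 mul1r [RHS](reindex_inj rev_ord_inj) /=.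
by apply: eq_bigr => k _; rewrite hornerXsubC.
Qed.

Lemma pair_of_char_poly g g' : char_poly g = char_poly g' ->
  (jordan g, signature g) = (jordan g', signature g').
Proof.
move=> e; have ee : eigenvalues g = eigenvalues g' by rewrite /eigenvalues e.
have je : jordan g = jordan g' by rewrite /jordan ee.
have : is_signature g = is_signature g' by rewrite /is_signature je ee.
by rewrite /signature je => ->.
Qed.

(** Functions of the eigenvalue index as sequences, so that partial products over the
    first indices can be written without casts. *)
Definition nat_ext (f : 'I_(n + n) -> R) (i : nat) : R := oapp f 0 (insub i).

Lemma nat_ext_ord f k : nat_ext f k = f k.
Proof. by rewrite /nat_ext valK. Qed.

Lemma nat_ext_lt f (i : nat) (hi : (i < n + n)%N) : nat_ext f i = f (Ordinal hi).
Proof. exact: (nat_ext_ord f (Ordinal hi)). Qed.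

(** The [j]-th elementary symmetric function of the eigenvalues is at most a constant
    times the product of the [j] largest moduli. *)
Lemma char_poly_coef_le g w c j : Sp g -> near_regular g w c -> 0 <= c -> (j <= n)%N ->
  `|(char_poly g)`_(n + n - j)| <=
     2 ^+ (n + n) * expR c ^+ n * \prod_(i < j) nat_ext (fun k => expR (w k)) i.
Proof.
move=> hg hw c0 jn; have [x [px xnorm _ _]] := loxodromic_roots hg hw.
have [hw1 _ _] := hw.
have e1 : 1 <= expR c by rewrite -expR0 ler_expR.
have -> : char_poly g = \prod_(i < n + n) ('X - (nat_ext x i)%:P).
  by rewrite (char_poly_prod px); apply: eq_bigr => k _; rewrite nat_ext_ord.
pose b := nat_ext (fun k => expR (jordan g 0 k)).
have hx i : `|nat_ext x i| <= b i.
  rewrite /b /nat_ext; case: insubP => [k _ _|_] /=; last by rewrite normr0.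
  by rewrite xnorm.
have hb (i i2 : nat) : (i <= i2)%N -> b i2 <= b i.
  rewrite /b /nat_ext => ik; case: insubP => [k' _ ek|_] /=; last first.
    by case: insubP => [i' _ _|_] //=; exact: expR_ge0.
  case: insubP => [i' _ ei|] /=; last first.
    by rewrite -leqNgt => h; move: (leq_trans h ik); rewrite -ek leqNgt ltn_ord.
  by rewrite ler_expR jordan_sorted//; move: ik; rewrite -ei -ek.
have jnn : (j <= n + n)%N by lia.
apply: le_trans (coef_prod_bound hx hb jnn) _.
rewrite -mulrA ler_wpM2l ?exprn_ge0//.
apply: (@le_trans _ _ (\prod_(i < j) (expR c * nat_ext (fun k => expR (w k)) i))).
  apply: ler_prod => i _; have inn : (i < n + n)%N by have := ltn_ord i; lia.
  rewrite /b !(nat_ext_lt _ inn) expR_ge0 -expRD ler_expR /=.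
  by rewrite -lerBlDr; apply: le_trans (hw1 _); exact: ler_norm.
rewrite big_split /= prodr_const card_ord ler_wpM2r ?ler_weXn2l//.
rewrite prodr_ge0// => i _; rewrite /nat_ext; case: insubP => //= *; exact: expR_ge0.
Qed.

Lemma prod_prod_lt (a : nat -> R) m :
  \prod_(j < m) \prod_(i < j.+1) a i = \prod_(i < m) a i ^+ (m - i).
Proof.
elim: m => [|m IH]; first by rewrite !big_ord0.
rewrite big_ord_recr /= IH [in RHS]big_ord_recr /= subSnn expr1 big_ord_recr /=.
rewrite mulrA -big_split /=; congr (_ * _); apply: eq_bigr => i _.
by rewrite subSn 1?ltnW// exprSr.
Qed.

(** The palindromic integral polynomial is determined by [n] of its coefficients, and
    the [j]-th of them takes [O(e^(w_1 + ... + w_j))] values. *)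
Lemma pair_count_le (c : R) : 0 <= c -> exists2 C : R, 0 < C & forall w : 'I_(n + n) -> R,
  (forall k, w (rev_ord k) = - w k) -> (forall k l, (k <= l)%N -> w l <= w k) ->
  forall A : set ('rV[R]_(n + n) * 'rV[R]_n),
    (forall P, A P -> exists g,
       [/\ SpZ g, near_regular g w c & (jordan g, signature g) = P]) ->
  (counting A <=
     (C * \prod_(i < n) nat_ext (fun k => expR (w k)) i ^+ (n - i))%:E)%E.
Proof.
move=> c0.
pose C0 : R := 2 ^+ (n + n) * expR c ^+ n.
have C01 : 1 <= C0.
  by rewrite -[1]mulr1 ler_pM// exprn_ege1// ?ler1n// -expR0 ler_expR.
have C00 : 0 < C0 by apply: lt_le_trans C01.
exists ((3 * C0) ^+ n); first by rewrite exprn_gt0// mulr_gt0.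
move=> w wrev wmon A hA.
pose a := nat_ext (fun k => expR (w k)).
pose K j : R := C0 * \prod_(i < j) a i.
have a1 i : (i < n)%N -> 1 <= a i.
  move=> hi; have inn : (i < n + n)%N by lia.
  rewrite /a (nat_ext_lt _ inn) -expR0 ler_expR.
  have := wrev (Ordinal inn).
  have : w (rev_ord (Ordinal inn)) <= w (Ordinal inn) by apply: wmon => /=; lia.
  by move: (w _) (w _) => p q; lra.
have K1 j : (j <= n)%N -> 1 <= K j.
  move=> jn; rewrite -[1]mulr1 ler_pM//.
  apply: (big_ind (fun z : R => 1 <= z)) => // [p q p1 q1|i _].
    by rewrite -[1]mulr1 ler_pM.
  by apply: a1; have := ltn_ord i; lia.
pose T : finType := {dffun forall j : 'I_n, 'I_(Num.truncn (2 * K j.+1)).+1}.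
pose lab g : T := [ffun j : 'I_n => inord (Num.truncn ((char_poly g)`_(n + n - j.+1) + K j.+1))
   : 'I_(Num.truncn (2 * K j.+1)).+1].
have cT : #|{: T}|%:R <= (3 * C0) ^+ n * \prod_(i < n) a i ^+ (n - i) :> R.
  rewrite -prod_prod_lt card_dep_ffun foldrE big_map big_enum /= natr_prod.
  have -> : (3 * C0) ^+ n = \prod_(j < n) (3 * C0) by rewrite prodr_const card_ord.
  rewrite -big_split /=; apply: ler_prod => j _; rewrite ler0n card_ord /=.
  rewrite -mulrA -/(K j.+1); have k1 := K1 j.+1 (ltn_ord j).
  have tr : (Num.truncn (2 * K j.+1))%:R <= 2 * K j.+1.
    by rewrite truncn_le// mulr_ge0//; apply: le_trans k1.
  by rewrite -natr1; move: k1 tr; lra.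
have ex_g P : exists g, A P -> [/\ SpZ g, near_regular g w c & (jordan g, signature g) = P].
  have [AP|nAP] := pselect (A P); last by exists 0.
  by have [g hg] := hA P AP; exists g.
have [g hg] := choice ex_g.
apply: le_trans (@counting_le R _ A #|{: T}| (fun P => enum_rank (lab (g P)) : nat) _ _) _.
- by move=> P _; exact: ltn_ord.
- move=> P1 P2 /hg[[s1 i1] r1 e1] /hg[[s2 i2] r2 e2] /val_inj/enum_rank_inj e.
  rewrite -[LHS]e1 -[RHS]e2; apply: pair_of_char_poly.
  have top j : (j < n)%N -> (char_poly (g P1))`_(n + n - j.+1) = (char_poly (g P2))`_(n + n - j.+1).
    move=> jn; apply: int_lt1_eq; try exact: char_poly_int.
    apply: (@label_close R (K j.+1)); try exact: char_poly_coef_le.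
    have := congr1 (fun F : T => F (Ordinal jn)) e; rewrite /lab !ffunE; exact.
  have mid j : (n <= j)%N -> (char_poly (g P1))`_j = (char_poly (g P2))`_j.
    move=> nj; have [jnn|jnn] := ltnP j (n + n).
      have -> : j = (n + n - (n + n - j.+1).+1)%N by lia.
      by apply: top; lia.
    have [->|jn2] := eqVneq j (n + n)%N.
      have m1 : (char_poly (g P1))`_(n + n) = 1.
        by have /monicP := char_poly_monic (g P1); rewrite /lead_coef size_char_poly.
      have m2 : (char_poly (g P2))`_(n + n) = 1.
        by have /monicP := char_poly_monic (g P2); rewrite /lead_coef size_char_poly.
      by rewrite m1 m2.
    by rewrite !nth_default ?size_char_poly//; lia.
  apply/polyP => j; have [/mid//|jn] := leqP n j.
  have [x1 [px1 _ _ xx1]] := loxodromic_roots s1 r1; have [x2 [px2 _ _ xx2]] := loxodromic_roots s2 r2.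
  have jnn : (j <= n + n)%N by lia.
  rewrite (char_poly_palindrome s1 (char_poly_prod px1) xx1 jnn).
  rewrite (char_poly_palindrome s2 (char_poly_prod px2) xx2 jnn).
  by apply: mid; lia.
- by rewrite lee_fin.
Qed.

(** * Recognizing the Jordan projection and the signature *)

(** A sorted list is determined by its contents. *)
Lemma jordan_eq g (x : 'I_(n + n) -> R) :
  perm_eq (eigenvalues g) [seq (x k)%:C | k <- enum 'I_(n + n)] ->
  (forall k, 0 < `|x k|) -> (forall k l, (k <= l)%N -> `|x l| <= `|x k|) ->
  forall k, jordan g 0 k = ln `|x k|.
Proof.
move=> px x0 xs k.
have tot : total (fun x y : R => y <= x) by move=> a b; exact: le_total.
have tr : transitive (fun x y : R => y <= x) by move=> a b c /[swap]; exact: le_trans.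
have asym : antisymmetric (fun x y : R => y <= x) by move=> a b; rewrite andbC => /le_anti.
have sub (f : 'I_(n + n) -> R) : (forall k l, (k <= l)%N -> f l <= f k) ->
    sorted (fun x y : R => y <= x) [seq f k | k <- enum 'I_(n + n)].
  move=> hf; apply/(sortedP 0) => i; rewrite size_map size_enum_ord => hi.
  have hi' : (i < n + n)%N by apply: ltnW.
  rewrite (nth_map (Ordinal hi)) ?size_enum_ord// [leRHS](nth_map (Ordinal hi)) ?size_enum_ord//.
  by apply: hf; rewrite !nth_enum_ord.
have e : [seq jordan g 0 k | k <- enum 'I_(n + n)] = [seq ln `|x k| | k <- enum 'I_(n + n)].
  apply: (sorted_eq tr asym); first by apply: sub; exact: jordan_sorted.
    by apply: sub => i j ij; rewrite ler_ln ?xs// posrE.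
  apply: perm_trans (jordan_perm g) _.
  apply: perm_trans (perm_map _ px) _; rewrite -map_comp.
  by rewrite (eq_map (g := fun k => ln `|x k|))// => i; rewrite /= lmod_real.
by move/eq_in_map : e; apply; rewrite mem_enum.
Qed.

Lemma is_signature_roots g (x : 'I_(n + n) -> R) (s : 'rV[R]_n) : is_sign_vector s ->
  perm_eq (eigenvalues g) [seq (x k)%:C | k <- enum 'I_(n + n)] ->
  (forall i, x (lshift n i) = s 0 i * expR (jordan g 0 (lshift n i))) ->
  (forall i, x (rev_ord (lshift n i)) = s 0 i * expR (- jordan g 0 (lshift n i))) ->
  is_signature g s.
Proof.
move=> hs px x1 x2; split => //; apply: perm_trans px _.
have pe : perm_eq (enum 'I_(n + n)) (map (lshift n) (enum 'I_n) ++ map (@rshift n n) (enum 'I_n)).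
  apply: uniq_perm; rewrite ?enum_uniq ?cat_uniq ?map_inj_uniq ?enum_uniq//=.
  - rewrite -!enumT !enum_uniq andbT; apply/hasPn => _ /mapP[j _ ->]; apply/mapP => -[k _ /eqP].
    by rewrite eq_rlshift.
  - exact: rshift_inj.
  - exact: lshift_inj.
  - move=> k; rewrite mem_enum mem_cat; case: (split_ordP k) => j ->.
      by rewrite map_f ?mem_enum.
    by rewrite [X in _ || X]map_f ?mem_enum// orbT.
apply: perm_trans (perm_map (fun k => (x k)%:C) pe) _; rewrite map_cat.
have -> : [seq (x k)%:C | k <- map (lshift n) (enum 'I_n)] =
    [seq (s 0 i * expR (jordan g 0 (lshift n i)))%:C | i <- enum 'I_n].
  by rewrite -map_comp; apply: eq_map => i /=; rewrite x1.
rewrite perm_cat2l.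
have pr : perm_eq (enum 'I_n) [seq rev_ord i | i <- enum 'I_n].
  apply: uniq_perm; first exact: enum_uniq.
    by rewrite map_inj_uniq ?enum_uniq//; apply: rev_ord_inj.
  move=> i; rewrite mem_enum; apply/esym/mapP; exists (rev_ord i); rewrite ?mem_enum//.
  by rewrite rev_ordK.
have := perm_map (fun k => (x k)%:C) (perm_map (@rshift n n) pr).
move/perm_trans; apply.
rewrite (_ : map _ _ = [seq (s 0 i * expR (- jordan g 0 (lshift n i)))%:C | i <- enum 'I_n])//.
rewrite -2!map_comp; apply: eq_map => i /=; rewrite -x2; congr (x _)%:C; apply/val_inj => /=; have := ltn_ord i; lia.
Qed.

(** The moduli of the listed eigenvalues are distinct, so each sign can be read off. *)
Lemma signature_uniq g (s s' : 'rV[R]_n) :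
  (forall i, 0 < jordan g 0 (lshift n i)) -> injective (fun i => jordan g 0 (lshift n i)) ->
  is_signature g s -> is_signature g s' -> s = s'.
Proof.
move=> l0 linj [hs ps] [hs' ps']; apply/rowP => i.
have : (s 0 i * expR (jordan g 0 (lshift n i)))%:C \in eigenvalues g.
  by rewrite (perm_mem ps) mem_cat; apply/orP; left; apply/mapP; exists i; rewrite ?mem_enum.
have absE (t : 'rV[R]_n) (k : 'I_n) (c : R) : is_sign_vector t -> `|t 0 k * expR c| = expR c.
  by move=> ht; rewrite normrM [`|expR c|]ger0_norm ?expR_ge0//; case: (ht k) => ->; rewrite ?normrN normr1 mul1r.
rewrite (perm_mem ps') mem_cat => /orP[] /mapP[j _ [e]].
- have := congr1 Num.norm e; rewrite !absE// => /expR_inj/linj ij; subst j.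
  by move: e => /mulIf; apply; rewrite gt_eqF// expR_gt0.
- have := congr1 Num.norm e; rewrite !absE// => /expR_inj.
  by have := l0 i; have := l0 j; lra.
Qed.

Lemma signatureE g (s : 'rV[R]_n) :
  (forall i, 0 < jordan g 0 (lshift n i)) -> injective (fun i => jordan g 0 (lshift n i)) ->
  is_signature g s -> signature g = s.
Proof.
move=> l0 linj hs; apply: xget_unique => // s' hs'; exact: signature_uniq hs' hs.
Qed.

Lemma char_poly_of_pair g g' : is_signature g (signature g) -> is_signature g' (signature g') ->
  (jordan g, signature g) = (jordan g', signature g') -> char_poly g = char_poly g'.
Proof.
move=> [_ p1] [_ p2] e; have /= ej := congr1 fst e; have /= es := congr1 snd e.
apply: (@map_poly_inj _ _ (real_complex R)).
rewrite !eigenvaluesE; apply: perm_big; apply: perm_trans p1 _.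
by rewrite es ej perm_sym.
Qed.

Lemma char_poly_of_class g g' : SpZ_class g = SpZ_class g' -> char_poly g = char_poly g'.
Proof.
move=> e; have : SpZ_class g g.
  exists 1%:M; last by rewrite mul1mx invmx1 mulmx1.
  split; last by move=> k l; rewrite mxE Num.Theory.intr_nat.
  by split; rewrite ?det1// trmx1 mul1mx mulmx1.
rewrite e => -[p [/Sp_unit pu _] <-].
rewrite /char_poly; set A := char_poly_mx _.
have -> : A = map_mx polyC p *m char_poly_mx g' *m map_mx polyC (invmx p).
  rewrite /A /char_poly_mx mulmxBr mulmxBl !map_mxM /=; congr (_ - _).
  rewrite scalar_mxC -mulmxA -map_mxM mulmxV//= map_mx1 mulmx1//.
rewrite !det_mulmx mulrAC -det_mulmx -map_mxM mulmxV// map_mx1 det1 mul1r//.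
Qed.

End Loxodromic.

(** * Symplectic companion matrices *)

Section Companion.
Variables (R : realType) (n : nat) (a : nat -> R).
Hypotheses (n0 : (0 < n)%N) (a0 : a 0%N = 1).

(** The [l]-th coordinate of X times the [k]-th vector of the basis [companion_vec] below,
    modulo [recip_poly]. This basis is adapted to the antidiagonal form, which the usual
    companion matrix does not preserve. *)
Definition companion_entry (k l : nat) : R :=
  if (k.+1 < n)%N then (l == k.+1)%:R else
  if k.+1 == n then - (l == (n + n).-1)%:R else
  if k == n then (if (l < n)%N then a l else 0) - a n * (l == (n + n).-1)%:R
  else (l == k.-1)%:R - a (n + n - k)%N * (l == (n + n).-1)%:R.

Definition companion : 'M[R]_(n + n) := \matrix_(l, k) companion_entry k l.

Definition recip_poly : {poly R} := \poly_(j < n + n.+1) a (minn j (n + n - j)).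

Lemma om_companion (f : nat -> R) (k : 'I_(n + n)) :
  om [set: 'I_(n + n)]%SET (\row_l f l) (row k companion^T) =
  \sum_(l < n + n) sg R l * f l * companion_entry k ((n + n).-1 - l).
Proof.
rewrite om_full; apply: eq_bigr => l _; rewrite !mxE /=.
by congr (_ * companion_entry _ _); lia.
Qed.

Lemma sum_delta (f : nat -> R) m : (m < n + n)%N ->
  \sum_(l < n + n) f l * ((l : nat) == m)%:R = f m.
Proof.
move=> hm; rewrite (bigD1 (Ordinal hm))//= eqxx mulr1 big1 ?addr0// => l lm.
by rewrite -val_eqE /= in lm; rewrite (negPf lm) mulr0.
Qed.

Ltac nat_cases := repeat (match goal with
  | |- context [@eq_op _ ?x ?y] => case: (@eqP _ x y) => ?
  | |- context [leq ?x ?y] => case: (leqP x y) => ?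
  end; try (exfalso; lia)); rewrite /= ?mulr0n ?mulr1n; try ring.

Lemma companion_entry0 (l : nat) : companion_entry l 0 = (l == n)%:R.
Proof. by rewrite /companion_entry; nat_cases; rewrite a0; ring. Qed.

(** Rows other than the [n]-th are combinations of at most two basis vectors, so the
    pairing is a case analysis on the second row; the [n]-th row pairs with itself to 0
    because the form is alternating. *)
Lemma companion_form (k l : 'I_(n + n)) : k != n :> nat ->
  om [set: 'I_(n + n)]%SET (row k companion^T) (row l companion^T) =
    sg R k * (l == rev_ord k)%:R.
Proof.
move=> kn; have hk := ltn_ord k; have hl := ltn_ord l.
have -> : row k companion^T = \row_m companion_entry k m by apply/rowP => m; rewrite !mxE.
rewrite om_companion -val_eqE /=.
have ev m (c : R) : (m < n + n)%N ->
   \sum_(j < n + n) sg R j * (c * ((j : nat) == m)%:R) * companion_entry l ((n + n).-1 - j) =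
   (if (m < n)%N then c else - c) * companion_entry l ((n + n).-1 - m).
  move=> hm; rewrite -[RHS](@sum_delta (fun j => (if (j < n)%N then c else - c) * companion_entry l ((n + n).-1 - j)) m hm).
  by apply: eq_bigr => j _; rewrite /sg; case: ifP => _; ring.
have evk c m : (m < n + n)%N -> (forall j, companion_entry k j = c * (j == m)%:R) ->
   \sum_(j < n + n) sg R j * companion_entry k j * companion_entry l ((n + n).-1 - j) =
   (if (m < n)%N then c else - c) * companion_entry l ((n + n).-1 - m).
  by move=> hm hc; rewrite -ev//; apply: eq_bigr => j _; rewrite hc.
have [k1|k1] := ltnP k.+1 n.
  rewrite (evk 1 k.+1); [|lia|by move=> j; rewrite /companion_entry k1 mul1r].
  by rewrite /companion_entry /sg; clear ev evk; nat_cases.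
have [k2|k2] := eqVneq k.+1 n.
  rewrite (evk (-1) (n + n).-1); [|lia|by move=> j; rewrite /companion_entry k2 ltnn eqxx mulN1r].
  by rewrite subnn companion_entry0 /sg; clear ev evk; nat_cases.
rewrite (_ : \sum_(j < _) _ = (\sum_(j < n + n) sg R j * (1 * ((j : nat) == k.-1)%:R) * companion_entry l ((n + n).-1 - j)) +
    (\sum_(j < n + n) sg R j * (- a (n + n - k)%N * ((j : nat) == (n + n).-1)%:R) * companion_entry l ((n + n).-1 - j))); last first.
  rewrite -big_split /=; apply: eq_bigr => j _; rewrite {1}/companion_entry.
  rewrite (negPf kn) (negPf k2) (_ : (k.+1 < n)%N = false); last by apply/negbTE; rewrite -leqNgt.
  ring.
rewrite !ev; [|lia|lia].
rewrite subnn companion_entry0 (_ : ((n + n).-1 - k.-1 = n + n - k)%N); last lia.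
have nk : (n < k)%N by lia.
have -> : ((n + n).-1 < n)%N = false by lia.
have -> : sg R k = -1 by rewrite /sg ifF//; lia.
have -> : (k.-1 < n)%N = false by lia.
clear -nk hk hl kn a0; rewrite /companion_entry; nat_cases.
Qed.

Lemma companion_sympl : companion^T *m sympl_form *m companion = sympl_form.
Proof.
have hom (k l : 'I_(n + n)) : (companion^T *m sympl_form *m companion) k l =
    om [set: 'I_(n + n)]%SET (row k companion^T) (row l companion^T).
  rewrite om_symplE -{2}[companion]trmxK.
  have h (A B : 'M[R]_(n + n)) : (A *m B^T) k l = (row k A *m (row l B)^T) 0 0.
    by rewrite !mxE; apply: eq_bigr => m _; rewrite !mxE.
  by rewrite h row_mul.
apply/matrixP => k l; rewrite hom sympl_formE.
have hT : rev_closed [set: 'I_(n + n)]%SET by move=> ? _; rewrite inE.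
have [kn|kn] := eqVneq (k : nat) n; last by rewrite companion_form.
have [ln|ln] := eqVneq (l : nat) n.
  have -> : l = k by apply/val_inj; rewrite /= ln.
  rewrite omxx// -val_eqE /= kn; case: eqP => [|_]; last by rewrite mulr0.
  by move: n0; clear; lia.
rewrite omC// companion_form// -(inj_eq rev_ord_inj) rev_ordK eq_sym.
by case: eqP => [->|_]; rewrite ?mulr0 ?oppr0// sg_rev mulNr opprK.
Qed.

(** The powers of [x] below [n], then multiples of the Horner quotients
    [x ^ r + a_1 x ^ (r - 1) + ... + a_r]. *)
Definition companion_vec (x : R) (k : nat) : R :=
  if (k < n)%N then x ^+ k else
   - x ^+ n * \sum_(s < n + n - k) a s * x ^+ ((n + n).-1 - k - s).

Lemma recip_polyE (x : R) : recip_poly.[x] =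
  \sum_(i < n) a i * (x ^+ i + x ^+ (n + n - i)) + a n * x ^+ n.
Proof.
rewrite horner_poly big_split_ord /= big_ord_recl /= addn0.
rewrite (_ : minn n (n + n - n) = n); last lia.
rewrite [X in _ + (_ + X)](reindex_inj rev_ord_inj) /= [X in _ + X]addrC addrA -big_split /=.
congr (_ + _); apply: eq_bigr => i _; rewrite mulrDr.
have hi := ltn_ord i.
congr (a _ * _ + a _ * _ ^+ _); rewrite /= /bump; lia.
Qed.

(** Only at the column [n] is the equation of [recip_poly] used; elsewhere it is the
    recursion of powers and of Horner quotients. *)
Lemma companion_eigen (x : R) : root recip_poly x ->
  (\row_k companion_vec x k) *m companion = x *: (\row_k companion_vec x k).
Proof.
move=> /rootP; rewrite recip_polyE => hx.
have hlast : companion_vec x (n + n).-1 = - x ^+ n.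
  rewrite /companion_vec ifF; last by move: n0; clear; lia.
  rewrite (_ : (n + n - (n + n).-1)%N = 1%N); last by move: n0; clear; lia.
  by rewrite big_ord1 a0 subnn sub0n expr0 !mulr1.
have lt1 : ((n + n).-1 < n + n)%N by move: n0; clear; lia.
apply/rowP => k; have hk := ltn_ord k.
rewrite mxE [RHS]mxE [X in _ = _ * X]mxE.
rewrite (eq_bigr (fun l : 'I_(n + n) => companion_vec x l * companion_entry k l)) => [|l _]; last by rewrite !mxE.
have [k1|k1] := ltnP k.+1 n.
  rewrite (eq_bigr (fun l : 'I_(n + n) => companion_vec x l * ((l : nat) == k.+1)%:R)); last first.
    by move=> l _; rewrite /companion_entry k1.
  rewrite sum_delta; last by clear -k1 hk; lia.
  by rewrite /companion_vec k1 ltnW// exprS.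
have [k2|k2] := eqVneq k.+1 n.
  rewrite (eq_bigr (fun l : 'I_(n + n) => (- companion_vec x l) * ((l : nat) == (n + n).-1)%:R)); last first.
    by move=> l _; rewrite /companion_entry k2 ltnn eqxx mulrN mulNr.
  rewrite (@sum_delta (fun l => - companion_vec x l))// hlast opprK.
  by rewrite /companion_vec (_ : (k < n)%N) -?exprS ?k2.
have h1 : (k.+1 < n)%N = false by clear -k1; lia.
have [k3|k3] := eqVneq (k : nat) n.
  rewrite (eq_bigr (fun l : 'I_(n + n) => (if (l < n)%N then a l * x ^+ l else 0)
      + (- a n * companion_vec x l) * ((l : nat) == (n + n).-1)%:R)); last first.
    move=> l _; rewrite /companion_entry h1 (negPf k2) k3 eqxx.
    by case: ifP => ln; rewrite /companion_vec ?ln; ring.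
  rewrite big_split /= (@sum_delta (fun l => - a n * companion_vec x l))// hlast.
  rewrite big_split_ord /= [X in _ + X + _]big1 ?addr0; last first.
    by move=> l _; rewrite ifF//; lia.
  rewrite (eq_bigr (fun l : 'I_n => a l * x ^+ l)) => [|l _]; last by rewrite ltn_ord.
  rewrite /companion_vec k3 ltnn addnK.
  rewrite [X in _ = x * (_ * X)](eq_bigr (fun s : 'I_n => a s * x ^+ (n.-1 - s))); last first.
    move=> s _; by congr (_ * _ ^+ _); lia.
  move: hx; rewrite (eq_bigr (fun i : 'I_n => a i * x ^+ i + x ^+ n.+1 * (a i * x ^+ (n.-1 - i)))).
    by rewrite big_split /= -mulr_sumr exprS => hx; lra.
  move=> i _; rewrite mulrDr [X in _ = _ + X]mulrCA -exprD; congr (_ + _ * _ ^+ _).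
  by have := ltn_ord i; clear; lia.
have k4 : (n < k)%N by clear -k1 k2 k3; lia.
rewrite (eq_bigr (fun l : 'I_(n + n) => companion_vec x l * ((l : nat) == k.-1)%:R
      + (- a (n + n - k)%N * companion_vec x l) * ((l : nat) == (n + n).-1)%:R)); last first.
  by move=> l _; rewrite /companion_entry h1 (negPf k2) (negPf k3); ring.
rewrite big_split /= (@sum_delta (fun l => - a (n + n - k)%N * companion_vec x l))// hlast.
rewrite sum_delta; last by clear -hk; lia.
rewrite /companion_vec ifF; last by clear -k4; lia.
rewrite ifF; last by clear -k4; lia.
rewrite (_ : (n + n - k.-1 = (n + n - k).+1)%N); last by clear -k4 hk; lia.
rewrite big_ord_recr /= (_ : ((n + n).-1 - k.-1 - (n + n - k) = 0)%N); last by clear -k4 hk; lia.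
rewrite (eq_bigr (fun s : 'I_(n + n - k) => x * (a s * x ^+ ((n + n).-1 - k - s)))); last first.
  move=> s _; rewrite mulrCA -exprS; congr (_ * _ ^+ _).
  by have := ltn_ord s; clear -k4 hk; lia.
by rewrite -mulr_sumr expr0; ring.
Qed.

Lemma recip_coef j : (j <= n)%N -> recip_poly`_j = a j.
Proof. by move=> jn; rewrite coef_poly (_ : (j < n + n.+1)%N) ?(minn_idPl _)//; lia. Qed.

Lemma size_recip : size recip_poly = (n + n).+1.
Proof.
rewrite size_poly_eq ?addnS//= (_ : minn _ _ = 0%N) ?a0 ?oner_eq0//; lia.
Qed.

Lemma recip_monic : recip_poly \is monic.
Proof.
rewrite monicE lead_coefE size_recip /= coef_poly addnS ltnSn.
by rewrite subnn minn0 a0.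
Qed.

Variable x : 'I_(n + n) -> R.
Hypotheses (x_inj : injective x) (x_root : forall k : 'I_(n + n), root recip_poly (x k)).

Lemma companion_root_char (y : R) : root recip_poly y -> root (char_poly companion) y.
Proof.
move=> hy; rewrite -eigenvalue_root_char; apply/eigenvalueP.
exists (\row_k companion_vec y k); first exact: companion_eigen.
have i0 : (0 < n + n)%N by move: n0; clear; lia.
apply/eqP => /rowP/(_ (Ordinal i0)); rewrite !mxE /companion_vec n0 expr0.
by move/eqP; rewrite oner_eq0.
Qed.

Lemma monic_roots_prod (p : {poly R}) : p \is monic -> size p = (n + n).+1 ->
  (forall k : 'I_(n + n), root p (x k)) -> p = \prod_k ('X - (x k)%:P).
Proof.
move=> pm sp hp.
have := @all_roots_prod_XsubC _ p [seq x k | k <- enum 'I_(n + n)].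
rewrite size_map size_enum_ord sp (monicP pm) scale1r big_map big_enum /=; apply=> //.
- by apply/allP => _ /mapP[k _ ->].
- by rewrite uniq_rootsE map_inj_uniq ?enum_uniq.
Qed.

(** All roots of [recip_poly] are eigenvalues, and both polynomials are monic of the same
    degree with as many distinct roots. *)
Lemma companion_char_poly : char_poly companion = recip_poly.
Proof.
rewrite (monic_roots_prod recip_monic size_recip x_root).
apply: monic_roots_prod; first exact: char_poly_monic.
- by rewrite size_char_poly.
- by move=> k; apply: companion_root_char.
Qed.

(** The determinant is the constant coefficient of the characteristic polynomial, [a 0 = 1]. *)
Lemma companion_Sp : Sp companion.
Proof.
split; last exact: companion_sympl.
have := char_poly_det companion; rewrite companion_char_poly recip_coef// a0.
by rewrite -signr_odd oddD addbb mul1r.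
Qed.

Lemma companion_SpZ : (forall k : nat, a k \is a Num.int) -> SpZ companion.
Proof.
move=> aint; split; first exact: companion_Sp.
move=> l k; rewrite mxE /companion_entry.
have b01 (b : bool) : (b%:R : R) \is a Num.int by rewrite Num.Theory.intr_nat.
by do ![case: ifP => _]; rewrite ?rpredN ?rpredB ?rpredM ?rpred0 ?b01.
Qed.

Lemma companion_eigenvalues : perm_eq (eigenvalues companion) [seq (x k)%:C%C | k <- enum 'I_(n + n)].
Proof.
apply: prod_XsubC_eq; rewrite -eigenvaluesE companion_char_poly.
rewrite (monic_roots_prod recip_monic size_recip x_root) rmorph_prod /= big_map big_enum.
by apply: eq_bigr => k _; rewrite map_polyXsubC.
Qed.

Lemma recip_root_inv (y : R) : y != 0 -> root recip_poly y -> root recip_poly y^-1.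
Proof.
move=> y0 /rootP h; apply/rootP.
have := horner_rev (fun j => a (minn j (n + n - j))) (n + n) y0.
rewrite -addnS -/recip_poly (_ : \poly_(j < _) _ = recip_poly) ?h.
  by move/eqP; rewrite mulf_eq0 expf_eq0 (negPf y0) andbF => /eqP.
apply/polyP => j; rewrite !coef_poly; case: ltnP => // jn; congr a; lia.
Qed.

End Companion.

Section CompanionSpectrum.
Variables (R : realType) (n : nat) (a : nat -> R).
Hypotheses (n0 : (0 < n)%N) (a0 : a 0%N = 1) (aint : forall k, a k \is a Num.int).
Variables (m : 'rV[R]_n) (y : 'I_n -> R).
Hypotheses (hm : is_sign_vector m) (y1 : forall i, 1 < y i)
  (ydec : forall i j : 'I_n, (i < j)%N -> y j < y i)
  (yroot : forall i, root (recip_poly n a) (m 0 i * y i)).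

Let y0 i : 0 < y i. Proof. by apply: lt_trans (y1 i). Qed.

Let m_norm i : `|m 0 i| = 1.
Proof. by case: (hm i) => ->; rewrite ?normrN normr1. Qed.

Let m_inv i : (m 0 i)^-1 = m 0 i.
Proof. by case: (hm i) => ->; rewrite ?invrN invr1. Qed.

Let x (k : 'I_(n + n)) : R := match fintype.split k with
  | inl i => m 0 i * y i | inr j => (m 0 (rev_ord j) * y (rev_ord j))^-1 end.

Let xl i : x (lshift n i) = m 0 i * y i.
Proof. by rewrite /x (unsplitK (inl i)). Qed.

Let xr i : x (rshift n i) = (m 0 (rev_ord i) * y (rev_ord i))^-1.
Proof. by rewrite /x (unsplitK (inr i)). Qed.

Let xl_norm i : `|x (lshift n i)| = y i.
Proof. by rewrite xl normrM m_norm mul1r gtr0_norm. Qed.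

Let xr_norm i : `|x (rshift n i)| = (y (rev_ord i))^-1.
Proof. by rewrite xr normfV normrM m_norm mul1r gtr0_norm. Qed.

Let xdec (k l : 'I_(n + n)) : (k < l)%N -> `|x l| < `|x k|.
Proof.
case: (split_ordP k) => i ->; case: (split_ordP l) => j ->; rewrite ?xl_norm ?xr_norm /=.
- exact: ydec.
- by move=> _; apply: lt_trans (y1 i); rewrite invf_lt1.
- by have := ltn_ord j; move=> h1 h2; exfalso; lia.
- rewrite ltn_add2l => ij; rewrite ltf_pV2 ?posrE// ydec//=.
  by have := ltn_ord j; lia.
Qed.

Let xinj : injective x.
Proof.
move=> k l e; apply/val_inj; case: (ltngtP k l) => // h.
- by have := xdec h; rewrite e ltxx.
- by have := xdec h; rewrite e ltxx.
Qed.

Let xroot k : root (recip_poly n a) (x k).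
Proof.
case: (split_ordP k) => i ->; rewrite ?xl ?xr//; apply: recip_root_inv => //.
by rewrite -normr_gt0 normrM m_norm mul1r gtr0_norm.
Qed.

Let xpos k : 0 < `|x k|.
Proof. by case: (split_ordP k) => i ->; rewrite ?xl_norm ?xr_norm ?invr_gt0. Qed.

Let companion_jordan k : jordan (companion n a) 0 k = ln `|x k|.
Proof.
apply: jordan_eq (companion_eigenvalues n0 a0 xinj xroot) xpos _ k => k l.
by rewrite leq_eqVlt => /orP[/eqP/val_inj ->//|/xdec/ltW].
Qed.

Lemma companion_jordan_lshift i : jordan (companion n a) 0 (lshift n i) = ln (y i).
Proof. by rewrite companion_jordan xl_norm. Qed.

Lemma companion_jordan_rev k : jordan (companion n a) 0 (rev_ord k) = - jordan (companion n a) 0 k.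
Proof.
have hl i : jordan (companion n a) 0 (rev_ord (lshift n i)) = - ln (y i).
  rewrite companion_jordan (_ : rev_ord _ = rshift n (rev_ord i)); last first.
    by apply/val_inj => /=; have := ltn_ord i; lia.
  by rewrite xr_norm rev_ordK lnV ?posrE.
case: (split_ordP k) => i ->; first by rewrite hl companion_jordan_lshift.
have -> : rshift n i = rev_ord (lshift n (rev_ord i)).
  by apply/val_inj => /=; have := ltn_ord i; lia.
by rewrite rev_ordK hl companion_jordan_lshift opprK.
Qed.

Lemma companion_is_signature : is_signature (companion n a) m.
Proof.
apply: (is_signature_roots hm (companion_eigenvalues n0 a0 xinj xroot)) => i.
  by rewrite xl companion_jordan_lshift lnK ?posrE.
rewrite companion_jordan_lshift expRN lnK ?posrE//.
have -> : rev_ord (lshift n i) = rshift n (rev_ord i).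
  by apply/val_inj => /=; have := ltn_ord i; lia.
by rewrite xr rev_ordK invfM m_inv.
Qed.

Lemma companion_signature : signature (companion n a) = m.
Proof.
apply: signatureE companion_is_signature => [i|i j /=].
  by rewrite companion_jordan_lshift ln_gt0.
rewrite !companion_jordan_lshift => /ln_inj e; apply/val_inj.
have {}e : y i = y j by apply: e; rewrite posrE.
case: (ltngtP i j) => // /ydec; by rewrite e ltxx.
Qed.

Lemma companion_in_SpZ : SpZ (companion n a).
Proof. apply: (companion_SpZ n0 a0 xinj xroot). by move=> k; have := aint k. Qed.

Lemma companion_charE : char_poly (companion n a) = recip_poly n a.
Proof. exact: (companion_char_poly n0 a0 xinj xroot). Qed.

End CompanionSpectrum.

(** * Location of the roots of reciprocal polynomials *)

Section RootLocation.
Variables (R : realType) (n : nat) (w : nat -> R) (kappa : R).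
Hypotheses (k0 : 0 < kappa)
  (wgap : forall k l, (k < l < n + n)%N -> w l + kappa <= w k)
  (wrev : forall k, (k < n + n)%N -> w ((n + n).-1 - k)%N = - w k).

Definition psum (j : nat) : R := \sum_(l < j) w l.

Lemma psumS j : psum j.+1 = psum j + w j.
Proof. by rewrite /psum big_ord_recr. Qed.

(** Opposite terms of the sequence cancel. *)
Lemma psum_rev j : (j <= n + n)%N -> psum (n + n - j) = psum j.
Proof.
have h i : (i <= n + n)%N -> psum (n + n) = psum (n + n - i) - psum i.
  elim: i => [|i IH] hi; first by rewrite subn0 /psum [X in _ - X]big_ord0 subr0.
  rewrite IH; last exact: ltnW.
  rewrite (_ : n + n - i = (n + n - i.+1).+1)%N; last lia.
  rewrite !psumS (_ : n + n - i.+1 = (n + n).-1 - i)%N; last lia.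
  by rewrite wrev//; ring.
have := h _ (leqnn _); rewrite subnn [psum 0]big_ord0 => h0 hj.
by have := h j hj; lra.
Qed.

(** The growth exponent [psum j + (2n - j) w i] of the [j]-th term of the polynomial near its
    [i]-th root is concave in [j] and is maximal at [i] and [i.+1] only. *)
Lemma psum_gap i j : (i < n + n)%N -> (j <= n + n)%N -> j != i -> j != i.+1 ->
  psum j + (n + n - j)%N%:R * w i + kappa <= psum i + (n + n - i)%N%:R * w i.
Proof.
move=> hi hj ji jSi; set f := fun j => psum j + (n + n - j)%N%:R * w i.
have fS l : (l < n + n)%N -> f l.+1 = f l + (w l - w i).
  move=> hl; rewrite /f psumS (_ : n + n - l = (n + n - l.+1).+1)%N; last lia.
  by rewrite -natr1; ring.
have lo d : (d < i)%N -> f (i - d.+1)%N + kappa <= f i.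
  elim: d => [|d IH] hd.
    have -> : f i = f (i - 1).+1 by congr f; lia.
    rewrite fS; last lia.
    by have := @wgap (i - 1)%N i ltac:(lia); lra.
  have := IH (ltnW hd); have -> : f (i - d.+1)%N = f (i - d.+2).+1 by congr f; lia.
  rewrite fS; last lia.
  have h : (i - d.+2 < i < n + n)%N by clear -hd hi; lia.
  move=> hF; apply: le_trans hF; have := wgap h; move: k0; clear; lra.
have up d : (i.+2 + d <= n + n)%N -> f (i.+2 + d)%N + kappa <= f i.
  elim: d => [|d IH] hd.
    rewrite addn0 fS; last lia.
    by rewrite fS//; have := @wgap i i.+1 ltac:(lia); lra.
  rewrite addnS fS; last lia.
  have hF := IH ltac:(lia); apply: le_trans hF.
  by have := @wgap i (i.+2 + d)%N ltac:(lia); move: k0; clear; lra.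
have [lt|ge] := ltnP j i.
  by have := lo (i - j.+1)%N ltac:(lia); rewrite (_ : i - _ = j)%N//; lia.
by have := up (j - i.+2)%N ltac:(lia); rewrite (_ : i.+2 + _ = j)%N//; lia.
Qed.

Variables (eta T : R) (mm c : nat -> R).
Hypotheses (eta0 : 0 < eta) (eta1 : eta <= 1) (T0 : 0 <= T)
  (hmm : forall j, mm j = 1 \/ mm j = - 1) (c0 : c 0%N = 1).
Let delta : R := (expR eta - 1) / 2.
Hypothesis hc : forall k, (k <= n)%N ->
  expR (T * psum k) <= c k <= (1 + delta) * expR (T * psum k).

(** The signs of the elementary symmetric functions of numbers of decreasing modulus
    with the signs [mm]. *)
Definition sgn_prod (k : nat) : R := \prod_(j < k) - mm j.
Definition sgn_coef (k : nat) : R := sgn_prod k * c k.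

Let err : R := (n + n.+1)%:R * ((1 + delta) * expR (n + n)%:R * expR (- (kappa * T))).
Hypothesis err_lt : err < delta * expR (- (n + n)%:R).

Let delta0 : 0 < delta.
Proof. by rewrite /delta divr_gt0// subr_gt0 expR_gt1. Qed.

Let he : expR eta = 1 + 2 * delta.
Proof. by rewrite /delta mulrC divfK ?pnatr_eq0// addrC subrK. Qed.

Let sign_from_main (p q e : R) : - e <= p - q -> e <= q -> 0 <= p.
Proof. lra. Qed.

Let neg_from_main (p q e : R) : p - q <= e -> e <= - q -> p <= 0.
Proof. lra. Qed.

Let D (i : nat) : R := expR (T * (psum i + (n + n - i)%N%:R * w i)).

Let mm2 j : mm j * mm j = 1.
Proof. by case: (hmm j) => ->; rewrite ?mulrNN mul1r. Qed.

Let mm_norm j : `|mm j| = 1.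
Proof. by case: (hmm j) => ->; rewrite ?normrN normr1. Qed.

Let sgn_norm k : `|sgn_prod k| = 1.
Proof.
rewrite /sgn_prod normr_prod big1// => j _; by rewrite normrN mm_norm.
Qed.

Let term (y : R) (i j : nat) := sgn_coef (minn j (n + n - j)) * (mm i * y) ^+ (n + n - j).

Let term_bound i j (s : R) : (i < n)%N -> (j <= n + n)%N -> j != i -> j != i.+1 -> `|s| <= 1 ->
  `|term (expR (T * w i + s)) i j| <=
    (1 + delta) * expR (n + n)%:R * expR (- (kappa * T)) * D i.
Proof.
move=> hi hj ji jSi hs.
have hm : (minn j (n + n - j) <= n)%N by lia.
have pm : psum (minn j (n + n - j)) = psum j.
  by rewrite /minn; case: ifP => // _; rewrite psum_rev.
have /andP[c1 c2] := hc hm.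
have cp : 0 <= c (minn j (n + n - j)) by apply: le_trans c1; apply: expR_ge0.
rewrite /term /sgn_coef !normrM sgn_norm mul1r (ger0_norm cp) normrX normrM mm_norm mul1r.
rewrite (ger0_norm (expR_ge0 _)) -expRM_natl pm in c1 c2 *.
apply: le_trans (ler_wpM2r (expR_ge0 _) c2) _.
rewrite -!mulrA; apply: ler_wpM2l; first by rewrite addr_ge0// ltW.
rewrite -!expRD ler_expR /D.
have gap := psum_gap (ltn_addr n hi) hj ji jSi.
have h1 : (n + n - j)%N%:R * s <= (n + n)%:R :> R.
  apply: (@le_trans _ _ ((n + n - j)%N%:R * 1)).
    by apply: ler_wpM2l => //; apply: le_trans hs; apply: ler_norm.
  by rewrite mulr1 ler_nat leq_subr.
have hT := ler_wpM2l T0 gap.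
have -> : T * psum j + (n + n - j)%N%:R * (T * w i + s) =
    T * (psum j + (n + n - j)%N%:R * w i + kappa) + (n + n - j)%N%:R * s - kappa * T by ring.
have -> : (n + n)%:R + (- (kappa * T) + T * (psum i + (n + n - i)%N%:R * w i)) =
    T * (psum i + (n + n - i)%N%:R * w i) + (n + n)%:R - kappa * T by ring.
by rewrite lerD2r lerD.
Qed.

Let hornerE_term (y : R) i : (recip_poly n sgn_coef).[mm i * y] = \sum_(j < n + n.+1) term y i j.
Proof.
rewrite horner_poly (reindex_inj rev_ord_inj) /=; apply: eq_bigr => j _; rewrite /term.
by have := ltn_ord j => hj; congr (sgn_coef _ * _ ^+ _); lia.
Qed.

Let main_close i (s y : R) : (i < n)%N -> `|s| <= 1 -> y = expR (T * w i + s) ->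
  `|(recip_poly n sgn_coef).[mm i * y] - (term y i i + term y i i.+1)| <= err * D i.
Proof.
move=> hi hs yE; rewrite hornerE_term.
have h1 : (i < n + n.+1)%N by lia.
have h2 : (i.+1 < n + n.+1)%N by lia.
rewrite (bigD1 (Ordinal h1))//= (bigD1 (Ordinal h2))/=; last by rewrite -val_eqE /=; lia.
set S := \sum_(j < _ | _) _; rewrite (_ : _ - _ = S); last ring.
apply: le_trans (ler_norm_sum _ _ _) _.
set B := (1 + delta) * expR (n + n)%:R * expR (- (kappa * T)) * D i.
have B0 : 0 <= B by rewrite !mulr_ge0 ?expR_ge0// addr_ge0// ltW.
apply: (@le_trans _ _ (\sum_(j < n + n.+1) B)).
  rewrite big_mkcond /=; apply: ler_sum => j _; case: ifP => // /andP[ji jSi].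
  rewrite -!val_eqE /= in ji jSi; rewrite yE; apply: term_bound => //.
  by have := ltn_ord j; lia.
by rewrite sumr_const card_ord -mulr_natl /err /B !mulrA.
Qed.

Let tau i : R := sgn_prod i * mm i ^+ (n + n - i).

Let tau2 i : tau i * tau i = 1.
Proof.
have h : `|tau i| = 1 by rewrite /tau normrM sgn_norm normrX mm_norm expr1n mul1r.
by rewrite -[LHS]real_normK ?num_real// h expr1n.
Qed.

Let tau_main (y : R) i : (i < n)%N ->
  tau i * (term y i i + term y i i.+1) = y ^+ (n + n - i.+1) * (c i * y - c i.+1).
Proof.
move=> hi; rewrite /term (minn_idPl _); last lia.
rewrite (minn_idPl _); last lia.
have e : (n + n - i = (n + n - i.+1).+1)%N by lia.
have s2 : sgn_prod i * sgn_prod i = 1.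
  by rewrite -[LHS]real_normK ?num_real// sgn_norm expr1n.
rewrite /tau /sgn_coef (_ : sgn_prod i.+1 = - (sgn_prod i * mm i)); last first.
  by rewrite /sgn_prod big_ord_recr /= mulrN.
rewrite e !exprMn !exprS; set M := mm i ^+ _; set Y := y ^+ _.
have M2 : M * M = 1 by rewrite -exprMn mm2 expr1n.
transitivity ((sgn_prod i * sgn_prod i) * (mm i * mm i) * (M * M) * (Y * (c i * y - c i.+1))).
  ring.
by rewrite s2 mm2 M2 !mul1r.
Qed.

(** Near [mm i * e^(T w_i)] the polynomial is, up to a sign [tau i] and a power of [y],
    [c i * y - c i.+1] plus a relatively small error. With [c] equal to [e^(T psum)] up to
    a factor [1 + delta], where [e^eta = 1 + 2 * delta], it changes sign between
    [e^(T w_i - eta)] and [e^(T w_i + eta)]. *)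
Lemma root_near i : (i < n)%N -> exists2 y : R,
  expR (T * w i - eta) <= y <= expR (T * w i + eta) & root (recip_poly n sgn_coef) (mm i * y).
Proof.
move=> hi; pose p := tau i *: (recip_poly n sgn_coef \Po (mm i *: 'X)).
have pE y : p.[y] = tau i * (recip_poly n sgn_coef).[mm i * y].
  by rewrite /p hornerZ horner_comp !hornerE.
have D0 : 0 < D i by apply: expR_gt0.
have close s y : `|s| <= 1 -> y = expR (T * w i + s) ->
    `|p.[y] - y ^+ (n + n - i.+1) * (c i * y - c i.+1)| <= err * D i.
  move=> hs yE; rewrite pE -(tau_main _ hi) -mulrBr normrM.
  have -> : `|tau i| = 1 by rewrite /tau normrM sgn_norm normrX mm_norm expr1n mul1r.
  by rewrite mul1r; apply: main_close hs yE.
have /andP[ci1 ci2] := hc (ltnW hi).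
have /andP[cS1 cS2] := hc hi.
rewrite psumS mulrDr expRD in cS1 cS2.
have e : (n + n - i = (n + n - i.+1).+1)%N by move: hi; clear; lia.
have Dsplit s : expR (T * w i + s) ^+ (n + n - i.+1) * expR (T * psum i) * expR (T * w i) =
    expR ((n + n - i.+1)%N%:R * s) * D i.
  by rewrite -expRM_natl -!expRD e -natr1; congr expR; ring.
set X := expR (T * psum i) in ci1 ci2 cS1 cS2 Dsplit; set Y := expR (T * w i) in cS1 cS2 Dsplit.
have X0 : 0 < X by apply: expR_gt0.
have Y0 : 0 < Y by apply: expR_gt0.
have XY0 : 0 < X * Y by apply: mulr_gt0.
have err_up : err * D i <= delta * D i.
  apply: ler_wpM2r; first exact: ltW.
  apply: le_trans (ltW err_lt) _; rewrite ger_pMr// expR_le1 oppr_le0.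
(* At the right end [c i * y] is at least [e^eta / (1 + delta)] times [c i.+1]. *)
have up : 0 <= p.[expR (T * w i + eta)].
  have hs : `|eta| <= 1 by rewrite gtr0_norm.
  have := close _ _ hs (erefl _).
  rewrite ler_norml => /andP[h _]; apply: (sign_from_main h) => //.
  apply: le_trans err_up _.
  apply: (@le_trans _ _ (expR (T * w i + eta) ^+ (n + n - i.+1) * (delta * (X * Y)))).
    rewrite mulrCA [_ * (X * Y)]mulrA Dsplit ler_pM2l// ler_peMl//; first exact: ltW.
    by rewrite -expR0 ler_expR mulr_ge0// ltW.
  apply: ler_wpM2l; first by rewrite exprn_ge0// expR_ge0.
  have h1 : X * (Y * expR eta) <= c i * expR (T * w i + eta).
    by rewrite expRD -/Y ler_wpM2r// mulr_ge0 ?expR_ge0// ltW.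
  move: h1; rewrite he => h1.
  rewrite lerBrDl; apply: le_trans h1; apply: le_trans (lerD cS2 (lexx _)) _.
  by rewrite le_eqVlt; apply/orP; left; apply/eqP; ring.
have lo : p.[expR (T * w i - eta)] <= 0.
  have hs : `|- eta| <= 1 by rewrite normrN gtr0_norm.
  have := close _ _ hs (erefl _).
  rewrite ler_norml => /andP[_ h]; apply: (neg_from_main h) => //.
  apply: (@le_trans _ _ (expR (T * w i - eta) ^+ (n + n - i.+1) * (delta * expR (- eta) * (X * Y)))).
    rewrite mulrCA [_ * (X * Y)]mulrA Dsplit mulrA; apply: ler_wpM2r; first exact: ltW.
    apply: le_trans (ltW err_lt) _; rewrite -[leRHS]mulrA -expRD.
    apply: ler_wpM2l; first exact: ltW.
    rewrite ler_expR.
    have -> : - eta + (n + n - i.+1)%N%:R * - eta = - ((n + n - i)%N%:R * eta).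
      by rewrite e -natr1; ring.
    rewrite lerN2; apply: (@le_trans _ _ ((n + n - i)%N%:R * 1)).
      by apply: ler_wpM2l.
    by rewrite mulr1 ler_nat leq_subr.
  rewrite -mulrN; apply: ler_wpM2l; first by rewrite exprn_ge0// expR_ge0.
  have h1 : c i * expR (T * w i - eta) <= (1 + delta) * X * (Y * expR (- eta)).
    by rewrite expRD -/Y ler_wpM2r// mulr_ge0 ?expR_ge0// ltW.
  rewrite opprB lerBrDr; apply: le_trans cS1; apply: le_trans (lerD (lexx _) h1) _.
  have he' : (1 + 2 * delta) * expR (- eta) = 1 by rewrite -he -expRD subrr expR0.
  rewrite le_eqVlt; apply/orP; left; apply/eqP.
  transitivity (X * Y * ((1 + 2 * delta) * expR (- eta))); first ring.
  by rewrite he' mulr1.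
have ab : expR (T * w i - eta) <= expR (T * w i + eta).
  by rewrite ler_expR lerD2l; apply: le_trans (ltW eta0); rewrite oppr_le0 ltW.
have [|y hy /rootP] := @poly_ivt _ p _ _ ab.
  by rewrite lo up.
rewrite pE => /eqP hy0; exists y => //; apply/rootP/eqP; move: hy0.
by rewrite mulf_eq0 => /orP[/eqP h|//]; have := tau2 i; rewrite h mulr0 => /esym/eqP; rewrite oner_eq0.
Qed.

Variable m : 'rV[R]_n.
Hypotheses (n0 : (0 < n)%N) (hm : is_sign_vector m) (mmE : forall i : 'I_n, mm i = m 0 i)
  (T2 : 2 < kappa * T) (cint : forall k, c k \is a Num.int).

Let w_pos i : (i < n)%N -> kappa <= w i + w i.
Proof.
move=> hi; have h1 : (i < (n + n).-1 - i < n + n)%N by lia.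
by have := wgap h1; rewrite wrev; [lra|lia].
Qed.

Let sgn_coef0 : sgn_coef 0 = 1.
Proof. by rewrite /sgn_coef /sgn_prod big_ord0 c0 mul1r. Qed.

Let sgn_coef_int k : sgn_coef k \is a Num.int.
Proof.
rewrite /sgn_coef rpredM// rpred_prod// => j _.
by case: (hmm j) => ->; rewrite !rpredN ?rpred1.
Qed.

Lemma companion_near : let g := companion n sgn_coef in
  [/\ SpZ g, forall k : 'I_(n + n), `|jordan g 0 k - T * w k| <= eta,
      is_signature g m, signature g = m & char_poly g = recip_poly n sgn_coef].
Proof.
move=> g.
have ex (i : 'I_n) : exists y : R, (expR (T * w i - eta) <= y <= expR (T * w i + eta)) /\
    root (recip_poly n sgn_coef) (m 0 i * y).
  by have [y h1 h2] := root_near (ltn_ord i); exists y; rewrite -mmE.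
have [y hy] := choice ex.
have y1 i : 1 < y i.
  have [/andP[h _] _] := hy i; apply: lt_le_trans h; rewrite expR_gt1.
  have := ler_wpM2r T0 (w_pos (ltn_ord i)); move: T2 eta1.
  set A := kappa * T; rewrite mulrDl [w i * T]mulrC; lra.
have ydec (i j : 'I_n) : (i < j)%N -> y j < y i.
  move=> ij; have [/andP[h _] _] := hy i; have [/andP[_ h'] _] := hy j.
  apply: le_lt_trans h' _; apply: lt_le_trans h; rewrite ltr_expR.
  have hj : (i < j < n + n)%N by rewrite ij ltn_addr.
  have := ler_wpM2r T0 (wgap hj); move: T2 eta1.
  set A := kappa * T; rewrite mulrDl -/A [w j * T]mulrC [w i * T]mulrC; lra.
have yroot i : root (recip_poly n sgn_coef) (m 0 i * y i) by case: (hy i).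
have jl (i : 'I_n) : `|jordan g 0 (lshift n i) - T * w i| <= eta.
  rewrite (companion_jordan_lshift n0 sgn_coef0 hm y1 ydec yroot).
  have [/andP[h h'] _] := hy i; have y0 : 0 < y i by apply: lt_trans (y1 i).
  rewrite ler_distl; apply/andP; split.
    by rewrite -ler_expR lnK ?posrE.
  by rewrite -ler_expR lnK ?posrE.
split.
- exact: (companion_in_SpZ n0 sgn_coef0 sgn_coef_int hm y1 ydec yroot).
- move=> k; case: (split_ordP k) => i ->; first exact: jl.
  have -> : rshift n i = rev_ord (lshift n (rev_ord i)).
    by apply/val_inj => /=; have := ltn_ord i; lia.
  rewrite (companion_jordan_rev n0 sgn_coef0 hm y1 ydec yroot).
  have -> : w (rev_ord (lshift n (rev_ord i))) = - w (rev_ord i).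
    rewrite /= (_ : (n + n - (n - i.+1).+1 = (n + n).-1 - (n - i.+1))%N) ?wrev//.
      by have := ltn_ord i; lia.
    by have := ltn_ord i; lia.
  by rewrite mulrN -opprD normrN; apply: jl.
- exact: (companion_is_signature n0 sgn_coef0 hm y1 ydec yroot).
- exact: (companion_signature n0 sgn_coef0 hm y1 ydec yroot).
- exact: (companion_charE n0 sgn_coef0 hm y1 ydec yroot).
Qed.

End RootLocation.

(** * A large family of companion matrices *)

Lemma round_up_bounds (R : realType) (d x s u : R) : u <= x -> x < u + 1 ->
  s <= d * x / 2 -> 0 <= s -> 4 <= d * x -> x <= u + 1 + s <= (1 + d) * x.
Proof. move=> h1 h2 h3 h4 h5; apply/andP; split; lra. Qed.

Lemma round_down_bound (R : realType) (d x u : R) : d * x / 2 < u + 1 -> 4 <= d * x ->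
  d / 4 * x <= u.
Proof. lra. Qed.

Section CompanionFamily.
Variables (R : realType) (n : nat) (w : nat -> R) (kappa : R).
Hypotheses (n0 : (0 < n)%N) (k0 : 0 < kappa)
  (wgap : forall k l, (k < l < n + n)%N -> w l + kappa <= w k)
  (wrev : forall k, (k < n + n)%N -> w ((n + n).-1 - k)%N = - w k).

Let w_pos i : (i < n)%N -> kappa / 2 <= w i.
Proof.
move=> hi; have h1 : (i < (n + n).-1 - i < n + n)%N by lia.
by have := wgap h1; rewrite wrev; [lra|lia].
Qed.

Let psum_ge k : (k < n)%N -> kappa / 2 <= psum w k.+1.
Proof.
move=> hk; rewrite /psum big_ord_recl /= -[kappa / 2]addr0; apply: lerD; first exact: w_pos.
apply: sumr_ge0 => l _; apply: le_trans (w_pos _); first by rewrite divr_ge0// ltW.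
by rewrite /bump /=; have := ltn_ord l; lia.
Qed.

(** Each [c_k] ranges independently over a fixed multiple of [e^(T psum k)] integers, and
    distinct choices give distinct polynomials. *)
Lemma companion_family (m : 'rV[R]_n) (eta : R) : is_sign_vector m -> 0 < eta -> eta <= 1 ->
  exists2 C : R, 0 < C & exists T1 : R, forall T, T1 <= T ->
  exists (F : finType) (h : F -> 'M[R]_(n + n)),
    C * expR (T * \sum_(k < n) psum w k.+1) <= #|F|%:R /\
    [/\ forall t, SpZ (h t), forall t (k : 'I_(n + n)), `|jordan (h t) 0 k - T * w k| <= eta,
      forall t, is_signature (h t) m, forall t, signature (h t) = m &
      injective (fun t => char_poly (h t))].
Proof.
move=> hm eta0 eta1.
pose delta : R := (expR eta - 1) / 2.
have delta0 : 0 < delta by rewrite /delta divr_gt0// subr_gt0 expR_gt1.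
pose K : R := (n + n.+1)%:R * ((1 + delta) * expR (n + n)%:R).
pose d' : R := delta * expR (- (n + n)%:R).
have d'0 : 0 < d' by rewrite mulr_gt0// expR_gt0.
have K0 : 0 <= K by rewrite !mulr_ge0 ?expR_ge0// addr_ge0// ltW.
exists ((delta / 4) ^+ n); first by rewrite exprn_gt0// divr_gt0.
exists ((3 + 8 / delta + K / d') / kappa) => T hT.
have h8 : 0 <= 8 / delta by rewrite divr_ge0// ltW.
have hK : 0 <= K / d' by rewrite divr_ge0// ltW.
have kT : 3 + 8 / delta + K / d' <= kappa * T by rewrite [leRHS]mulrC -ler_pdivrMr.
have T0 : 0 <= T by apply: le_trans hT; rewrite divr_ge0// ?(ltW k0)// !addr_ge0.
have T2 : 2 < kappa * T by move: kT h8 hK; clear; move: (8 / delta) (K / d') => *; lra.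
have err_lt : (n + n.+1)%:R * ((1 + delta) * expR (n + n)%:R * expR (- (kappa * T))) < d'.
  rewrite mulrA -/K expRN -ltr_pdivlMr ?invr_gt0 ?expR_gt0// invrK.
  rewrite [ltRHS]mulrC -ltr_pdivrMr//; apply: lt_le_trans (expR_ge1Dx _).
  by move: kT h8; clear; move: (8 / delta) (K / d') => *; lra.
pose X k := expR (T * psum w k).
have X0 k : 0 < X k by apply: expR_gt0.
have Xbig k : (k < n)%N -> 4 <= delta * X k.+1.
  move=> hk; rewrite [leRHS]mulrC -ler_pdivrMr//.
  apply: (@le_trans _ _ (1 + T * (kappa / 2))); last first.
    apply: le_trans (expR_ge1Dx _) _; rewrite ler_expR.
    by apply: ler_wpM2l => //; apply: psum_ge.
  have -> : 4 / delta = (8 / delta) / 2 by field; rewrite gt_eqF.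
  have -> : T * (kappa / 2) = (kappa * T) / 2 by ring.
  by move: kT hK; clear; move: (8 / delta) (K / d') (kappa * T) => *; lra.
(* [c_k] runs over the first [b k] integers above [X k]; half of the tolerance absorbs the
   rounding, and [T] is so large that [b k] is at least a fixed proportion of [X k]. *)
pose b k := Num.truncn (delta * X k / 2).
pose F : finType := {dffun forall k : 'I_n, 'I_(b k.+1)}.
pose cN (t : F) (k : nat) : nat := if k is k'.+1 then
  (if (insub k' : option 'I_n) is Some i then ((Num.truncn (X i.+1)).+1 + t i)%N else 1%N) else 1%N.
pose mm (j : nat) : R := if (insub j : option 'I_n) is Some i then m 0 i else 1.
have mmE (i : 'I_n) : mm i = m 0 i by rewrite /mm valK.
have hmm j : mm j = 1 \/ mm j = -1 by rewrite /mm; case: insub => [i|]; [exact: hm|left].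
pose c t k : R := (cN t k)%:R.
have hc t k : (k <= n)%N -> X k <= c t k <= (1 + delta) * X k.
  case: k => [|k] hk.
    rewrite /c /cN /X /psum big_ord0 mulr0 expR0 mulr1 lexx lerDl; exact: ltW.
  rewrite /c /cN; case: insubP => [i _ ik|]; last by rewrite hk.
  have := Xbig _ hk; rewrite -ik; move: (t i) => s h4.
  have /andP[x1 x2] := Num.Theory.truncn_itv (ltW (X0 i.+1)).
  have hd : 0 <= delta * X i.+1 / 2 by rewrite divr_ge0// mulr_ge0// ltW.
  have /andP[z1 z2] := Num.Theory.truncn_itv hd.
  have s1 : (s : nat)%:R <= delta * X i.+1 / 2.
    by apply: le_trans z1; rewrite ler_nat ltnW// -/(b i.+1) ltn_ord.
  have s0 : 0 <= (s : nat)%:R :> R by rewrite ler0n.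
  by rewrite natrD -natr1; rewrite -natr1 in x2; apply: round_up_bounds x1 x2 s1 s0 h4.
exists F, (fun t => companion n (sgn_coef mm (c t))); split.
  rewrite card_dep_ffun foldrE big_image /= mulr_sumr expR_sum.
  have -> : (delta / 4) ^+ n = \prod_(k < n) (delta / 4) by rewrite prodr_const card_ord.
  rewrite -big_split /= natr_prod; apply: ler_prod => k _.
  apply/andP; split.
    apply: mulr_ge0; last exact: expR_ge0.
    by apply: divr_ge0 => //; apply: ltW.
  rewrite (_ : #|_| = b k.+1); last exact: card_ord.
  have hd : 0 <= delta * X k.+1 / 2 by rewrite divr_ge0// mulr_ge0// ltW.
  have /andP[_ z2] := Num.Theory.truncn_itv hd.
  by move: z2; rewrite -[ltRHS]natr1 => z2; apply: round_down_bound z2 (Xbig _ (ltn_ord k)).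
have c_int t k : c t k \is a Num.int by rewrite /c Num.Theory.intr_nat.
have near t := companion_near k0 wgap wrev eta0 eta1 T0 hmm (erefl _ : c t 0%N = 1)
  (hc t) err_lt n0 hm mmE T2 (c_int t).
split.
- by move=> t; case: (near t).
- by move=> t; case: (near t).
- by move=> t; case: (near t).
- by move=> t; case: (near t).
move=> t t'; have [_ _ _ _ ->] := near t; have [_ _ _ _ ->] := near t' => e.
apply/ffunP => k; apply/val_inj.
have := congr1 (fun p : {poly R} => p`_k.+1) e; rewrite !recip_coef// /sgn_coef.
have nz : sgn_prod mm k.+1 != 0.
  apply/prodf_neq0 => j _; rewrite oppr_eq0; case: (hmm j) => ->; rewrite ?oppr_eq0 oner_eq0//.
move/(mulfI nz)/eqP; rewrite /c eqr_nat /cN.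
have -> : insub (k : nat) = Some k by rewrite valK.
by rewrite eqn_add2l => /eqP.
Qed.

End CompanionFamily.

(** * Equivalence of norms *)

Section NormEquivalence.
Local Open Scope classical_set_scope.
Variables (R : realType) (n : nat) (N : 'rV[R]_(n + n) -> R).
Hypotheses (n0 : (0 < n)%N) (hN : is_norm N).

Let i0 : (0 < n + n)%N. Proof. lia. Qed.

Lemma norm_ge0 x : 0 <= N x.
Proof.
have [N1 N2 _] := hN.
have h0 : N 0 = 0 by rewrite -(scale0r (0 : 'rV[R]_(n + n))) N2 normr0 mul0r.
have := N1 x (- x); rewrite subrr h0 -scaleN1r N2 normrN normr1 mul1r; lra.
Qed.

Lemma norm_le_max : exists2 C : R, 0 < C & forall (x : 'rV[R]_(n + n)) (c : R),
  (forall k, `|x 0 k| <= c) -> N x <= C * c.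
Proof.
have [N1 N2 _] := hN.
have h0 : N 0 = 0 by rewrite -(scale0r (0 : 'rV[R]_(n + n))) N2 normr0 mul0r.
exists (1 + \sum_k N (delta_mx 0 k)).
  by apply: ltr_pwDl => //; apply: sumr_ge0 => k _; apply: norm_ge0.
move=> x c hx.
have S (J : seq 'I_(n + n)) : N (\sum_(k <- J) x 0 k *: delta_mx 0 k) <=
    \sum_(k <- J) `|x 0 k| * N (delta_mx 0 k).
  elim: J => [|k J IH]; first by rewrite !big_nil h0.
  by rewrite !big_cons; apply: le_trans (N1 _ _) _; rewrite N2 lerD2l.
rewrite {1}[x]row_sum_delta; apply: le_trans (S _) _.
have c0 : 0 <= c by apply: le_trans (hx (Ordinal i0)).
rewrite mulrDl mul1r -[X in X <= _]add0r lerD// mulr_suml; apply: ler_sum => l _.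
by rewrite mulrC ler_wpM2l// norm_ge0.
Qed.

(** The norm is Lipschitz for the sup norm, so it has a positive minimum on the compact
    sup norm unit sphere. *)
Lemma norm_ge_max : exists2 K : R, 0 < K & forall (x : 'rV[R]_(n + n)) k, `|x 0 k| <= K * N x.
Proof.
have [N1 N2 N3] := hN; have [C C0 hC] := norm_le_max.
pose A := [set x : 'rV[R]_(n + n) | `|x| = 1].
have coord (x : 'rV[R]_(n + n)) k : `|x 0 k| <= `|x|.
  by rewrite [leRHS]/Num.norm /= mx_normrE; apply/bigmax_geP; right => /=; exists (0, k).
have nz (x : 'rV[R]_(n + n)) : x != 0 -> A (`|x|^-1 *: x).
  by move=> x0; rewrite /A /= normrZ ger0_norm ?invr_ge0// mulVf// normr_eq0.
have A0 : A !=set0.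
  exists (`|const_mx 1 : 'rV[R]_(n + n)|^-1 *: const_mx 1); apply: nz.
  apply/eqP => /rowP/(_ (Ordinal i0)); rewrite !mxE => /eqP; rewrite oner_eq0//.
have cA : compact A.
  apply: bounded_closed_compact.
    exists 1; split => // M M1 x /= ->; exact: ltW.
  have -> : A = (fun x : 'rV[R]_(n + n) => `|x|) @^-1` [set 1] by [].
  apply: closed_comp; last exact: closed_eq.
  by move=> x _; apply: norm_continuous.
have lip x y : `|N x - N y| <= C * `|x - y|.
  have h u v : N u - N v <= C * `|u - v|.
    apply: le_trans (hC _ _ (coord (u - v))).
    by rewrite lerBlDr; have := N1 (u - v) v; rewrite subrK.
  by rewrite ler_norml h lerNl opprB -[`|x - y|]normrN opprB h.
have cN : continuous N.
  move=> x; apply/(@cvgrPdist_le _ _ _ _ (nbhs_filter x)) => e e0.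
  apply/nbhs_ballP; exists (e / C); first by rewrite /= divr_gt0.
  move=> y; rewrite -ball_normE /= => /ltW h; apply: le_trans (lip x y) _.
  by rewrite mulrC -ler_pdivlMr.
have [x0 hx0 hmin] := EVT_min_rV A0 cA (continuous_subspaceT cN).
have Nx0 : 0 < N x0.
  rewrite lt_neqAle norm_ge0 andbT; apply/eqP => /esym/N3 e.
  by move: hx0; rewrite e inE /A /= normr0 => /eqP; rewrite eq_sym oner_eq0.
exists (N x0)^-1; first by rewrite invr_gt0.
move=> x k; have [->|xn0] := eqVneq x 0.
  by rewrite mxE normr0 mulr_ge0 ?norm_ge0// invr_ge0 ltW.
apply: le_trans (coord x k) _; rewrite mulrC ler_pdivlMr// mulrC.
have := hmin (`|x|^-1 *: x); rewrite inE => /(_ (nz _ xn0)).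
by rewrite N2 ger0_norm ?invr_ge0// => h; rewrite -ler_pdivlMr ?normr_gt0// [leRHS]mulrC.
Qed.

End NormEquivalence.

(** * Vectors in the Weyl chamber *)

Section WeylChamber.
Variables (R : realType) (n : nat) (v : 'rV[R]_(n + n)).
Hypothesis hv : int_weyl_chamber v.

Lemma weyl_rev k : v 0 (rev_ord k) = - v 0 k.
Proof.
have [u _ <-] := hv; case: (split_ordP k) => i ->.
- have -> : rev_ord (lshift n i) = rshift n (rev_ord i).
    by apply/val_inj => /=; have := ltn_ord i; lia.
  by rewrite row_mxEl row_mxEr mxE rev_ordK.
- have -> : rev_ord (rshift n i) = lshift n (rev_ord i).
    by apply/val_inj => /=; have := ltn_ord i; lia.
  by rewrite row_mxEl row_mxEr mxE opprK.
Qed.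

Lemma weyl_lt (k l : 'I_(n + n)) : (k < l)%N -> v 0 l < v 0 k.
Proof.
have [u [udec upos] <-] := hv; case: (split_ordP k) => i ->; case: (split_ordP l) => j ->;
  rewrite ?row_mxEl ?row_mxEr ?mxE /=.
- exact: udec.
- by move=> _; apply: lt_trans (upos i); rewrite oppr_lt0.
- by have := ltn_ord j; move=> h1 h2; exfalso; lia.
- by rewrite ltn_add2l ltrN2 => ij; apply: udec => /=; have := ltn_ord j; lia.
Qed.

Lemma weyl_gap : exists2 kappa : R, 0 < kappa &
  forall k l : 'I_(n + n), (k < l)%N -> v 0 l + kappa <= v 0 k.
Proof.
exists (\big[Num.min/1]_(p : 'I_(n + n) * 'I_(n + n) | (p.1 < p.2)%N) (v 0 p.1 - v 0 p.2)).
  by apply/bigmin_gtP; split => // p /weyl_lt; rewrite subr_gt0.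
move=> k l kl; rewrite addrC -lerBrDr.
exact: (@bigmin_le_cond _ _ _ 1 (k, l) (fun p => (p.1 < p.2)%N) (fun p => v 0 p.1 - v 0 p.2)).
Qed.

Lemma expR_rho T : \prod_(i < n) nat_ext (fun k => expR (T * v 0 k)) i ^+ (n - i) = expR (rho v * T).
Proof.
rewrite /rho mulr_suml expR_sum; apply: eq_bigr => i _.
rewrite (_ : nat_ext _ i = expR (T * v 0 (lshift n i))); last exact: (nat_ext_ord _ (lshift n i)).
by rewrite -expRM_natl; congr expR; ring.
Qed.

(** The weight of the covering is the square of [expR (rho v * T)]: this is where the
    factor 2 in the bound for classes comes from. *)
Lemma weight_rho T : weight n (fun k => expR (T * v 0 k)) = expR (2 * rho v * T).
Proof.
rewrite /weight subnn big_mkcond big_split_ord /= [X in _ * X]big1 ?mulr1; last first.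
  by move=> i _; rewrite ifF//; lia.
rewrite /rho mulr_sumr mulr_suml expR_sum; apply: eq_bigr => i _.
by rewrite ltn_ord -expRM_natl natrM; congr expR; ring.
Qed.

(** Exchanging the order of summation, the coordinate of index [i] occurs in the last
    [n - i] partial sums. *)
Lemma psum_rho T : expR (T * \sum_(k < n) psum (nat_ext (fun k => v 0 k)) k.+1) = expR (rho v * T).
Proof.
rewrite -expR_rho -prod_prod_lt mulr_sumr expR_sum; apply: eq_bigr => k _.
rewrite /psum mulr_sumr expR_sum; apply: eq_bigr => i _.
have hi : (i < n + n)%N by have := ltn_ord i; have := ltn_ord k; lia.
by rewrite !(nat_ext_lt _ hi).
Qed.

End WeylChamber.

(** * The two estimates *)

Local Open Scope classical_set_scope.
Local Open Scope ring_scope.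

Theorem theorem1p11 (R : realType) (n : nat) (hn : (1 <= n)%N)
    (N : 'rV[R]_(n + n) -> R) (hN : is_norm N)
    (v : 'rV[R]_(n + n)) (hv : int_weyl_chamber v)
    (m : 'rV[R]_n) (hm : is_sign_vector m)
    (eps : R) (heps : 0 < eps < 1) :
  (exists c1 c2 : R, [/\ 0 < c1, 0 < c2 &
    \forall T \near +oo,
      ((c1 * expR (rho v * T))%:E
         <= counting [set (jordan g, signature g) | g in SpZ_near N v m eps T]
         <= (c2 * expR (rho v * T))%:E)%E]) /\
  (exists C1 C2 : R, [/\ 0 < C1, 0 < C2 &
    \forall T \near +oo,
      ((C1 * expR (rho v * T))%:E
         <= counting [set SpZ_class g | g in SpZ_near N v m eps T]
         <= (C2 * expR (2 * rho v * T))%:E)%E]).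
Proof.
have [eps0 _] := andP heps.
have [C C0 hC] := norm_le_max hn hN.
have [K K0 hK] := norm_ge_max hn hN.
have [kappa k0 gap] := weyl_gap hv.
pose c := K * eps; have c0 : 0 <= c by rewrite mulr_ge0// ltW.
have T00 : 0 <= 2 * c / kappa by rewrite divr_ge0// ?(ltW k0)// mulr_ge0.
have regular T g : 2 * c / kappa < T -> SpZ_near N v m eps T g ->
    near_regular g (fun k => T * v 0 k) c.
  move=> hT [_ hg _]; have T0 : 0 <= T by apply: le_trans T00 (ltW hT).
  split.
  - move=> k; have := hK (jordan g - T *: v) k; rewrite mxE [X in _ + X]mxE [X in _ - X]mxE => h.
    by apply: le_trans h _; rewrite ler_wpM2l// ltW.
  - move=> k l kl; apply: lt_le_trans (ler_wpM2l T0 (gap k l kl)).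
    by rewrite mulrDr ltrD2l -ltr_pdivrMr.
  - by move=> k; rewrite weyl_rev// mulrN.
have wrev T (k : 'I_(n + n)) : T * v 0 (rev_ord k) = - (T * v 0 k) by rewrite weyl_rev// mulrN.
have wdec T : 0 <= T -> forall k l : 'I_(n + n), (k <= l)%N -> T * v 0 l <= T * v 0 k.
  move=> T0 k l; rewrite leq_eqVlt => /orP[/eqP/val_inj ->//|kl].
  by apply: ler_wpM2l => //; apply/ltW/weyl_lt.
pose w := nat_ext (fun k => v 0 k).
have wgap k l : (k < l < n + n)%N -> w l + kappa <= w k.
  move=> /andP[kl ln]; rewrite /w (nat_ext_lt _ ln) (nat_ext_lt _ (ltn_trans kl ln)).
  exact: gap.
have wrev' k : (k < n + n)%N -> w ((n + n).-1 - k)%N = - w k.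
  move=> hk; have hk' : ((n + n).-1 - k < n + n)%N by lia.
  rewrite /w (nat_ext_lt _ hk) (nat_ext_lt _ hk') -weyl_rev//; congr (v 0 _).
  by apply/val_inj => /=; lia.
(* Jordan projections within [eta] of [T *: v] in sup norm are within [eps] in norm. *)
pose eta := Num.min 1 (eps / C).
have eta0 : 0 < eta by rewrite lt_min ltr01 divr_gt0.
have eta1 : eta <= 1 by rewrite ge_min lexx.
have [Cl Cl0 [T1 family]] := companion_family hn k0 wgap wrev' hm eta0 eta1.
have family_near T (F : finType) (h : F -> 'M[R]_(n + n)) :
    [/\ forall t, SpZ (h t), forall t (k : 'I_(n + n)), `|jordan (h t) 0 k - T * w k| <= eta,
      forall t, is_signature (h t) m, forall t, signature (h t) = m &
      injective (fun t => char_poly (h t))] -> forall t, SpZ_near N v m eps T (h t).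
  move=> [h1 h2 _ h4 _] t; split => //.
  apply: (@le_trans _ _ (C * eta)); last by rewrite mulrC -ler_pdivlMr// ge_min lexx orbT.
  apply: hC => k; rewrite mxE [X in _ + X]mxE [X in _ - X]mxE.
  by have := h2 t k; rewrite /w nat_ext_ord.
have [P P0 hP] := pair_count_le n c0; have [Q Q0 hQ] := class_count_le n c.
have main T : T1 <= T -> 2 * c / kappa < T ->
    ((Cl * expR (rho v * T))%:E
         <= counting [set (jordan g, signature g) | g in SpZ_near N v m eps T]
         <= (P * expR (rho v * T))%:E)%E /\
    ((Cl * expR (rho v * T))%:E
         <= counting [set SpZ_class g | g in SpZ_near N v m eps T]
         <= (Q * expR (2 * rho v * T))%:E)%E.
  move=> hT1 hT2; have T0 : 0 <= T by apply: le_trans T00 (ltW hT2).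
  have [F [h [hF hh]]] := family T hT1.
  have hnear := family_near T F h hh; have [h1 h2 h3 h4 h5] := hh.
  have hF' : ((Cl * expR (rho v * T))%:E <= (#|F|%:R : R)%:E)%E by rewrite lee_fin -psum_rho.
  split; apply/andP; split.
  - apply: (le_trans hF'); apply: (@counting_ge R _ _ F (fun t => (jordan (h t), signature (h t)))).
      by move=> t; exists (h t).
    move=> t t' e; apply: h5; apply: char_poly_of_pair e; rewrite h4; exact: h3.
  - rewrite -expR_rho; apply: (hP (fun k => T * v 0 k)); [exact: wrev|exact: wdec|].
    move=> _ [g hg <-]; exists g; split; [by case: hg|exact: regular|by []].
  - apply: (le_trans hF'); apply: (@counting_ge R _ _ F (fun t => SpZ_class (h t))).
      by move=> t; exists (h t).
    by move=> t t' e; apply: h5; apply: char_poly_of_class e.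
  - rewrite -weight_rho; apply: (hQ (fun k => T * v 0 k)); [exact: wrev|exact: wdec|].
    move=> _ [g hg <-]; exists g; split; [by case: hg|exact: regular|by []].
split; [exists Cl, P|exists Cl, Q]; split => //; near=> T;
  (have hT1 : T1 <= T by near: T; apply: nbhs_pinfty_ge; rewrite num_real);
  (have hT2 : 2 * c / kappa < T by near: T; apply: nbhs_pinfty_gt; rewrite num_real).
- by have [] := main T hT1 hT2.
- by have [] := main T hT1 hT2.
Unshelve. all: by end_near. Qed.
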